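(* Let $V$ be a compact complex manifold and let $\omega$ be a positive $(1,1)$-form on $V$ whose holomorphic sectional curvature is bounded from above by $-\lambda$ with $\lambda>0$, i.e. for every open subset $U\subset\mathbb C$ and every holomorphic map $g:U\to V$ one has $\mathrm{Ric}(g^*\omega)\ge\lambda\,g^*\omega$. Let $0<R\le\infty$ and let $f:\bigtriangleup(R)\to V$ be a non-constant holomorphic map with $c_{f,\omega}<\infty$. Then, for every $\epsilon>0$, the inequality $$\big(\lambda-(1+\epsilon)(c_{f,\omega}+\epsilon)\big)T_{f,\omega}(r)+N_{f,\mathrm{ram}}(r)\le O(\log T_{f,\omega}(r))+\epsilon\log r$$ holds for all $r\in(0,R)$ outside a set $E$ with $\int_E\exp((c_{f,\omega}+\epsilon)T_{f,\omega}(r))\,dr<\infty$. In particular, $c_{f,\omega}\ge\lambda$.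
   Context: $\bigtriangleup(R)=\{z\in\mathbb C:|z|<R\}$, with $\bigtriangleup(\infty)=\mathbb C$. Put $dd^c=\frac{\sqrt{-1}}{2\pi}\partial\bar\partial$. For a non-negative $(1,1)$-form $\eta=a(z)\frac{\sqrt{-1}}{2\pi}dz\wedge d\bar z$ on an open subset of $\mathbb C$, $\mathrm{Ric}(\eta):=dd^c\log a$, considered where $a>0$; the curvature condition on $g^*\omega$ is understood at points where $g'\neq0$. $T_{f,\omega}(r)=\int_0^r\frac{dt}{t}\int_{|z|<t}f^*\omega$ for $0<r<R$, and $c_{f,\omega}=\inf\{c>0:\int_0^R\exp(cT_{f,\omega}(r))\,dr=\infty\}$ ($=\infty$ if the set is empty). $N_{f,\mathrm{ram}}(r)$ is the counting function of the ramification divisor of $f$ (zeros of $f'$, with multiplicity): if $n(t)$ is the number of points of this divisor in $|z|<t$, counted with multiplicity, and $n(0)$ its multiplicity at $0$, then $N_{f,\mathrm{ram}}(r)=\int_0^r(n(t)-n(0))\frac{dt}{t}+n(0)\log r$. The term $O(\log T_{f,\omega}(r))$ means: there is a constant $C$ (independent of $r$) such that the inequality holds with this term replaced by $C\log T_{f,\omega}(r)$, for all $r\in(0,R)\setminus E$. *)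

(* Defs.v *)
From HB Require Import structures.
From mathcomp Require Import all_boot all_order all_algebra.
From mathcomp Require Import complex.
From mathcomp Require Import all_classical all_reals all_analysis.

Set Implicit Arguments.
Unset Strict Implicit.
Unset Printing Implicit Defensive.
Import Order.TTheory GRing.Theory Num.Theory.
Import numFieldNormedType.Exports.
Import ComplexField.Normc.

Local Open Scope classical_set_scope.
Local Open Scope ring_scope.
Local Open Scope complex_scope.
Local Open Scope sesquilinear_scope.

(* The topology and norm of the complex plane: those of the numeric field R[i],
   as a normed module over itself.  Hence [derivable _ z 1], [derive1],
   [differentiable] and 'J on R[i] and 'rV[R[i]]_n are complex
   differentiability and complex derivatives. *)
#[warnings="-redundant-canonical-projection"]
HB.instance Definition _ (R : realType) := NormedModule.copy R[i] R[i]^o.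

Section real_smoothness.
Variables (R : realType).

Definition real_derive (E : lmodType R[i]) (F : E -> R) (v p : E) : R :=
  derive1 (fun t : R => F (p + t%:C *: v) : R^o) 0.

(* C^k on an open set D, in the real sense: [v] ranges over all complex
   vectors, hence over all real directions of C^n = R^2n. *)
Fixpoint is_Ck (n k : nat) (D : set 'rV[R[i]]_n) (F : 'rV[R[i]]_n -> R) : Prop :=
  (forall p, D p -> {for p, continuous F}) /\
  match k with
  | 0%N => True
  | k'.+1 => forall v,
      (forall p, D p -> derivable (fun t : R => F (p + t%:C *: v) : R^o) 0 1) /\
      is_Ck k' D (real_derive F v)
  end.

Definition smooth_on (n : nat) (D : set 'rV[R[i]]_n) (F : 'rV[R[i]]_n -> R) :=
  forall k, is_Ck k D F.

End real_smoothness.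

(* A (not necessarily maximal) holomorphic atlas of dimension n.  The maps are
   total; only their restrictions to [chart_dom i], resp. to its image in C^n,
   matter.  [chart_at] selects a chart around each point. *)
Record complex_atlas (R : realType) (V : topologicalType) (n : nat) :=
  ComplexAtlas {
  chart_index : Type;
  chart_dom : chart_index -> set V;
  chart : chart_index -> V -> 'rV[R[i]]_n;
  chart_inv : chart_index -> 'rV[R[i]]_n -> V;
  chart_at : V -> chart_index;
  mem_chart_at : forall p, chart_dom (chart_at p) p;
  chart_dom_open : forall i, open (chart_dom i);
  chart_image_open : forall i, open (chart i @` chart_dom i);
  chartK : forall i p, chart_dom i p -> chart_inv i (chart i p) = p;
  chart_continuous : forall i p,
    chart_dom i p -> {for p, continuous (chart i)};
  chart_inv_continuous : forall i x,
    (chart i @` chart_dom i) x -> {for x, continuous (chart_inv i)};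
  transition_holomorphic : forall i j p, chart_dom i p -> chart_dom j p ->
    differentiable (chart j \o chart_inv i) (chart i p)
}.

Arguments chart_dom {R V n} _ _ _.
Arguments chart {R V n} _ _ _.
Arguments chart_inv {R V n} _ _ _.

(* A positive smooth (1,1)-form, given in each chart w by the matrix h with
     omega = (sqrt(-1) / 2 pi) \sum_(j, k) h_jk dw_j /\ d(conj w_k).
   Vectors are rows, so 'J acts on the right. *)
Record positive_form (R : realType) (V : topologicalType) (n : nat)
    (M : complex_atlas R V n) := PositiveForm {
  form_coef : chart_index M -> 'rV[R[i]]_n -> 'M[R[i]]_n;
  form_smooth : forall i j k,
    smooth_on (chart M i @` chart_dom M i)
      (fun x => complex.Re (form_coef i x j k)) /\
    smooth_on (chart M i @` chart_dom M i)
      (fun x => complex.Im (form_coef i x j k));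
  form_hermitian : forall i p, chart_dom M i p ->
    form_coef i (chart M i p) \is hermsymmx;
  form_positive : forall i p, chart_dom M i p -> forall v : 'rV[R[i]]_n,
    v != 0 -> 0 < (v *m form_coef i (chart M i p) *m v^t*) 0 0;
  form_compatible : forall i j p, chart_dom M i p -> chart_dom M j p ->
    let J := 'J (chart M j \o chart_inv M i) (chart M i p) in
    form_coef i (chart M i p) = J *m form_coef j (chart M j p) *m J^t*
}.

Arguments form_coef {R V n M} _ _ _.

Section plane_forms.
Variables (R : realType).
Implicit Types (a u : R[i] -> R) (F : R[i] -> R[i]) (z : R[i]).

(* A (1,1)-form a(z) (sqrt(-1) / 2 pi) dz /\ d(conj z) on an open subset of the
   plane is represented by its coefficient a. *)

Definition real_partial (v : R[i]) F z : R[i] :=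
  (real_derive (fun w => complex.Re (F w)) v z) +i*
  (real_derive (fun w => complex.Im (F w)) v z).

Definition d_z F z : R[i] :=
  (real_partial 1 F z - (0 +i* 1) * real_partial (0 +i* 1) F z) / 2.

Definition d_zbar F z : R[i] :=
  (real_partial 1 F z + (0 +i* 1) * real_partial (0 +i* 1) F z) / 2.

Definition ddc u z : R[i] := d_z (d_zbar (fun w => (u w)%:C)) z.

Definition Ric a z : R[i] := ddc (fun w => ln (a w)) z.

Definition disc (rho : \bar R) : set R[i] :=
  [set z | ((normc z)%:E < rho)%E].

(* (sqrt(-1) / 2 pi) dz /\ d(conj z) = (1 / pi) dx /\ dy *)
Definition disc_integral a (t : R) : R :=
  Rintegral (@lebesgue_measure R \x @lebesgue_measure R)%E
    [set p : R * R | normc (p.1 +i* p.2) < t]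
    (fun p => a (p.1 +i* p.2) / pi).

Definition has_zero_order (n : nat) (F : R[i] -> 'rV[R[i]]_n) z (m : nat) :=
  exists G : R[i] -> 'rV[R[i]]_n,
    [/\ \forall w \near z, derivable G w 1, G z != 0 &
        \forall w \near z, F w = (w - z) ^+ m *: G w].

Definition radii (rho : \bar R) : set R := [set r | 0 < r /\ (r%:E < rho)%E].

End plane_forms.

Section holomorphic_maps.
Variables (R : realType) (V : topologicalType) (n : nat).
Variables (M : complex_atlas R V n).
Implicit Types (f g : R[i] -> V).

(* Only the values of g on the open set U matter. *)
Definition holomorphic_on (U : set R[i]) g :=
  forall z, U z -> {for z, continuous g} /\
    forall i, chart_dom M i (g z) -> derivable (chart M i \o g) z 1.

Definition local_rep g (z : R[i]) : R[i] -> 'rV[R[i]]_n :=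
  chart M (chart_at M (g z)) \o g.

(* The multiplicity at z of the zero of f'; f' is computed in the chart at f z,
   but the order of vanishing does not depend on the chart. *)
Definition ram_mult f (z : R[i]) : nat :=
  xget 0%N [set m | has_zero_order (fun w => derive1 (local_rep f z) w) z m].

(* For t < R and f nonconstant holomorphic on the disc of radius R the support
   of [ram_mult f] in |z| < t is finite, so the sum is a genuine one. *)
Definition ram_count f (t : R) : R :=
  \sum_(z \in [set z : R[i] | normc z < t]) ((ram_mult f z)%:R : R).

Definition N_ram f (r : R) : R :=
  Rintegral (@lebesgue_measure R) `]0, r[
    (fun t => (ram_count f t - (ram_mult f 0)%:R) / t)
  + (ram_mult f 0)%:R * ln r.

Variable omega : positive_form M.

(* The coefficient of g^* omega; it is real because omega is hermitian, and
   independent of the chart because of [form_compatible]. *)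
Definition pullback g (z : R[i]) : R :=
  let v := derive1 (local_rep g z) z in
  complex.Re ((v *m form_coef omega (chart_at M (g z)) (local_rep g z z)
                 *m v^t*) 0 0).

Definition curvature_le_opp (lambda : R) :=
  forall (U : set R[i]) (g : R[i] -> V), open U -> holomorphic_on U g ->
  forall z, U z -> 0 < pullback g z ->
    (lambda * pullback g z)%:C <= Ric (pullback g) z.

Definition T_char f (r : R) : R :=
  Rintegral (@lebesgue_measure R) `]0, r[
    (fun t => disc_integral (pullback f) t / t).

Definition exp_T_integral f (c : R) (A : set R) : \bar R :=
  (\int[@lebesgue_measure R]_(r in A) (expR (c * T_char f r))%:E)%E.

Definition c_growth f (rho : \bar R) : \bar R :=
  ereal_inf [set c%:E | c in
    [set c : R | 0 < c /\ exp_T_integral f c (radii rho) = +oo%E]].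

End holomorphic_maps.

(* Main.v *)
(* Write f^*omega = a (sqrt(-1) / 2 pi) dz /\ d(conj z).  Near a point z the coefficient a is |w - z|^(2 m)
   times a positive smooth function, where m is the multiplicity of z in the ramification divisor, and
   the curvature hypothesis says that log a has Laplacian at least 4 lambda a where a > 0.  Subtract from
   log a the logarithms of |w - x|^2 over the zeros x of a in |w| < r and add back their harmonic
   extensions from the circle, obtained by reflecting x; Green's formula in polar coordinates then gives
     lambda T(r) + N_ram(r) + const <= 1/2 (mean of log a on |w| = r) <= 1/2 log (mean of a on |w| = r).
   With A(t) the integral of f^*omega over |w| < t one has r T' = A and A' = 2 r (mean of a).  If h is
   increasing, the set where h' >= exp((c + eps) T) h^(1 + delta) has finite integral against
   exp((c + eps) T), because h' / h^(1 + delta) has a bounded primitive; applying this to T and to A with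
   delta = 2 eps bounds log (mean of a) by 2 (1 + eps)(c + eps) T + 2 eps log r + O(log T) off E.
   If c < lambda, a small eps makes T bounded off E (for R infinite c = 0 and eps log r is absorbed by
   T >= A(1) log r), which contradicts the definition of c. *)

(* Only complex differentiability of [f] in charts is given, while Green's formula needs continuous
   second partials and the local form |w - z|^(2 m) g of [a] needs orders of zeros. Both come from
   Cauchy integrals: Goursat's bisection gives local primitives, and a Cauchy integral can be
   differentiated again and again and divided by z - c at a zero. The curvature bound is silent at
   the zeros of [a]. Once the logarithms are removed, the corrected function is smooth across them
   and the inequality extends by continuity. A circle may itself carry zeros; Jensen's inequality is
   therefore proved for slightly smaller radii and carried over by a left limit, in a form that is
   continuous in the radius. The choice delta = 2 eps answers the factor 1/2 before the logarithm of
   the mean: the two growth estimates give the exponent (1 + (1 + 2 eps)) (c + eps) T, half of which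
   is (1 + eps)(c + eps) T, and half of (1 + 2 eps) log r - log r is eps log r. Paths are
   parametrised through sin or sin^2, so that they are differentiable, and remain in the disc, for
   all real times. *)
Require Import Defs.
From HB Require Import structures.
From mathcomp Require Import all_boot all_order all_algebra.
From mathcomp Require Import complex.
From mathcomp Require Import all_classical all_reals all_analysis.
From mathcomp Require Import measurable_realfun ring lra.
Set Implicit Arguments.
Unset Strict Implicit.
Unset Printing Implicit Defensive.
Import Order.TTheory GRing.Theory Num.Theory.
Import numFieldNormedType.Exports.
Import ComplexField.Normc.

Local Open Scope classical_set_scope.
Local Open Scope ring_scope.
Local Open Scope complex_scope.

(** * Complex derivatives *)

Section complex_plane.
Variable R : realType.
Implicit Types (z w h l : R[i]) (F G : R[i] -> R[i]).

Lemma normc_ge0 z : 0 <= normc z.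
Proof. by case: z => a b; rewrite sqrtr_ge0. Qed.

Lemma normcE' z : `|z| = (normc z)%:C.
Proof. by []. Qed.

Lemma normc_real (x : R) : normc x%:C = `|x|.
Proof. by rewrite /= expr0n addr0 sqrtr_sqr. Qed.

Lemma normcZr (x : R) z : normc (x%:C * z) = `|x| * normc z.
Proof. by rewrite normcM normc_real. Qed.

Lemma normc_triB z w : normc (z - w) <= normc z + normc w.
Proof. by rewrite -(normcN w); apply: le_normcD. Qed.

Lemma normcBC z w : normc (z - w) = normc (w - z).
Proof. by rewrite -normcN opprB. Qed.

Lemma normc_tri3 z w v : normc (z - w) <= normc (z - v) + normc (v - w).
Proof. by rewrite (_ : z - w = (z - v) + (v - w)) ?le_normcD//; ring. Qed.

Lemma normc_ge_sub z w : normc z - normc w <= normc (z - w).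
Proof. by rewrite lerBlDr (le_trans _ (le_normcD _ _))// subrK. Qed.

Lemma normc_eq0 z : (normc z == 0) = (z == 0).
Proof.
by apply/eqP/eqP => [/eq0_normc|->]; rewrite ?normc0.
Qed.

Lemma normc_gt0 z : (0 < normc z) = (z != 0).
Proof. by rewrite lt_neqAle normc_ge0 andbT eq_sym normc_eq0. Qed.

Lemma normcX z n : normc (z ^+ n) = normc z ^+ n.
Proof. by elim: n => [|n ih]; rewrite ?expr0 ?normc1// !exprS normcM ih. Qed.

Lemma normc_div z w : normc (z / w) = normc z / normc w.
Proof. by rewrite normcM normcV. Qed.

Lemma sqr_normc z : normc z ^+ 2 = complex.Re z ^+ 2 + complex.Im z ^+ 2.
Proof. by case: z => a b /=; rewrite sqr_sqrtr// addr_ge0// sqr_ge0. Qed.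

Lemma Re_le_normc z : `|complex.Re z| <= normc z.
Proof.
by rewrite -(@ler_pXn2r _ 2) ?nnegrE ?normc_ge0// sqr_normc real_normK ?num_real// lerDl sqr_ge0.
Qed.

Lemma Im_le_normc z : `|complex.Im z| <= normc z.
Proof.
by rewrite -(@ler_pXn2r _ 2) ?nnegrE ?normc_ge0// sqr_normc real_normK ?num_real// lerDr sqr_ge0.
Qed.

Lemma normc_le_ReIm z : normc z <= `|complex.Re z| + `|complex.Im z|.
Proof.
rewrite -(@ler_pXn2r _ 2) ?nnegrE ?normc_ge0 ?addr_ge0// sqr_normc sqrrD !real_normK ?num_real//.
by rewrite lerD2r lerDl mulrn_wge0// mulr_ge0.
Qed.

Lemma ReD z w : complex.Re (z + w) = complex.Re z + complex.Re w.
Proof. by case: z w => [a b] [c d]. Qed.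
Lemma ImD z w : complex.Im (z + w) = complex.Im z + complex.Im w.
Proof. by case: z w => [a b] [c d]. Qed.
Lemma ReB z w : complex.Re (z - w) = complex.Re z - complex.Re w.
Proof. by case: z w => [a b] [c d]. Qed.
Lemma ImB z w : complex.Im (z - w) = complex.Im z - complex.Im w.
Proof. by case: z w => [a b] [c d]. Qed.
Lemma ReM z w : complex.Re (z * w) = complex.Re z * complex.Re w - complex.Im z * complex.Im w.
Proof. by case: z w => [a b] [c d]. Qed.
Lemma ImM z w : complex.Im (z * w) = complex.Re z * complex.Im w + complex.Im z * complex.Re w.
Proof. by case: z w => [a b] [c d]. Qed.
Lemma ReN z : complex.Re (- z) = - complex.Re z.
Proof. by case: z => [a b]. Qed.
Lemma ImN z : complex.Im (- z) = - complex.Im z.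
Proof. by case: z => [a b]. Qed.

Definition ReImE := (ReD, ImD, ReB, ImB, ReM, ImM, ReN, ImN).

Lemma eqC z w : complex.Re z = complex.Re w -> complex.Im z = complex.Im w -> z = w.
Proof. by case: z w => [a b] [c d] /= -> ->. Qed.

(** The norm of [R[i]] takes its values in [R[i]], so the radius of a ball is a complex number that
    happens to be real and positive; this equivalence lets everything below use real radii. *)
Lemma nearCP z (P : R[i] -> Prop) :
  (\forall w \near z, P w) <->
  exists2 d : R, 0 < d & forall w, normc (w - z) < d -> P w.
Proof.
split=> [/nbhs_ballP[e /= e0 eP]|[d d0 dP]].
  have [ei er] : complex.Im e = 0 /\ 0 < complex.Re e.
    by move: e0; rewrite ltcE/= => /andP[/eqP -> ->].
  exists (complex.Re e) => // w wz; apply: eP.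
  rewrite -ball_normE/= normcE' normcBC in wz *.
  by rewrite ltcE/= ei eqxx/=.
apply/nbhs_ballP; exists d%:C; first by rewrite /= ltcR.
move=> w /=; rewrite -ball_normE/= normcE' ltcR => h; apply: dP.
by rewrite normcBC.
Qed.

Lemma continuousCP {T : topologicalType} (f : T -> R[i]) x :
  {for x, continuous f} <->
  forall e : R, 0 < e -> \forall y \near x, normc (f y - f x) < e.
Proof.
split=> [cf e e0|H].
  have : \forall w \near f x, normc (w - f x) < e.
    by apply/nearCP; exists e.
  by move/cf.
move=> A /nearCP [d d0 dA]; have := H d d0; apply: filterS => y; exact: dA.
Qed.

Lemma continuous_fromC {U : R[i] -> R} z :
  {for z, continuous U} <->
  forall e : R, 0 < e -> exists2 d : R, 0 < d & forall w, normc (w - z) < d ->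
    `|U w - U z| < e.
Proof.
split=> [cf e e0|H].
  apply/nearCP; have : \forall w \near U z, `|w - U z| < e.
    by apply/nbhs_ballP; exists e => //= w; rewrite -ball_normE/= distrC.
  by move/cf.
move=> A /nbhs_ballP[e e0 eA]; have [d d0 dP] := H e e0.
apply/nearCP; exists d => // w wz; apply: eA.
by rewrite -ball_normE/= distrC; exact: dP.
Qed.

Lemma continuousCCP F z :
  {for z, continuous F} <->
  forall e : R, 0 < e -> exists2 d : R, 0 < d & forall w, normc (w - z) < d ->
    normc (F w - F z) < e.
Proof.
split=> [/continuousCP H e /H /nearCP //|H].
by apply/continuousCP => e /H He; apply/nearCP.
Qed.

(** Complex differentiability without a quotient: the weak inequality is trivial at h = 0, so no
    punctured neighbourhood occurs. *)
Definition cdiff F z l := forall e : R, 0 < e ->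
  exists2 d : R, 0 < d & forall h, normc h < d ->
    normc (F (z + h) - F z - l * h) <= e * normc h.

Lemma cdiffP F z l : is_derive z (1 : R[i]) F l <-> cdiff F z l.
Proof.
split=> [[dF Fl] e e0|H].
  have /cvgrPdist_lt /(_ e%:C) : h^-1 *: (F (h *: (1 : R[i]) + z) - F z) @[h --> 0^'] --> l.
    by rewrite -Fl; exact: dF.
  rewrite ltcR => /(_ e0); rewrite near_withinE => /nearCP[d d0 dP].
  exists d => // h hd; have [->|h0] := eqVneq h 0.
    by rewrite addr0 subrr mulr0 subr0 normc0 mulr0.
  have := dP h; rewrite subr0 => /(_ hd h0).
  rewrite normcE' ltcR => /ltW /(ler_wpM2r (normc_ge0 h)); apply: le_trans.
  rewrite -normcM normcBC mulrBl.
  rewrite [h *: _ + z](_ : _ = z + h); last by rewrite /GRing.scale/= mulr1 addrC.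
  by rewrite /GRing.scale/= [_^-1 * _]mulrC -mulrA mulVf// mulr1.
have cv : h^-1 *: (F (h *: (1 : R[i]) + z) - F z) @[h --> 0^'] --> l.
  apply/cvgrPdist_lt => e; rewrite ltcE/= => /andP[/eqP ei er].
  rewrite near_withinE; apply/nearCP.
  have [d d0 dP] := H (complex.Re e / 2) ltac:(by rewrite divr_gt0).
  exists d => // h; rewrite subr0 => hd h0.
  rewrite normcE' ltcE/= ei eqxx/=.
  rewrite [h *: _ + z](_ : _ = z + h); last by rewrite /GRing.scale/= mulr1 addrC.
  rewrite /GRing.scale/=.
  have -> : l - h^-1 * (F (z + h) - F z) = - h^-1 * (F (z + h) - F z - l * h).
    by field.
  rewrite normcM normcN normcV mulrC ltr_pdivrMr ?normc_gt0//.
  apply: (le_lt_trans (dP _ hd)); rewrite ltr_pM2r ?normc_gt0//.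
  by rewrite ltr_pdivrMr// ltr_pMr// ltr1n.
by apply: DeriveDef; [apply/cvg_ex; exists l|exact: cvg_lim cv].
Qed.

Lemma cdiff_cont F z l : cdiff F z l -> {for z, continuous F}.
Proof.
move=> /cdiffP [dF _].
by apply: differentiable_continuous; apply/derivable1_diffP.
Qed.

End complex_plane.

(** * Integrals over a segment *)

Section continuity.
Variables (R : realType) (T : topologicalType).
Implicit Types (f g : T -> R) (x : T).

Lemma contD_at f g x : {for x, continuous f} -> {for x, continuous g} ->
  {for x, continuous (fun y => f y + g y)}.
Proof. by move=> cf cg; exact: (@cvgD _ R _ _ _ f g _ _ cf cg). Qed.
Lemma contB_at f g x : {for x, continuous f} -> {for x, continuous g} ->
  {for x, continuous (fun y => f y - g y)}.
Proof. by move=> cf cg; exact: (@cvgB _ R _ _ _ f g _ _ cf cg). Qed.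
Lemma contM_at f g x : {for x, continuous f} -> {for x, continuous g} ->
  {for x, continuous (fun y => f y * g y)}.
Proof. by move=> cf cg; exact: (@cvgM _ _ _ _ f g _ _ cf cg). Qed.
Lemma contD f g : continuous f -> continuous g -> continuous (fun y => f y + g y).
Proof. by move=> cf cg x; exact: (contD_at (cf x) (cg x)). Qed.
Lemma contB f g : continuous f -> continuous g -> continuous (fun y => f y - g y).
Proof. by move=> cf cg x; exact: (contB_at (cf x) (cg x)). Qed.
Lemma contM f g : continuous f -> continuous g -> continuous (fun y => f y * g y).
Proof. by move=> cf cg x; exact: (contM_at (cf x) (cg x)). Qed.
Lemma contC (k : R) : continuous (fun _ : T => k).
Proof. by move=> x; exact: cvg_cst. Qed.
End continuity.

Section integrals.
Variable R : realType.
Notation mu := (@lebesgue_measure R).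
Implicit Types (a b c x y : R) (f g F : R -> R).

(** There is no orientation: the value is 0 for b < a. Most lemmas on [Int] ask for continuity on
    the whole line, which is why later integrands are built to be continuous for every real
    parameter. *)
Definition Int a b f : R := Rintegral mu `[a, b] f.

Lemma cont_integrable a b f : continuous f -> mu.-integrable `[a, b] (EFin \o f).
Proof.
move=> cf; apply: continuous_compact_integrable; first exact: segment_compact.
exact: continuous_subspaceT.
Qed.

Lemma eq_Int a b f g : (forall x, a <= x <= b -> f x = g x) -> Int a b f = Int a b g.
Proof.
by move=> fg; apply: eq_Rintegral => x; rewrite inE/= in_itv/= => /fg.
Qed.

Lemma IntD a b f g : continuous f -> continuous g ->
  Int a b (fun x => f x + g x) = Int a b f + Int a b g.
Proof. by move=> cf cg; rewrite /Int RintegralD//; exact: cont_integrable. Qed.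

Lemma IntB a b f g : continuous f -> continuous g ->
  Int a b (fun x => f x - g x) = Int a b f - Int a b g.
Proof. by move=> cf cg; rewrite /Int RintegralB//; exact: cont_integrable. Qed.

Lemma IntZ a b k f : continuous f -> Int a b (fun x => k * f x) = k * Int a b f.
Proof. by move=> cf; rewrite /Int RintegralZl//; exact: cont_integrable. Qed.

Lemma Int_cst a b k : a <= b -> Int a b (fun=> k) = k * (b - a).
Proof.
move=> ab; rewrite /Int Rintegral_cst//= lebesgue_measure_itv/= lte_fin.
by move: ab; rewrite le_eqVlt => /predU1P[->|ab]; rewrite ?ltxx ?subrr ?mulr0//= ab -EFinB.
Qed.

Lemma Int_ge0 a b f : (forall x, a <= x <= b -> 0 <= f x) -> 0 <= Int a b f.
Proof. by move=> f0; apply: Rintegral_ge0 => x/=; rewrite in_itv/= => /f0. Qed.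

Lemma Int_le a b f g : continuous f -> continuous g ->
  (forall x, a <= x <= b -> f x <= g x) -> Int a b f <= Int a b g.
Proof.
move=> cf cg fg; by apply: le_Rintegral => //; try exact: cont_integrable;
  move=> x/=; rewrite in_itv/= => /fg.
Qed.

Lemma Int_abs_le a b f (M : R) : a <= b -> continuous f ->
  (forall x, a <= x <= b -> `|f x| <= M) -> `|Int a b f| <= M * (b - a).
Proof.
move=> ab cf fM; rewrite ler_norml -mulNr -!Int_cst//.
apply/andP; split; apply: Int_le => //; try exact: cst_continuous.
all: by move=> x /fM; rewrite ler_norml => /andP[].
Qed.

Lemma Int_point a f : Int a a f = 0.
Proof. by rewrite /Int set_itv1 Rintegral_set1. Qed.

Lemma Int_cat a b c f : a <= b -> b <= c -> continuous f ->
  Int a c f = Int a b f + Int b c f.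
Proof.
move=> ab bc cf.
have := @Rintegral_itvB R f (BLeft a) (BRight c) b (cont_integrable a c cf).
rewrite !bnd_simp => /(_ ab bc) => h.
rewrite /Int -(@Rintegral_itv_obnd_cbnd R b (BRight c)) -?h; first by rewrite addrC subrK.
by apply: (integrableS _ _ _ (cont_integrable b c cf)) => //; exact: subset_itv_oc_cc.
Qed.

Lemma Int_FTC1 a x f : continuous f -> a < x -> is_derive x 1 (fun t => Int a t f) (f x).
Proof.
move=> cf ax.
have x1 : x < x + 1 by rewrite ltrDl.
have i := cont_integrable a (x + 1) cf.
have := @continuous_FTC1_closed R f a x (x + 1) x1.
move=> /(_ i) /(_ ax (cf x)) [dF F'].
have F2 : 'D_1 ((Int a)^~ f) x = f x by rewrite -derive1E; exact: F'.
have F3 : derivable ((Int a)^~ f) x 1 by exact: dF.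
exact: (DeriveDef F3 F2).
Qed.

Lemma is_derive_cont f x l : is_derive x 1 f l -> {for x, continuous f}.
Proof.
by move=> [df _]; apply: differentiable_continuous; apply/derivable1_diffP.
Qed.

Lemma Int_FTC2 a b F f : a <= b -> continuous f -> (forall x, is_derive x 1 F (f x)) ->
  Int a b f = F b - F a.
Proof.
rewrite le_eqVlt => /predU1P[<- _ _|ab cf dF]; first by rewrite Int_point subrr.
have cF : continuous F by move=> x; exact: is_derive_cont (dF x).
rewrite /Int /Rintegral (@continuous_FTC2 R f F)//.
- exact: continuous_subspaceT.
- split.
  + by move=> x _; have [] := dF x.
  + exact/cvg_at_right_filter/cF.
  + exact/cvg_at_left_filter/cF.
- by move=> x _; rewrite derive1E; have [] := dF x.
Qed.

Lemma Int_DUI (k k1 : R -> R -> R) (x0 a b d M : R) : 0 < d ->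
  (forall x, `|x - x0| < d -> continuous (k x)) ->
  (forall x y, `|x - x0| < d -> a <= y <= b -> is_derive x 1 (k^~ y) (k1 x y)) ->
  (forall x y, `|x - x0| < d -> a <= y <= b -> `|k1 x y| <= M) ->
  is_derive x0 1 (fun x => Int a b (k x)) (Int a b (k1 x0)).
Proof.
move=> d0 ck dk bk.
have I0 : `](x0 - d), (x0 + d)[%classic x0 by rewrite /= in_itv/= ltrBlDr ltrDl d0.
have dI x : `](x0 - d), (x0 + d)[%classic x -> `|x - x0| < d.
  by rewrite /= in_itv/= ltr_norml => /andP[? ?]; rewrite ltrBrDr addrC ltrBlDr addrC; lra.
have k1E x y : `](x0 - d), (x0 + d)[%classic x -> `[a, b]%classic y ->
    partial1of2 k x y = k1 x y.
  move=> /dI xd /=; rewrite in_itv/= => yab.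
  by rewrite partial1of2E; have [] := dk x y xd yab.
have intk x : `](x0 - d), (x0 + d)[%classic x -> mu.-integrable `[a, b] (EFin \o k x).
  by move=> /dI xd; apply: cont_integrable; exact: ck.
have dk' x y : `](x0 - d), (x0 + d)[%classic x -> `[a, b]%classic y -> derivable (k^~ y) x 1.
  move=> /dI xd /=; rewrite in_itv/= => yab; by have [] := dk x y xd yab.
(* The maximum with 0 keeps the dominating function nonnegative even when [a, b] is empty and [M] is
   negative. *)
have bM x y : `](x0 - d), (x0 + d)[%classic x -> `[a, b]%classic y ->
    `|partial1of2 k x y| <= Num.max M 0.
  move=> xd yab; rewrite k1E// le_max bk//; first exact: dI.
have iG : mu.-integrable `[a, b] (EFin \o (fun=> Num.max M 0)).
  by apply: cont_integrable; exact: cst_continuous.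
have G0 : forall y : R, 0 <= Num.max M 0 by move=> _; rewrite le_max lexx orbT.
apply: DeriveDef.
  exact: (@derivable_under_integral _ _ _ mu k `[a, b] _ x0 _ _ I0 intk dk' _ G0 iG bM).
rewrite -derive1E (@differentiation_under_integral _ _ _ mu k `[a, b] _ x0 _ _ I0 intk dk' _ G0 iG bM)//.
by apply: eq_Rintegral => y; rewrite inE => yab; rewrite -k1E//.
Qed.

Lemma dC (k x : R) : is_derive x 1 (fun=> k) 0.
Proof. exact: is_derive_cst. Qed.
Lemma did (x : R) : is_derive x 1 (fun y => y) 1.
Proof. exact: is_derive_id. Qed.
Lemma dD f g x l m : is_derive x 1 f l -> is_derive x 1 g m ->
  is_derive x 1 (fun y => f y + g y) (l + m).
Proof. by move=> df dg; exact: (is_deriveD df dg). Qed.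
Lemma dB f g x l m : is_derive x 1 f l -> is_derive x 1 g m ->
  is_derive x 1 (fun y => f y - g y) (l - m).
Proof. by move=> df dg; exact: (is_deriveB df dg). Qed.
Lemma dN f x l : is_derive x 1 f l -> is_derive x 1 (fun y => - f y) (- l).
Proof. by move=> df; exact: (is_deriveN df). Qed.
Lemma dM f g x l m : is_derive x 1 f l -> is_derive x 1 g m ->
  is_derive x 1 (fun y => f y * g y) (l * g x + f x * m).
Proof.
move=> df dg; have -> : l * g x + f x * m = f x *: m + g x *: l.
  by rewrite /GRing.scale/= addrC [l * _]mulrC.
exact: (is_deriveM df dg).
Qed.
Lemma dcomp f g x l m : is_derive (g x) 1 f l -> is_derive x 1 g m ->
  is_derive x 1 (fun y => f (g y)) (l * m).
Proof. by move=> df dg; exact: (is_derive1_comp df dg). Qed.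

Lemma is_derive_ext f g x l : (forall y, f y = g y) -> is_derive x 1 f l -> is_derive x 1 g l.
Proof. by move=> fg; rewrite (_ : f = g)//; apply/funext. Qed.

Lemma is_derive_near f g x l : (exists2 d, 0 < d & forall y, `|y - x| < d -> f y = g y) ->
  is_derive x 1 f l -> is_derive x 1 g l.
Proof.
move=> [d d0 dP]; apply: near_eq_is_derive.
apply/nbhs_ballP; exists d => // y; rewrite -ball_normE/= => h; apply: dP.
by rewrite distrC.
Qed.

Lemma is_derive_eps f x l : is_derive x 1 f l <->
  forall e : R, 0 < e -> exists2 d : R, 0 < d & forall h : R, `|h| < d ->
    `|f (x + h) - f x - l * h| <= e * `|h|.
Proof.
split=> [[dF Fl] e e0|H].
  have /cvgrPdist_lt /(_ e e0) : h^-1 *: (f (h *: (1 : R) + x) - f x) @[h --> 0^'] --> l.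
    by rewrite -Fl; exact: dF.
  rewrite near_withinE => /nbhs_ballP[d d0 dP]; exists d => // h hd.
  have [->|h0] := eqVneq h 0; first by rewrite addr0 subrr mulr0 subr0 normr0 mulr0.
  have := dP h; rewrite -ball_normE/= sub0r normrN => /(_ hd h0) /ltW /(ler_wpM2r (normr_ge0 h)).
  apply: le_trans; rewrite -normrM distrC mulrBl.
  rewrite [h *: _ + x](_ : _ = x + h); last by rewrite /GRing.scale/= mulr1 addrC.
  by rewrite /GRing.scale/= [_^-1 * _]mulrC -mulrA mulVf// mulr1.
have cv : h^-1 *: (f (h *: (1 : R) + x) - f x) @[h --> 0^'] --> l.
  apply/cvgrPdist_lt => e e0; rewrite near_withinE.
  have [d d0 dP] := H (e / 2) ltac:(by rewrite divr_gt0).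
  apply/nbhs_ballP; exists d => // h; rewrite -ball_normE/= sub0r normrN => hd h0.
  rewrite [h *: _ + x](_ : _ = x + h); last by rewrite /GRing.scale/= mulr1 addrC.
  rewrite /GRing.scale/=.
  have -> : l - h^-1 * (f (x + h) - f x) = - h^-1 * (f (x + h) - f x - l * h) by field.
  rewrite normrM normrN normfV mulrC ltr_pdivrMr ?normr_gt0//.
  apply: (le_lt_trans (dP _ hd)); rewrite ltr_pM2r ?normr_gt0//.
  by rewrite ltr_pdivrMr// ltr_pMr// ltr1n.
by apply: DeriveDef; [apply/cvg_ex; exists l|exact: cvg_lim cv].
Qed.

Lemma cont_eps f x : {for x, continuous f} <->
  forall e : R, 0 < e -> exists2 d : R, 0 < d & forall y, `|y - x| < d -> `|f y - f x| < e.
Proof.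
split=> [cf e e0|H].
  have /nbhs_ballP[d d0 dP] : \forall y \near x, `|f x - f y| < e by move/cvgrPdist_lt: cf; exact.
  by exists d => // y yx; rewrite distrC; apply: dP; rewrite -ball_normE/= distrC.
apply/cvgrPdist_lt => e /H [d d0 dP]; apply/nbhs_ballP; exists d => // y.
by rewrite /ball/= distrC => /dP; rewrite distrC.
Qed.

Lemma zero_derive_const f a b : (forall x, is_derive x 1 f 0) -> f a = f b.
Proof.
move=> H; wlog ab : a b / a <= b.
  by move=> W; case: (leP a b) => [/W//|/ltW/W ->].
apply/esym/eqP; rewrite -subr_eq0 -(@Int_FTC2 a b f (fun=> 0))//; last exact: cst_continuous.
by rewrite Int_cst// mul0r.
Qed.

End integrals.

(** * The chain rule for real functions on complex vector spaces *)

Section real_chain_rule.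
Variable R : realType.

(** The mean value theorem between 0 and x, for either sign of x and for x = 0, so that the chain
    rule needs no case analysis on signs. *)
Lemma MVT_zero (g g' : R -> R) (x : R) :
  (forall t : R, `|t| <= `|x| -> is_derive t 1 g (g' t)) ->
  exists2 c, `|c| <= `|x| & g x - g 0 = g' c * x.
Proof.
move=> dg; have [->|x0] := eqVneq x 0.
  by exists 0; rewrite ?normr0// subrr mulr0.
have cg t : `|t| <= `|x| -> {for t, continuous g}.
  by move=> /dg; exact: is_derive_cont.
case: (ltrP 0 x) => [xp|xn].
- have dI (t : R) : t \in `]0, x[ -> is_derive t 1 g (g' t).
    rewrite in_itv/= => /andP[t0 tx]; apply: dg.
    by rewrite !gtr0_norm// ltW.
  have [|c] := @MVT R g g' 0 x xp dI.
    apply: continuous_in_subspaceT => t; rewrite inE/= in_itv/= => /andP[t0 tx].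
    by apply: cg; rewrite !ger0_norm// ltW.
  rewrite in_itv/= subr0 => /andP[c0 cx] ->; exists c => //.
  by rewrite !gtr0_norm// ltW.
- have {}xn : x < 0 by rewrite lt_neqAle x0.
  have dI (t : R) : t \in `]x, 0[ -> is_derive t 1 g (g' t).
    rewrite in_itv/= => /andP[t0 tx]; apply: dg.
    by rewrite !ltr0_norm// lerN2 ltW.
  have [|c] := @MVT R g g' x 0 xn dI.
    apply: continuous_in_subspaceT => t; rewrite inE/= in_itv/= => /andP[t0 tx].
    by apply: cg; rewrite (ler0_norm tx) (ltr0_norm xn) lerN2.
  rewrite in_itv/= => /andP[c0 cx] E; exists c; last first.
    by rewrite -opprB E sub0r mulrN opprK.
  by rewrite !ltr0_norm// lerN2 ltW.
Qed.

Lemma is_derive_translate (g : R -> R) (a l : R) :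
  is_derive (0 : R) 1 (fun s => g (a + s)) l <-> is_derive (a : R) 1 g l.
Proof.
by split=> /is_derive_eps H; apply/is_derive_eps => e /H[d d0 dP]; exists d => // h /dP;
  rewrite add0r addr0.
Qed.

Variables (E : lmodType R[i]) (N : E -> R) (I : eqType) (e : I -> E).
Hypothesis N0 : N 0 = 0.
Hypothesis ND : forall v w, N (v + w) <= N v + N w.
Hypothesis Ne : forall k (t : R), N (t%:C *: e k) <= `|t|.
Variables (h : E -> R) (p : E) (dh : I -> E -> R).
Hypothesis h_der : exists2 d : R, 0 < d & forall w k, N w < d ->
  is_derive (0 : R) 1 (fun t : R => h (p + w + t%:C *: e k)) (dh k (p + w)).
Hypothesis dh_cont : forall k (eps : R), 0 < eps ->
  exists2 d : R, 0 < d & forall w, N w < d -> `|dh k (p + w) - dh k p| <= eps.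

(** The coordinates are changed one at a time. The mean value theorem turns each change into [dh k]
    at an intermediate point, and continuity of [dh k] at [p] replaces that point by [p]. The base
    point [w] is free so that the induction hypothesis applies after the first move. The gauge [N]
    stands for [normc] on the plane and for [rvN] on C^n. *)
Lemma telescope_frechet (s : seq I) (eps : R) : 0 < eps ->
  exists2 d : R, 0 < d & forall w (x : I -> R), N w < d -> (forall k, `|x k| < d) ->
    `|h (p + w + \sum_(k <- s) (x k)%:C *: e k) - h (p + w)
      - \sum_(k <- s) x k * dh k p| <= eps * \sum_(k <- s) `|x k|.
Proof.
move=> eps0; elim: s => [|k s [d d0 IH]].
  by exists 1 => // w x _ _; rewrite !big_nil addr0 subrr subr0 normr0 mulr0.
have [d1 d10 hd1] := h_der; have [d2 d20 hd2] := dh_cont k eps0.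
(* Half of the minimum: [w] plus one move then still has gauge below each of the three radii. *)
exists (Num.min d (Num.min d1 d2) / 2); first by rewrite divr_gt0// !lt_min d0 d10.
move=> w x; set dd := Num.min d _ => Nw xd.
have [ddd dd1 dd2] : [/\ dd <= d, dd <= d1 & dd <= d2].
  by rewrite /dd !ge_min !lexx ?orbT.
have Nt t : `|t| <= `|x k| -> N (w + t%:C *: e k) < dd.
  move=> tx; apply: le_lt_trans (ND _ _) _.
  have := Ne k t; have := xd k; lra.
rewrite !big_cons.
have [|c cx Ec] := @MVT_zero (fun t => h (p + w + t%:C *: e k))
    (fun t => dh k (p + (w + t%:C *: e k))) (x k).
  move=> t tx; apply/is_derive_translate.
  have := hd1 (w + t%:C *: e k) k (lt_le_trans (Nt _ tx) dd1).
  apply: is_derive_ext => y.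
  by congr h; rewrite rmorphD/= scalerDl !addrA.
have A1 := IH (w + (x k)%:C *: e k) x (lt_le_trans (Nt _ (lexx _)) ddd).
have A2 := hd2 (w + c%:C *: e k) (lt_le_trans (Nt _ cx) dd2).
move: Ec; rewrite scale0r addr0 => Ec.
rewrite -!addrA !addrA in A1 *.
have /A1{}A1 : forall k0, `|x k0| < d by move=> k0; have := xd k0; have : 0 < dd; [rewrite !lt_min d0 d10 d20|lra].
set S := \sum_(j <- s) _ in A1 *; set h2 := h (_ + S) in A1 *.
set h1 := h (p + w + (x k)%:C *: e k) in A1 Ec *.
rewrite (_ : h2 - _ - _ = (h2 - h1 - \sum_(j <- s) x j * dh j p)
  + x k * (dh k (p + (w + c%:C *: e k)) - dh k p)); last first.
  have -> : h1 = h (p + w) + dh k (p + (w + c%:C *: e k)) * x k by rewrite -Ec addrC subrK.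
  ring.
apply: le_trans (ler_normD _ _) _; rewrite [leRHS]mulrDr [leRHS]addrC lerD//.
by rewrite normrM [leLHS]mulrC ler_wpM2r.
Qed.

Lemma chain_rule (s : seq I) (x : I -> R -> R) (l : I -> R) :
  (forall k, x k 0 = 0) -> (forall k, is_derive (0 : R) 1 (x k) (l k)) ->
  is_derive (0 : R) 1 (fun t => h (p + \sum_(k <- s) (x k t)%:C *: e k))
    (\sum_(k <- s) l k * dh k p).
Proof.
move=> x0 dx; apply/is_derive_eps => eps eps0.
(* Two errors occur, each [e1] times |t| times a sum: over |l k| + 1 from the telescoping estimate,
   over |dh k p| from replacing x k t by l k * t. [M] collects both sums. *)
pose M := \sum_(k <- s) (`|l k| + 1) + \sum_(k <- s) `|dh k p|.
have M0 : 0 <= M by rewrite /M addr_ge0// sumr_ge0// => k _; rewrite addr_ge0.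
pose e1 := eps / (M + 1).
have e10 : 0 < e1 by rewrite divr_gt0// ltr_wpDl.
have [d d0 H] := telescope_frechet s e10.
have xs r : 0 < r -> exists2 d' : R, 0 < d' & forall t k, k \in s -> `|t| < d' ->
    `|x k t - l k * t| <= r * `|t|.
  move=> r0; elim: s {M M0 e1 e10 d d0 H} => [|k s' [d' d'0 IH]]; first by exists 1.
  have /is_derive_eps/(_ r r0)[d2 d20 H2] := dx k.
  exists (Num.min d' d2); first by rewrite lt_min d'0.
  move=> t j; rewrite inE lt_min => /predU1P[->|js] /andP[td' td2]; last exact: IH.
  by have := H2 t td2; rewrite add0r x0 subr0.
have [da da0 Ha] := xs _ (ltac:(rewrite lt_min ltr01 e10; done) : 0 < Num.min 1 e1).
have [L L0 HL] : exists2 L : R, 0 < L & forall k, k \in s -> `|l k| + 1 <= L.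
  exists (\sum_(k <- s) (`|l k| + 1) + 1).
    by rewrite ltr_wpDl// sumr_ge0// => k _; rewrite addr_ge0.
  move=> k ks; rewrite (big_rem k)//=.
  have : 0 <= \sum_(y <- rem k s) (`|l y| + 1).
    by apply: sumr_ge0 => j _; rewrite addr_ge0.
  by move: (\sum_(y <- _) _) => S; lra.
exists (Num.min da (d / L)); first by rewrite lt_min da0 divr_gt0.
move=> t; rewrite lt_min => /andP[tda]; rewrite ltr_pdivlMr// => tL.
have xb k : k \in s -> `|x k t| <= (`|l k| + 1) * `|t|.
  move=> ks; have := Ha t k ks tda.
  have : Num.min 1 e1 * `|t| <= 1 * `|t| by rewrite ler_wpM2r// ge_min lexx.
  have := ler_normD (x k t - l k * t) (l k * t); rewrite subrK normrM.
  rewrite mulrDl mul1r; lra.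
(* [telescope_frechet] asks for small increments at every index, whereas only those in [s] are
   controlled. *)
pose y k := if k \in s then x k t else 0.
have yE (f : I -> R -> E) : \sum_(k <- s) f k (x k t) = \sum_(k <- s) f k (y k).
  by apply: eq_big_seq => k ks; rewrite /y ks.
have yE' (f : I -> R -> R) : \sum_(k <- s) f k (x k t) = \sum_(k <- s) f k (y k).
  by apply: eq_big_seq => k ks; rewrite /y ks.
have yd k : `|y k| < d.
  rewrite /y; case: ifP => ks; last by rewrite normr0.
  apply: le_lt_trans (xb k ks) _; apply: le_lt_trans tL.
  by rewrite mulrC ler_wpM2l// HL.
have := H 0 y; rewrite N0 => /(_ d0 yd).
rewrite addr0 -(yE (fun k z => z%:C *: e k)) -(yE' (fun k z => z * dh k p)) -(yE' (fun=> Num.norm)) => A.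
rewrite add0r; have -> : \sum_(k <- s) (x k 0)%:C *: e k = 0.
  by rewrite big1// => k _; rewrite x0 scale0r.
rewrite addr0 mulr_suml.
set S := \sum_(k <- s) x k t * _ in A; set S2 := \sum_(k <- s) _ * t.
set h1 := h _ in A *.
have B : `|S - S2| <= e1 * `|t| * \sum_(k <- s) `|dh k p|.
  rewrite /S /S2 -sumrB; apply: le_trans (ler_norm_sum _ _ _) _.
  rewrite mulr_sumr big_seq [leRHS]big_seq; apply: ler_sum => k ks.
  rewrite mulrAC -mulrBl normrM ler_wpM2r//.
  apply: le_trans (Ha t k ks tda) _.
  by rewrite ler_wpM2r// ge_min lexx orbT.
have Cc : \sum_(k <- s) `|x k t| <= `|t| * \sum_(k <- s) (`|l k| + 1).
  rewrite mulr_sumr big_seq [leRHS]big_seq; apply: ler_sum => k ks.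
  by rewrite mulrC; exact: xb.
rewrite (_ : h1 - h p - S2 = (h1 - h p - S) + (S - S2)); last by ring.
apply: le_trans (ler_normD _ _) _; apply: le_trans (lerD A B) _.
apply: le_trans (lerD (ler_wpM2l (ltW e10) Cc) (lexx _)) _.
rewrite mulrA -mulrDr -/M mulrAC ler_wpM2r//.
have M1 : 0 < M + 1 by rewrite ltr_wpDl.
rewrite /e1 mulrAC ler_pdivrMr//; apply: ler_wpM2l; first exact: ltW.
by rewrite lerDl.
Qed.

End real_chain_rule.

(** * Goursat's theorem *)

Section goursat.
Variable R : realType.
Implicit Types (x y w h a b c : R).

Definition diff2 (p : R -> R -> R) x y a b := forall e : R, 0 < e ->
  exists2 d : R, 0 < d & forall h k, `|h| < d -> `|k| < d ->
    `|p (x + h) (y + k) - p x y - a * h - b * k| <= e * (`|h| + `|k|).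

Variables p q : R -> R -> R.
Hypothesis cp : forall y, continuous (p^~ y).
Hypothesis cq : forall x, continuous (q x).

(** The integral of p dx + q dy, counterclockwise around the rectangle with lower left corner (x,
    y), width w and height h. *)
Definition loop x y w h :=
  (Int x (x + w) (p^~ y) - Int x (x + w) (p^~ (y + h)))
  + (Int y (y + h) (q (x + w)) - Int y (y + h) (q x)).

Lemma loop_split x y w h : 0 <= w -> 0 <= h ->
  loop x y (w + w) (h + h) =
  loop x y w h + loop (x + w) y w h + loop x (y + h) w h + loop (x + w) (y + h) w h.
Proof.
move=> w0 h0; rewrite /loop !addrA.
have catx f : continuous f -> Int x (x + w + w) f = Int x (x + w) f + Int (x + w) (x + w + w) f.
  by move=> cf; apply: Int_cat; rewrite ?lerDl.
have caty f : continuous f -> Int y (y + h + h) f = Int y (y + h) f + Int (y + h) (y + h + h) f.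
  by move=> cf; apply: Int_cat; rewrite ?lerDl.
by rewrite !catx// !caty//; ring.
Qed.

(** The shared coefficient [b] is the common value of dp/dy and dq/dx: the form p dx + q dy is
    closed at this single point, with no continuity of the derivatives. *)
Definition closed_at x y := exists a b c, diff2 p x y a b /\ diff2 q x y b c.

(** An affine closed form has zero loop integral: the terms in a and c cancel between opposite
    sides, and the two terms b w h cancel each other. Only the remainders stay, each at most e (w +
    h) on a side. *)
Lemma loop_small x0 y0 (e : R) : closed_at x0 y0 -> 0 < e ->
  exists2 d : R, 0 < d & forall x y w h, 0 <= w -> 0 <= h -> w + h < d ->
    x <= x0 <= x + w -> y <= y0 <= y + h -> `|loop x y w h| <= 2 * e * (w + h) ^+ 2.
Proof.
move=> [a [b [c [dp dq]]]] e0.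
have [d1 d10 H1] := dp e e0; have [d2 d20 H2] := dq e e0.
exists (Num.min d1 d2); first by rewrite lt_min d10.
move=> x y w h w0 h0; rewrite lt_min => /andP[wh1 wh2] /andP[xx0 x0x] /andP[yy0 y0y].
have dist t s : x <= t <= x + w -> y <= s <= y + h ->
    [/\ `|t - x0| <= w, `|s - y0| <= h, `|t - x0| < d1 & `|t - x0| < d2 /\ (`|s - y0| < d1 /\ `|s - y0| < d2)].
  move=> /andP[? ?] /andP[? ?].
  have A : `|t - x0| <= w by rewrite ler_norml; apply/andP; split; lra.
  have B : `|s - y0| <= h by rewrite ler_norml; apply/andP; split; lra.
  split=> //; first lra. by split; [|split]; lra.
have est p' a' b' d' t s : (forall h k, `|h| < d' -> `|k| < d' ->
    `|p' (x0 + h) (y0 + k) - p' x0 y0 - a' * h - b' * k| <= e * (`|h| + `|k|)) ->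
    `|t - x0| < d' -> `|s - y0| < d' -> `|t - x0| <= w -> `|s - y0| <= h ->
    `|p' t s - p' x0 y0 - a' * (t - x0) - b' * (s - y0)| <= e * (w + h).
  move=> H t1 s1 t2 s2; have := H _ _ t1 s1; rewrite ![_ + (_ - _)]addrC !subrK => /le_trans; apply.
  by rewrite ler_pM2l// lerD.
have xy : y <= y <= y + h by rewrite lexx lerDl.
have xyh : y <= y + h <= y + h by rewrite lexx lerDl h0.
have xx : x <= x <= x + w by rewrite lexx lerDl.
have xxw : x <= x + w <= x + w by rewrite lexx lerDl w0.
have E1 : Int x (x + w) (p^~ y) - Int x (x + w) (p^~ (y + h)) =
    Int x (x + w) (fun t => p t y - p t (y + h) + b * h) - b * h * w.
  rewrite IntD ?IntB ?Int_cst ?lerDl//; last 2 first.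
  - by move=> t; apply: continuousB; exact: cp.
  - exact: cst_continuous.
  by rewrite [x + w - x]addrC addKr; ring.
have E2 : Int y (y + h) (q (x + w)) - Int y (y + h) (q x) =
    Int y (y + h) (fun t => q (x + w) t - q x t - b * w) + b * w * h.
  rewrite [in RHS]IntB ?IntB ?Int_cst ?lerDl//; last 2 first.
  - by move=> t; apply: continuousB; exact: cq.
  - exact: cst_continuous.
  by rewrite [y + h - y]addrC addKr; ring.
have A1 : `|Int x (x + w) (fun t => p t y - p t (y + h) + b * h)| <= 2 * e * (w + h) * (x + w - x).
  apply: Int_abs_le; rewrite ?lerDl//.
    by apply: contD; [apply: contB; exact: cp|exact: contC].
  move=> t tx.
  have [u1 u2 u3 [u4 [u5 u6]]] := dist t y tx xy.
  have [v1 v2 v3 [v4 [v5 v6]]] := dist t (y + h) tx xyh.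
  have B1 := est _ _ _ _ t y H1 u3 u5 u1 u2; have B2 := est _ _ _ _ t (y + h) H1 v3 v5 v1 v2.
  rewrite (_ : p t y - _ + _ = (p t y - p x0 y0 - a * (t - x0) - b * (y - y0)) -
    (p t (y + h) - p x0 y0 - a * (t - x0) - b * (y + h - y0))); last by ring.
  by apply: le_trans (ler_normB _ _) _; lra.
have A2 : `|Int y (y + h) (fun t => q (x + w) t - q x t - b * w)| <= 2 * e * (w + h) * (y + h - y).
  apply: Int_abs_le; rewrite ?lerDl//.
    by apply: contB; [apply: contB; exact: cq|exact: contC].
  move=> t tx.
  have [u1 u2 u3 [u4 [u5 u6]]] := dist x t xx tx.
  have [v1 v2 v3 [v4 [v5 v6]]] := dist (x + w) t xxw tx.
  have B1 := est _ _ _ _ x t H2 u4 u6 u1 u2; have B2 := est _ _ _ _ (x + w) t H2 v4 v6 v1 v2.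
  rewrite (_ : q (x + w) t - _ - _ = (q (x + w) t - q x0 y0 - b * (x + w - x0) - c * (t - y0)) -
    (q x t - q x0 y0 - b * (x - x0) - c * (t - y0))); last by ring.
  by apply: le_trans (ler_normB _ _) _; lra.
rewrite /loop E1 E2; set I1 := Int _ _ _ in A1 *; set I2 := Int _ _ _ in A2 *.
rewrite (_ : _ + _ = I1 + I2); last by ring.
apply: le_trans (ler_normD _ _) _; apply: le_trans (lerD A1 A2) _.
by rewrite le_eqVlt; apply/orP; left; apply/eqP; ring.
Qed.

(* Bisection: a rectangle with nonzero loop integral has a quarter with at least a quarter of it. *)
Lemma goursat x y w h : 0 < w -> 0 < h ->
  (forall x' y', x <= x' <= x + w -> y <= y' <= y + h -> closed_at x' y') ->
  loop x y w h = 0.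
Proof.
move=> w0 h0 H; apply: contrapT => /eqP L0.
pose W n := w / 2 ^+ n; pose K n := h / 2 ^+ n.
have WS n : W n = W n.+1 + W n.+1 by rewrite /W exprS; field; rewrite expf_neq0.
have KS n : K n = K n.+1 + K n.+1 by rewrite /K exprS; field; rewrite expf_neq0.
have W0 n : 0 < W n by rewrite divr_gt0// exprn_gt0.
have K0 n : 0 < K n by rewrite divr_gt0// exprn_gt0.
pose eta := `|loop x y w h| / (w + h) ^+ 2.
have eta0 : 0 < eta by rewrite divr_gt0 ?normr_gt0// exprn_gt0// addr_gt0.
pose big n (v : R * R) := eta * (W n + K n) ^+ 2 <= `|loop v.1 v.2 (W n) (K n)|.
(* The implication stands under the existential so that choice yields a function on all pairs of a
   depth and a corner; it is informative only if the current rectangle is [big]. *)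
have step (u : nat * (R * R)) : exists v : R * R, big u.1 u.2 ->
    [/\ big u.1.+1 v, u.2.1 <= v.1, v.1 + W u.1.+1 <= u.2.1 + W u.1,
        u.2.2 <= v.2 & v.2 + K u.1.+1 <= u.2.2 + K u.1].
  case: u => n [a b] /=.
  have W1 := W0 n.+1; have K1 := K0 n.+1; have Ws := WS n; have Ks := KS n.
  case: (pselect (big n.+1 (a, b))) => [B|B1].
    by exists (a, b) => _; split=> //=; lra.
  case: (pselect (big n.+1 (a + W n.+1, b))) => [B|B2].
    by exists (a + W n.+1, b) => _; split=> //=; lra.
  case: (pselect (big n.+1 (a, b + K n.+1))) => [B|B3].
    by exists (a, b + K n.+1) => _; split=> //=; lra.
  exists (a + W n.+1, b + K n.+1) => B; split; [|rewrite /=; lra..].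
  move: B B1 B2 B3; rewrite /big/=.
  rewrite Ws Ks loop_split; [|exact: ltW..].
  set l1 := loop _ _ _ _; set l2 := loop _ _ _ _; set l3 := loop _ _ _ _; set l4 := loop _ _ _ _.
  move=> B /negP; rewrite -ltNge => B1 /negP; rewrite -ltNge => B2 /negP; rewrite -ltNge => B3.
  have := ler_normD (l1 + l2 + l3) l4; have := ler_normD (l1 + l2) l3; have := ler_normD l1 l2.
  move: B B1 B2 B3; rewrite (_ : (_ + _ + _) ^+ 2 = 4 * (W n.+1 + K n.+1) ^+ 2); last by ring.
  lra.
have [g gP] := choice step.
pose s := fix s n := if n is m.+1 then g (m, s m) else (x, y).
have sB n : big n (s n).
  elim: n => [|n /(gP (n, s n))[]//].
  by rewrite /big /= /W /K expr0 !divr1 /eta divfK// expf_neq0// lt0r_neq0// addr_gt0.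
have sP n := gP (n, s n) (sB n).
have mono1 n m : (s n).1 <= (s (n + m)%N).1 /\ (s (n + m)%N).1 + W (n + m)%N <= (s n).1 + W n.
  elim: m => [|m [IH1 IH2]]; first by rewrite addn0.
  rewrite addnS; have [_ /= A1 A2 _ _] := sP (n + m)%N.
  by split; [exact: le_trans A1|exact: le_trans IH2].
have mono2 n m : (s n).2 <= (s (n + m)%N).2 /\ (s (n + m)%N).2 + K (n + m)%N <= (s n).2 + K n.
  elim: m => [|m [IH1 IH2]]; first by rewrite addn0.
  rewrite addnS; have [_ /= _ _ A1 A2] := sP (n + m)%N.
  by split; [exact: le_trans A1|exact: le_trans IH2].
(* Nested intervals: the supremum of the left ends lies in all of them. *)
have lim (t : nat -> R) (V : nat -> R) : (forall n, 0 < V n) ->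
    (forall n m, t n <= t (n + m)%N /\ t (n + m)%N + V (n + m)%N <= t n + V n) ->
    exists X, forall n, t n <= X <= t n + V n.
  move=> V0 tV; pose A := range t.
  have ub n : ubound A (t n + V n).
    move=> _ [m _ <-]; have := tV n m; have := tV m n; rewrite addnC.
    have := V0 (n + m)%N; lra.
  have A0 : A !=set0 by exists (t 0%N), 0%N.
  exists (sup A) => n; apply/andP; split.
    by apply: ub_le_sup; [exists (t n + V n); exact: ub|exists n].
  exact: ge_sup.
have [X HX] := lim _ _ W0 mono1; have [Y HY] := lim _ _ K0 mono2.
(* With e = [eta / 4] the bound of [loop_small] is half of the lower bound in [big]. *)
have [d d0 Hd] := loop_small (H X Y ltac:(have := HX 0%N; rewrite /= /W expr0 divr1; exact)
  ltac:(have := HY 0%N; rewrite /= /K expr0 divr1; exact))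
  (ltac:(by rewrite divr_gt0) : 0 < eta / 4).
have [n Hn] : exists n, W n + K n < d.
  have [n] : exists n : nat, (w + h) / d < n%:R.
    exists (Num.truncn ((w + h) / d)).+1; rewrite truncnS_gt//.
  rewrite ltr_pdivrMr// => nd; exists n.
  rewrite /W /K -mulrDl ltr_pdivrMr ?exprn_gt0// (lt_le_trans nd)//.
  rewrite mulrC ler_pM2l// -natrX ler_nat.
  by apply: ltnW; exact: ltn_expl.
have := Hd _ _ _ _ (ltW (W0 n)) (ltW (K0 n)) Hn (HX n) (HY n).
apply/negP; rewrite -ltNge; apply: lt_le_trans (sB n).
have : 0 < eta * (W n + K n) ^+ 2 by rewrite mulr_gt0// exprn_gt0// addr_gt0.
by move: (_ ^+ 2) => z; lra.
Qed.

(** The primitive integrates along the lower side and then upwards, which makes its y-derivative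
    immediate. For the x-derivative, Goursat's theorem exchanges this path for the one that goes up
    first and then to the right. *)
Lemma primitive x0 y0 x1 y1 :
  (forall x y, x0 <= x < x1 -> y0 <= y < y1 -> closed_at x y) ->
  exists U : R -> R -> R, forall x y, x0 < x < x1 -> y0 < y < y1 ->
    is_derive x 1 (U^~ y) (p x y) /\ is_derive y 1 (U x) (q x y).
Proof.
move=> H; exists (fun x y => Int x0 x (p^~ y0) + Int y0 y (q x)) => x y /andP[x0x xx1] /andP[y0y yy1].
split; last first.
  have D := Int_FTC1 (@cq x) y0y.
  by have := dD (dC (Int x0 x (p^~ y0)) y) D; rewrite add0r.
have E x' : x0 < x' < x1 -> Int x0 x' (p^~ y0) + Int y0 y (q x') = Int x0 x' (p^~ y) + Int y0 y (q x0).
  move=> /andP[a b].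
  have Ex : x0 + (x' - x0) = x' by rewrite addrC subrK.
  have Ey : y0 + (y - y0) = y by rewrite addrC subrK.
  have : loop x0 y0 (x' - x0) (y - y0) = 0.
    apply: goursat; rewrite ?subr_gt0// => t s; rewrite Ex Ey.
    move=> /andP[t1 t2] /andP[s1 s2]; apply: H; first by rewrite t1 (le_lt_trans t2).
    by rewrite s1 (le_lt_trans s2).
  rewrite /loop Ex Ey => h.
  by apply/eqP; rewrite -subr_eq0 -h; apply/eqP; ring.
have D := Int_FTC1 (@cp y) x0x.
have D2 : is_derive x 1 (fun x' => Int x0 x' (p^~ y) + Int y0 y (q x0)) (p x y).
  by have := dD D (dC (Int y0 y (q x0)) x); rewrite addr0.
apply: is_derive_near D2; exists (Num.min (x - x0) (x1 - x)); first by rewrite lt_min !subr_gt0 x0x.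
move=> t; rewrite lt_min !ltr_norml => /andP[/andP[a1 a2] /andP[a3 a4]].
by apply/esym/E; apply/andP; split; lra.
Qed.

End goursat.

(** * Real partial derivatives in the plane and primitives of holomorphic functions *)

Section plane_calculus.
Variable R : realType.
Implicit Types (z w v l c : R[i]) (F G P : R[i] -> R[i]) (U : R[i] -> R) (g : R -> R[i]).

Definition rder U v z (l : R) := is_derive (0 : R) 1 (fun t : R => U (z + t%:C * v)) l.

Lemma ReZ (t : R) v : complex.Re (t%:C * v) = t * complex.Re v.
Proof. by rewrite ReM /= mul0r subr0. Qed.
Lemma ImZ (t : R) v : complex.Im (t%:C * v) = t * complex.Im v.
Proof. by rewrite ImM /= mul0r addr0. Qed.

Definition dir (b : bool) : R[i] := if b then 1 else 'i%C.

Lemma dir_decomp (a b : R) : \sum_(k <- [:: true; false]) ((if k then a else b)%:C : R[i]) *: dir k = (a +i* b : R[i]).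
Proof.
rewrite !big_cons big_nil addr0 /GRing.scale/= mulr1.
by apply: eqC; rewrite !ReImE/= !(mulr0, mul0r, mulr1, addr0, subr0, add0r).
Qed.

Definition has_partials U Ux Uy z :=
  exists2 d : R, 0 < d & forall w, normc (w - z) < d -> rder U 1 w (Ux w) /\ rder U 'i%C w (Uy w).

Section chain.
Variables (U Ux Uy : R[i] -> R) (z : R[i]).
Hypotheses (dU : has_partials U Ux Uy z).
Hypotheses (cUx : {for z, continuous Ux}) (cUy : {for z, continuous Uy}).

Let dh (b : bool) := if b then Ux else Uy.

Let N0 : normc (0 : R[i]) = 0. Proof. exact: normc0. Qed.
Let ND (v w : R[i]) : normc (v + w) <= normc v + normc w. Proof. exact: le_normcD. Qed.
Let Ne k (t : R) : normc (t%:C *: dir k) <= `|t|.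
Proof.
by rewrite /GRing.scale/= normcZr; case: k; rewrite /= expr0n expr1n ?add0r ?addr0 sqrtr1 mulr1.
Qed.
Let hder : exists2 d : R, 0 < d & forall w k, normc w < d ->
  is_derive (0 : R) 1 (fun t : R => U (z + w + t%:C *: dir k)) (dh k (z + w)).
Proof.
have [d d0 dP] := dU; exists d => // w k wd.
have [] := dP (z + w); first by rewrite addrC addKr.
by case: k.
Qed.
Let hcont k (eps : R) : 0 < eps ->
  exists2 d : R, 0 < d & forall w, normc w < d -> `|dh k (z + w) - dh k z| <= eps.
Proof.
move=> e0; have : {for z, continuous (dh k)} by case: k.
move=> /continuous_fromC/(_ _ e0)[d d0 dP]; exists d => // w wd.
by apply/ltW/dP; rewrite addrC addKr.
Qed.

Lemma plane_frechet (eps : R) : 0 < eps -> exists2 d : R, 0 < d & forall h, normc h < d ->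
  `|U (z + h) - U z - (complex.Re h * Ux z + complex.Im h * Uy z)| <= eps * normc h.
Proof.
move=> e0; have e20 : 0 < eps / 2 by rewrite divr_gt0.
have [d d0 dP] := telescope_frechet ND Ne hder hcont [:: true; false] e20.
exists d => // h hd.
have := dP 0 (fun k => if k then complex.Re h else complex.Im h); rewrite N0 => /(_ d0).
rewrite dir_decomp addr0 => H.
have hk (k : bool) : `|if k then complex.Re h else complex.Im h| < d.
  by case: k; apply: le_lt_trans hd; [exact: Re_le_normc|exact: Im_le_normc].
have := H hk; rewrite !big_cons !big_nil !addr0 {H hk}.
have := Re_le_normc h; have := Im_le_normc h; case: h hd => a b /= hd.
set n := Num.sqrt _ => h1 h2 H; apply: le_trans H _.
by rewrite -mulrA ler_pM2l// mulrC ler_pdivrMr// mulr_natr mulr2n lerD.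
Qed.

Lemma plane_chain0 (x y : R -> R) (a b : R) : x 0 = 0 -> y 0 = 0 ->
  is_derive (0 : R) 1 x a -> is_derive (0 : R) 1 y b ->
  is_derive (0 : R) 1 (fun t => U (z + (x t +i* y t))) (a * Ux z + b * Uy z).
Proof.
move=> x0 y0 dx dy.
have := @chain_rule R _ _ _ dir N0 ND Ne U z dh hder hcont [:: true; false]
  (fun k : bool => if k then x else y) (fun k : bool => if k then a else b).
rewrite !big_cons !big_nil addr0 => H.
apply: is_derive_ext (H _ _) => [t||]; last 2 first.
- by case.
- by case.
rewrite -dir_decomp !big_cons !big_nil; by [].
Qed.

End chain.

Lemma plane_chain U Ux Uy g t l : has_partials U Ux Uy (g t) ->
  {for g t, continuous Ux} -> {for g t, continuous Uy} ->
  is_derive t 1 (fun s => complex.Re (g s)) (complex.Re l) ->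
  is_derive t 1 (fun s => complex.Im (g s)) (complex.Im l) ->
  is_derive t 1 (fun s => U (g s)) (complex.Re l * Ux (g t) + complex.Im l * Uy (g t)).
Proof.
move=> hU cx cy dx dy; apply/is_derive_translate.
pose x s := complex.Re (g (t + s)) - complex.Re (g t).
pose y s := complex.Im (g (t + s)) - complex.Im (g t).
have dx' : is_derive (0 : R) 1 x (complex.Re l).
  by rewrite -[X in is_derive _ _ _ X]subr0; apply: dB (dC _ _); apply/is_derive_translate.
have dy' : is_derive (0 : R) 1 y (complex.Im l).
  by rewrite -[X in is_derive _ _ _ X]subr0; apply: dB (dC _ _); apply/is_derive_translate.
have x0 : x 0 = 0 by rewrite /x addr0 subrr.
have y0 : y 0 = 0 by rewrite /y addr0 subrr.
apply: is_derive_ext (plane_chain0 hU cx cy x0 y0 dx' dy') => s; congr U.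
by apply: eqC; rewrite !ReImE/= addrC subrK.
Qed.

(** The hypotheses are the Cauchy-Riemann equations U_x = V_y = u and V_x = - U_y = v with u and v
    continuous at z; the two real expansions combine to multiplication by u + i v. *)
Lemma cauchy_riemann U V P z : (forall w, P w = U w +i* V w) -> forall u v : R[i] -> R,
  has_partials U u (fun w => - v w) z -> has_partials V v u z ->
  {for z, continuous u} -> {for z, continuous v} ->
  cdiff P z (u z +i* v z).
Proof.
move=> PE u v hU hV cu cv e e0; have e20 : 0 < e / 2 by rewrite divr_gt0.
have cv' : {for z, continuous (fun w => - v w)}.
  by apply: (@continuousN _ R _ v z cv).
have [d1 d10 H1] := plane_frechet hU cu cv' e20; have [d2 d20 H2] := plane_frechet hV cv cu e20.
exists (Num.min d1 d2); first by rewrite lt_min d10.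
move=> h; rewrite lt_min => /andP[/H1{}H1 /H2{}H2].
apply: le_trans (normc_le_ReIm _) _; rewrite !PE.
rewrite !ReImE/=; move: H1 H2; set n := normc h => H1 H2.
rewrite (_ : U (z + h) - U z - _ = U (z + h) - U z - (complex.Re h * u z + complex.Im h * - v z)); last by ring.
rewrite (_ : V (z + h) - V z - _ = V (z + h) - V z - (complex.Re h * v z + complex.Im h * u z)); last by ring.
apply: le_trans (lerD H1 H2) _; by rewrite -mulrDl -splitr.
Qed.

(** The real and imaginary parts of F dz are u dx - v dy and v dx + u dy. Complex differentiability
    alone makes both closed at each point, and their primitives are the two parts of P. *)
Lemma holo_primitive F c (r : R) : 0 < r ->
  (forall z, normc (z - c) < r -> exists l, cdiff F z l) ->
  exists P, forall z, normc (z - c) < r / 2 -> cdiff P z (F z).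
Proof.
(* The square of half side [B] around c lies in the disc of radius r, because 2 (2/3)^2 = 8/9 < 1,
   and contains the disc of radius r / 2. Clamping the coordinates by [cl] makes the integrands
   continuous in each variable on the whole line. *)
move=> r0 dF; pose B := 2 * r / 3; have B0 : 0 < B by rewrite /B; lra.
pose cl x : R := Num.max (- B) (Num.min B x).
have clB x : `|cl x| <= B.
  rewrite /cl ler_norml le_max lexx/= ge_max ge_min lexx/= andbT.
  by lra.
have clid x : `|x| <= B -> cl x = x.
  by rewrite ler_norml => /andP[a b]; rewrite /cl (min_idPr b) (max_idPr a).
have cl_lip x y : `|cl x - cl y| <= `|x - y|.
  rewrite /cl /Num.max /Num.min.
  by repeat case: ifP => //; rewrite ?ltNge => *; rewrite ler_norml; apply/andP;
    have := ler_norm (x - y); have := ler_norm (y - x); rewrite [in X in X -> _]distrC; split; lra.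
pose pt x y : R[i] := c + (cl x +i* cl y).
have ptr x y : normc (pt x y - c) < r.
  rewrite /pt addrC addKr -(@ltr_pXn2r _ 2) ?nnegrE ?normc_ge0 ?ltW// sqr_normc/=.
  have sq t : cl t ^+ 2 <= B ^+ 2.
    by rewrite -[cl t ^+ 2]real_normK ?num_real// lerXn2r ?nnegrE// ltW.
  apply: le_lt_trans (lerD (sq x) (sq y)) _.
  rewrite /B (_ : _ + _ = 8 / 9 * r ^+ 2); last by field.
  by have := exprn_gt0 2 r0; lra.
have lip (x y x' y' : R) : normc (pt x y - pt x' y') <= `|x - x'| + `|y - y'|.
  apply: le_trans (normc_le_ReIm _) _; rewrite /pt !ReImE/=.
  by rewrite lerD// opprD addrACA subrr add0r.
have cont (V : R[i] -> R) : (forall z w, `|V z - V w| <= normc (z - w)) ->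
    (forall y, continuous (fun x => V (F (pt x y)))) /\ (forall x, continuous (fun y => V (F (pt x y)))).
  move=> lV; split=> s t; apply/cont_eps => e e0.
    have [l /cdiff_cont/continuousCCP/(_ e e0)[d d0 dP]] := dF _ (ptr t s).
    exists d => // x xt; apply: le_lt_trans (lV _ _) _; apply: dP.
    by apply: le_lt_trans (lip _ _ _ _) _; rewrite subrr normr0 addr0.
  have [l /cdiff_cont/continuousCCP/(_ e e0)[d d0 dP]] := dF _ (ptr s t).
  exists d => // x xt; apply: le_lt_trans (lV _ _) _; apply: dP.
  by apply: le_lt_trans (lip _ _ _ _) _; rewrite subrr normr0 add0r.
pose u x y := complex.Re (F (pt x y)); pose v x y := complex.Im (F (pt x y)).
have [cu1 cu2] : (forall y, continuous (u^~ y)) /\ (forall x, continuous (u x)).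
  by apply: cont => z w; rewrite -ReB Re_le_normc.
have [cv1 cv2] : (forall y, continuous (v^~ y)) /\ (forall x, continuous (v x)).
  by apply: cont => z w; rewrite -ImB Im_le_normc.
pose nv x y := - v x y.
have cnv2 x : continuous (nv x) by move=> y; apply: (@continuousN _ R _ (v x) y (@cv2 x y)).
have d2 x y : `|x| < B -> `|y| < B -> exists l, diff2 u x y (complex.Re l) (- complex.Im l) /\
    diff2 v x y (complex.Im l) (complex.Re l).
  move=> xB yB; have [l dl] := dF _ (ptr x y); exists l.
  have est e : 0 < e -> exists2 d : R, 0 < d & forall h k, `|h| < d -> `|k| < d ->
      normc (F (pt (x + h) (y + k)) - F (pt x y) - l * (h +i* k)) <= e * (`|h| + `|k|).
    move=> e0; have [d d0 dP] := dl e e0.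
    exists (Num.min (d / 2) (Num.min (B - `|x|) (B - `|y|))).
      by rewrite !lt_min divr_gt0// !subr_gt0 xB.
    move=> h k; rewrite !lt_min => /and3P[hd hx hy] /and3P[kd kx ky].
    have ptE : pt (x + h) (y + k) = pt x y + (h +i* k).
      rewrite /pt !clid; [|exact: ltW|exact: ltW| |].
      - by apply: eqC; rewrite !ReImE/= addrA.
      - by apply: le_trans (ler_normD _ _) _; lra.
      - by apply: le_trans (ler_normD _ _) _; lra.
    have nhk : normc (h +i* k) <= `|h| + `|k| by exact: (normc_le_ReIm (h +i* k)).
    rewrite ptE; apply: le_trans (dP _ _) _; last by rewrite ler_pM2l.
    by lra.
  split=> e /est[d d0 dP]; exists d => // h k hd kd; apply: le_trans (dP h k hd kd).
    apply: le_trans (Re_le_normc _); rewrite !ReImE/= -/(u _ _) -/(u _ _).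
    by rewrite le_eqVlt; apply/orP; left; apply/eqP; congr `|_|; ring.
  apply: le_trans (Im_le_normc _); rewrite !ReImE/= -/(v _ _) -/(v _ _).
  by rewrite le_eqVlt; apply/orP; left; apply/eqP; congr `|_|; ring.
have bB x : - (r / 2) <= x < B -> `|x| < B.
  by move=> /andP[a b]; rewrite ltr_norml b andbT; rewrite /B; lra.
have [U1 U1P] : exists U : R -> R -> R, forall x y, - (r / 2) < x < B -> - (r / 2) < y < B ->
    is_derive x 1 (U^~ y) (u x y) /\ is_derive y 1 (U x) (nv x y).
  apply: primitive => // x y /bB xB /bB yB; have [l [du dv]] := d2 x y xB yB.
  exists (complex.Re l), (- complex.Im l), (- complex.Re l); split=> // e /dv[d d0 dP].
  exists d => // h k hd kd; apply: le_trans (dP h k hd kd); rewrite /nv.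
  by rewrite le_eqVlt; apply/orP; left; apply/eqP; rewrite -normrN; congr `|_|; ring.
have [U2 U2P] : exists U : R -> R -> R, forall x y, - (r / 2) < x < B -> - (r / 2) < y < B ->
    is_derive x 1 (U^~ y) (v x y) /\ is_derive y 1 (U x) (u x y).
  apply: primitive => // x y /bB xB /bB yB; have [l [du dv]] := d2 x y xB yB.
  by exists (complex.Im l), (complex.Re l), (- complex.Im l).
pose toU (V : R -> R -> R) w := V (complex.Re (w - c)) (complex.Im (w - c)).
exists (fun w => toU U1 w +i* toU U2 w) => z zr.
have ptz w : normc (w - c) < r / 2 -> pt (complex.Re (w - c)) (complex.Im (w - c)) = w.
  move=> wr; have := Re_le_normc (w - c); have := Im_le_normc (w - c) => a b.
  rewrite /pt !clid; [|rewrite /B; lra..].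
  by apply: eqC; rewrite !ReImE/= addrC subrK.
have cF w : normc (w - c) < r / 2 -> {for w, continuous F}.
  move=> wr; have [l] := dF w ltac:(lra); exact: cdiff_cont.
have cR : {for z, continuous (fun w => complex.Re (F w))}.
  apply/continuous_fromC => e e0; have /continuousCCP/(_ e e0)[d d0 dP] := cF z zr.
  by exists d => // w /dP; apply: le_lt_trans; rewrite -ReB Re_le_normc.
have cI : {for z, continuous (fun w => complex.Im (F w))}.
  apply/continuous_fromC => e e0; have /continuousCCP/(_ e e0)[d d0 dP] := cF z zr.
  by exists d => // w /dP; apply: le_lt_trans; rewrite -ImB Im_le_normc.
have part (V p q : R -> R -> R) (P Q : R[i] -> R) : (forall x y, - (r / 2) < x < B -> - (r / 2) < y < B ->
    is_derive x 1 (V^~ y) (p x y) /\ is_derive y 1 (V x) (q x y)) ->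
    (forall w, normc (w - c) < r / 2 -> p (complex.Re (w - c)) (complex.Im (w - c)) = P w /\
       q (complex.Re (w - c)) (complex.Im (w - c)) = Q w) ->
    has_partials (toU V) P Q z.
  move=> HV HPQ; exists (r / 2 - normc (z - c)); first by rewrite subr_gt0.
  move=> w wz; have wr : normc (w - c) < r / 2.
    by have := normc_tri3 w c z; lra.
  have := Re_le_normc (w - c); have := Im_le_normc (w - c).
  rewrite !ler_norml => /andP[a1 a2] /andP[a3 a4].
  have [<- <-] := HPQ w wr.
  have [D1 D2] := HV (complex.Re (w - c)) (complex.Im (w - c)) ltac:(rewrite /B; apply/andP; split; lra)
    ltac:(rewrite /B; apply/andP; split; lra).
  move/is_derive_translate : D1 => D1; move/is_derive_translate : D2 => D2.
  split.
    apply: is_derive_ext D1 => t; rewrite /toU mulr1 !ReImE/=; congr V; ring.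
  apply: is_derive_ext D2 => t; rewrite /toU !ReImE/=; congr V; ring.
have := @cauchy_riemann (toU U1) (toU U2) (fun w => toU U1 w +i* toU U2 w) z (fun=> erefl)
  (fun w => complex.Re (F w)) (fun w => complex.Im (F w)).
have FE : complex.Re (F z) +i* complex.Im (F z) = F z by case: (F z).
rewrite FE; apply=> //.
- by apply: part U1P _ => w wr; rewrite /nv /u /v ptz.
- by apply: part U2P _ => w wr; rewrite /u /v ptz.
Qed.

End plane_calculus.

(** * Cauchy's formula *)

Section complex_continuity.
Variables (R : realType) (T : topologicalType).
Implicit Types (f g : T -> R[i]) (x : T).

Lemma ccontD_at f g x : {for x, continuous f} -> {for x, continuous g} ->
  {for x, continuous (fun y => f y + g y)}.
Proof. by move=> cf cg; exact: (@cvgD _ R[i] _ _ _ f g _ _ cf cg). Qed.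
Lemma ccontB_at f g x : {for x, continuous f} -> {for x, continuous g} ->
  {for x, continuous (fun y => f y - g y)}.
Proof. by move=> cf cg; exact: (@cvgB _ R[i] _ _ _ f g _ _ cf cg). Qed.
Lemma ccontM_at f g x : {for x, continuous f} -> {for x, continuous g} ->
  {for x, continuous (fun y => f y * g y)}.
Proof. by move=> cf cg; exact: (@cvgM R[i] _ _ _ f g _ _ cf cg). Qed.
Lemma ccontV_at f x : f x != 0 -> {for x, continuous f} ->
  {for x, continuous (fun y => (f y)^-1)}.
Proof. by move=> f0 cf; exact: (@cvgV R[i] _ _ _ f _ f0 cf). Qed.
Lemma ccontD f g : continuous f -> continuous g -> continuous (fun y => f y + g y).
Proof. by move=> cf cg x; exact: (ccontD_at (cf x) (cg x)). Qed.
Lemma ccontB f g : continuous f -> continuous g -> continuous (fun y => f y - g y).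
Proof. by move=> cf cg x; exact: (ccontB_at (cf x) (cg x)). Qed.
Lemma ccontM f g : continuous f -> continuous g -> continuous (fun y => f y * g y).
Proof. by move=> cf cg x; exact: (ccontM_at (cf x) (cg x)). Qed.
Lemma ccontV f : (forall x, f x != 0) -> continuous f -> continuous (fun y => (f y)^-1).
Proof. by move=> f0 cf x; exact: (ccontV_at (f0 x) (cf x)). Qed.
Lemma ccontX f n : continuous f -> continuous (fun y => f y ^+ n).
Proof.
move=> cf; elim: n => [|n IH] x; first by under eq_fun do rewrite expr0; exact: cvg_cst.
by under eq_fun do rewrite exprS; exact: (ccontM_at (cf x) (IH x)).
Qed.
Lemma ccontC (k : R[i]) : continuous (fun _ : T => k).
Proof. by move=> x; exact: cvg_cst. Qed.

Lemma contRe_at f x : {for x, continuous f} -> {for x, continuous (fun y => complex.Re (f y))}.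
Proof.
move=> /continuousCP H; apply/cvgrPdist_lt => e e0.
have := H e e0; apply: filterS => y; apply: le_lt_trans.
by rewrite -ReB normcBC Re_le_normc.
Qed.
Lemma contIm_at f x : {for x, continuous f} -> {for x, continuous (fun y => complex.Im (f y))}.
Proof.
move=> /continuousCP H; apply/cvgrPdist_lt => e e0.
have := H e e0; apply: filterS => y; apply: le_lt_trans.
by rewrite -ImB normcBC Im_le_normc.
Qed.
Lemma contnormc_at f x : {for x, continuous f} -> {for x, continuous (fun y => normc (f y))}.
Proof.
move=> /continuousCP H; apply/cvgrPdist_lt => e e0.
have := H e e0; apply: filterS => y; apply: le_lt_trans.
rewrite ler_norml -(normcBC (f x)) normc_ge_sub andbT.
by have := normc_ge_sub (f y) (f x); rewrite [in X in X -> _]normcBC; lra.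
Qed.
Lemma cont_pair (p q : T -> R) x : {for x, continuous p} -> {for x, continuous q} ->
  {for x, continuous (fun y => p y +i* q y : R[i])}.
Proof.
move=> cp cq; apply/continuousCP => e e0; have e20 : 0 < e / 2 by rewrite divr_gt0.
move/cvgrPdist_lt/(_ _ e20) : cp => cp; move/cvgrPdist_lt/(_ _ e20) : cq => cq.
near=> y; apply: le_lt_trans (normc_le_ReIm _) _; rewrite !ReImE/= [e]splitr.
by rewrite ltrD// distrC; near: y.
Unshelve. all: by end_near. Qed.
End complex_continuity.

Section complex_path_integrals.
Variable R : realType.
Implicit Types (g G : R -> R[i]) (F P : R[i] -> R[i]) (t a b : R) (l m k : R[i]).

Lemma cont_comp (T : topologicalType) (S : topologicalType) (F : R[i] -> S) (g : T -> R[i]) x :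
  {for g x, continuous F} -> {for x, continuous g} -> {for x, continuous (fun y => F (g y))}.
Proof. by move=> cF cg; exact: (continuous_comp cg cF). Qed.

Definition pder g t l :=
  is_derive t 1 (fun s => complex.Re (g s)) (complex.Re l) /\
  is_derive t 1 (fun s => complex.Im (g s)) (complex.Im l).

Lemma pder_eps g t l : pder g t l <-> forall e : R, 0 < e ->
  exists2 d : R, 0 < d & forall h : R, `|h| < d -> normc (g (t + h) - g t - l * h%:C) <= e * `|h|.
Proof.
split=> [[/is_derive_eps dr /is_derive_eps di] e e0|H].
  have e20 : 0 < e / 2 by rewrite divr_gt0.
  have [d1 d10 H1] := dr _ e20; have [d2 d20 H2] := di _ e20.
  exists (Num.min d1 d2); first by rewrite lt_min d10.
  move=> h; rewrite lt_min => /andP[/H1{}H1 /H2{}H2].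
  apply: le_trans (normc_le_ReIm _) _; rewrite !ReImE/= !mulr0 subr0 add0r.
  by apply: le_trans (lerD H1 H2) _; rewrite -mulrDl -splitr.
split; apply/is_derive_eps => e /H[d d0 dP]; exists d => // h /dP; apply: le_trans.
  by apply: le_trans (Re_le_normc _); rewrite !ReImE/= !mulr0 subr0.
by apply: le_trans (Im_le_normc _); rewrite !ReImE/= !mulr0 add0r.
Qed.

Lemma pder_cont g t l : pder g t l -> {for t, continuous g}.
Proof.
move=> [/is_derive_cont dr /is_derive_cont di].
have := cont_pair dr di; rewrite (_ : (fun y => _) = g)//.
by apply/funext => s; case: (g s).
Qed.

Lemma pder_comp P g t l m : cdiff P (g t) l -> pder g t m -> pder (fun s => P (g s)) t (l * m).
Proof.
move=> dP dg; have /continuousCP cg := pder_cont dg; move/pder_eps : dg => dg.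
apply/pder_eps => e e0.
have n0 : 0 < normc l + normc m + 2 by rewrite ltr_wpDl// addr_ge0 ?normc_ge0.
pose e1 := Num.min 1 (e / (normc l + normc m + 2)).
have e10 : 0 < e1 by rewrite lt_min ltr01 divr_gt0.
have e1le : e1 * (normc l + normc m + 2) <= e.
  by rewrite -ler_pdivlMr// ge_min lexx orbT.
have e11 : e1 <= 1 by rewrite ge_min lexx.
have [d1 d10 H1] := dP e1 e10; have [d2 d20 H2] := dg e1 e10.
have /nbhs_ballP[d3 /= d30 H3] := cg d1 d10.
exists (Num.min d2 d3); first by rewrite lt_min d20.
move=> h; rewrite lt_min => /andP[hd2 hd3].
have := H3 (t + h); rewrite -ball_normE/= opprD addNKr normrN => /(_ hd3)/H1.
rewrite [g t + _]addrC subrK => A.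
have {}B := H2 h hd2; set u := g (t + h) - g t in A B.
have un : normc u <= (1 + normc m) * `|h|.
  rewrite (_ : u = (u - m * h%:C) + m * h%:C); last by rewrite subrK.
  apply: le_trans (le_normcD _ _) _; rewrite normcM normc_real mulrDl lerD2r.
  by apply: le_trans B _; rewrite ler_wpM2r.
rewrite (_ : P _ - _ - _ = (P (g (t + h)) - P (g t) - l * u) + l * (u - m * h%:C)); last by ring.
apply: le_trans (le_normcD _ _) _; rewrite normcM.
have C1 : e1 * normc u <= e1 * ((1 + normc m) * `|h|) by rewrite ler_pM2l.
have C2 : normc l * normc (u - m * h%:C) <= normc l * (e1 * `|h|) by rewrite ler_wpM2l ?normc_ge0.
apply: le_trans (lerD A C2) _; apply: le_trans (lerD C1 (lexx _)) _.
rewrite (_ : _ + _ = e1 * (normc l + normc m + 1) * `|h|); last by ring.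
rewrite ler_wpM2r// (le_trans _ e1le)// ler_pM2l//; lra.
Qed.

Lemma pderC k t : pder (fun=> k) t 0.
Proof. by split; exact: dC. Qed.

Lemma pderD g G t l m : pder g t l -> pder G t m -> pder (fun s => g s + G s) t (l + m).
Proof.
move=> [a b] [c d]; split.
  by rewrite ReD; apply: is_derive_ext (dD a c) => s; rewrite ReD.
by rewrite ImD; apply: is_derive_ext (dD b d) => s; rewrite ImD.
Qed.

Lemma pderM g G t l m : pder g t l -> pder G t m -> pder (fun s => g s * G s) t (l * G t + g t * m).
Proof.
move=> [a b] [c d]; split.
  have := dB (dM a c) (dM b d); rewrite (_ : _ - _ = complex.Re (l * G t + g t * m)).
    by apply: is_derive_ext => s; rewrite ReM.
  by rewrite !ReImE; ring.
have := dD (dM a d) (dM b c); rewrite (_ : _ + _ = complex.Im (l * G t + g t * m)).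
  by apply: is_derive_ext => s; rewrite ImM.
by rewrite !ReImE; ring.
Qed.

Lemma pder_eq g t l m : l = m -> pder g t l -> pder g t m.
Proof. by move=> ->. Qed.

Lemma pderZ g t l k : pder g t l -> pder (fun s => k * g s) t (k * l).
Proof. by move=> dg; apply: pder_eq (pderM (pderC k t) dg); rewrite mul0r add0r. Qed.

Lemma pder_real (p : R -> R) t (l : R) : is_derive t 1 p l -> pder (fun s => (p s)%:C) t l%:C.
Proof. by move=> dp; split; [exact: dp|exact: dC]. Qed.

Lemma cdiff_inv (z : R[i]) : z != 0 -> cdiff (fun w => w^-1) z (- (z ^+ 2)^-1).
Proof.
move=> z0; apply/cdiffP.
have [D1 D2] : is_derive z (1 : R[i]) (fun w => w^-1) (- z ^- 2).
  have did' : derivable (id : R[i] -> R[i]) z 1 by exact: derivable_id.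
  have D := @derivableV R[i] R[i] id z 1 z0 did'.
  have := @deriveV R[i] R[i] id z 1 z0 did'; rewrite derive_id => E.
  by apply: DeriveDef => //; rewrite E /GRing.scale/= mulr1.
exact: DeriveDef.
Qed.

Lemma pderV g t l : g t != 0 -> pder g t l -> pder (fun s => (g s)^-1) t (- l / g t ^+ 2).
Proof.
move=> g0 dg; have := pder_comp (cdiff_inv g0) dg.
by apply: pder_eq; rewrite mulNr mulrC mulNr.
Qed.

Definition CI a b g : R[i] :=
  (Int a b (fun t => complex.Re (g t))) +i* (Int a b (fun t => complex.Im (g t))).

Lemma cRe g : continuous g -> continuous (fun t => complex.Re (g t)).
Proof. by move=> cg t; exact: (contRe_at (cg t)). Qed.
Lemma cIm g : continuous g -> continuous (fun t => complex.Im (g t)).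
Proof. by move=> cg t; exact: (contIm_at (cg t)). Qed.

Lemma eq_CI a b g G : (forall t, a <= t <= b -> g t = G t) -> CI a b g = CI a b G.
Proof. by move=> H; rewrite /CI; congr (_ +i* _); apply: eq_Int => t /H ->. Qed.

Lemma CID a b g G : continuous g -> continuous G ->
  CI a b (fun t => g t + G t) = CI a b g + CI a b G.
Proof.
move=> cg cG; apply: eqC; rewrite ?ReD ?ImD/=.
  by rewrite -IntD; [apply: eq_Int => t _; rewrite ReD|exact: cRe..].
by rewrite -IntD; [apply: eq_Int => t _; rewrite ImD|exact: cIm..].
Qed.

Lemma CIZ a b k g : continuous g -> CI a b (fun t => k * g t) = k * CI a b g.
Proof.
move=> cg; have cr := cRe cg; have ci := cIm cg.
have cZ (x : R) (f : R -> R) : continuous f -> continuous (fun t => x * f t).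
  by move=> cf; apply: contM => //; exact: contC.
apply: eqC; rewrite ?ReM ?ImM/= -!IntZ//.
  by rewrite -IntB; [apply: eq_Int => t _; rewrite ReM|exact: cZ..].
by rewrite -IntD; [apply: eq_Int => t _; rewrite ImM|exact: cZ..].
Qed.

Lemma CIB a b g G : continuous g -> continuous G ->
  CI a b (fun t => g t - G t) = CI a b g - CI a b G.
Proof.
move=> cg cG; have cN : continuous (fun t => -1 * G t) by exact: (ccontM (@ccontC _ _ (-1)) cG).
have -> : CI a b g - CI a b G = CI a b g + CI a b (fun t => -1 * G t) by rewrite (CIZ _ _ _ cG) mulN1r.
by rewrite -(CID _ _ cg cN); apply: eq_CI => t _; rewrite mulN1r.
Qed.

(** The factor 2 comes from estimating real and imaginary parts separately; the applications
    tolerate any constant. *)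
Lemma CI_norm a b g (M : R) : a <= b -> continuous g ->
  (forall t, a <= t <= b -> normc (g t) <= M) -> normc (CI a b g) <= 2 * M * (b - a).
Proof.
move=> ab cg gM; apply: le_trans (normc_le_ReIm _) _ => /=.
rewrite -mulrA mulrDl !mul1r; apply: lerD; apply: Int_abs_le => //.
- exact: cRe.
- by move=> t /gM; apply: le_trans; exact: Re_le_normc.
- exact: cIm.
- by move=> t /gM; apply: le_trans; exact: Im_le_normc.
Qed.

Lemma CI_FTC2 a b G g : a <= b -> continuous g -> (forall t, pder G t (g t)) ->
  CI a b g = G b - G a.
Proof.
move=> ab cg dG; apply: eqC; rewrite ?ReB ?ImB/=.
  by apply: (@Int_FTC2 R a b (fun t => complex.Re (G t)) _ ab (cRe cg)) => t; have [] := dG t.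
by apply: (@Int_FTC2 R a b (fun t => complex.Im (G t)) _ ab (cIm cg)) => t; have [] := dG t.
Qed.

Lemma CI_DUI (k k1 : R -> R -> R[i]) (x0 a b M : R) :
  (forall x, continuous (k x)) -> (forall x y, pder (k^~ y) x (k1 x y)) ->
  (forall x y, normc (k1 x y) <= M) ->
  pder (fun x => CI a b (k x)) x0 (CI a b (k1 x0)).
Proof.
move=> ck dk bM; split=> /=.
  apply: (@Int_DUI R (fun x y => complex.Re (k x y)) (fun x y => complex.Re (k1 x y)) x0 a b 1 M) => //.
  - by move=> x _; exact: cRe.
  - by move=> x y _ _; have [] := dk x y.
  - by move=> x y _ _; apply: le_trans (bM x y); exact: Re_le_normc.
apply: (@Int_DUI R (fun x y => complex.Im (k x y)) (fun x y => complex.Im (k1 x y)) x0 a b 1 M) => //.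
- by move=> x _; exact: cIm.
- by move=> x y _ _; have [] := dk x y.
- by move=> x y _ _; apply: le_trans (bM x y); exact: Im_le_normc.
Qed.

Definition eit t : R[i] := cos t +i* sin t.

Lemma eit_der t : pder eit t ('i%C * eit t).
Proof.
split; rewrite /eit !ReImE/= !(mul0r, mul1r) ?sub0r ?add0r ?addr0.
  exact: is_derive_cos.
exact: is_derive_sin.
Qed.

Lemma eit_cont : continuous eit.
Proof. by move=> t; exact: (pder_cont (eit_der t)). Qed.

Lemma normc_eit t : normc (eit t) = 1.
Proof. by rewrite /= cos2Dsin2 sqrtr1. Qed.

(** The full turn starts at - pi / 2 so that pi / 2 cuts it into the right and the left half circle;
    [disc_integral_xprim] matches these with the two ends of horizontal chords. *)
Definition th0 : R := - (pi / 2).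
Definition th1 : R := pi + pi / 2.

Lemma th01 : th0 <= th1.
Proof. by rewrite /th0 /th1; have := pi_gt0 R; lra. Qed.

Lemma th1B0 : th1 - th0 = 2 * pi.
Proof. by rewrite /th0 /th1; field. Qed.

Lemma cos_th0 : cos th0 = 0 :> R.
Proof. by rewrite /th0 cosN cos_pihalf. Qed.
Lemma sin_th0 : sin th0 = -1 :> R.
Proof. by rewrite /th0 sinN sin_pihalf. Qed.
Lemma cos_th1 : cos th1 = 0 :> R.
Proof. by rewrite /th1 addrC cosDpi cos_pihalf oppr0. Qed.
Lemma sin_th1 : sin th1 = -1 :> R.
Proof. by rewrite /th1 addrC sinDpi sin_pihalf. Qed.

Lemma eit_period : eit th1 = eit th0.
Proof. by rewrite /eit cos_th0 cos_th1 sin_th0 sin_th1. Qed.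

End complex_path_integrals.
Arguments th0 {R}.
Arguments th1 {R}.

(** * Bounds on discs and segments by compactness *)

Section discs.
Variable R : realType.
Implicit Types (z w c : R[i]) (r : R).

Lemma compact_closed_disc c r : compact [set z : R[i] | normc (z - c) <= r].
Proof.
pose f (p : R * R) : R[i] := c + (p.1 +i* p.2).
have cf : continuous f.
  move=> p; have c1 : {for p, continuous (fun q : R * R => q.1 +i* q.2 : R[i])}.
    by apply: cont_pair; [exact: cvg_fst|exact: cvg_snd].
  exact: (ccontD_at (@ccontC R _ c p) c1).
have K : compact (`[- r, r] `*` `[- r, r] : set (R * R)).
  by apply: compact_setX; exact: segment_compact.
apply: (@subclosed_compact _ _ (f @` (`[- r, r] `*` `[- r, r]))).
- have : closed ((fun z => normc (z - c)) @^-1` [set x | x <= r]).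
    apply: preimage_closed; last exact: closed_le.
    move=> z _; have cz : {for z, continuous (id : R[i] -> R[i])} by exact: cvg_id.
    exact: (contnormc_at (ccontB_at cz (@ccontC R _ c z))).
  by [].
- by apply: continuous_compact => //; exact: continuous_subspaceT.
- move=> z /= zr; have := Re_le_normc (z - c); have := Im_le_normc (z - c).
  rewrite !ReImE => a b.
  exists (complex.Re (z - c), complex.Im (z - c)).
    rewrite /= !in_itv/= -!ler_norml !ReImE; split.
      exact: le_trans zr.
    exact: le_trans zr.
  rewrite /f/=; have -> : complex.Re (z - c) +i* complex.Im (z - c) = z - c by case: (z - c).
  by rewrite addrC subrK.
Qed.

Lemma disc_bounded (U : R[i] -> R) c r : 0 <= r ->
  (forall z, normc (z - c) <= r -> {for z, continuous U}) ->
  exists2 M, 0 <= M & forall z, normc (z - c) <= r -> `|U z| <= M.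
Proof.
move=> r0 cU; pose A := [set z : R[i] | normc (z - c) <= r].
have A0 : A !=set0 by exists c; rewrite /A/= subrr normc0.
have cA : {within A, continuous (fun z => `|U z|)}.
  apply: continuous_in_subspaceT => z; rewrite inE => /cU cz.
  exact: (continuous_comp cz (@norm_continuous _ R (U z))).
have [w _ wP] := compact_EVT_max A0 (@compact_closed_disc c r) cA.
by exists `|U w| => // z zr; apply: wP; rewrite inE.
Qed.

Lemma segment_bounded (f : R -> R) (a b : R) : continuous f ->
  exists2 M, 0 <= M & forall t, a <= t <= b -> `|f t| <= M.
Proof.
move=> cf; have [ab|ba] := leP a b; last first.
  by exists 0 => // t /andP[t1 t2]; have := le_trans t1 t2; rewrite leNgt ba.
have A0 : (`[a, b]%classic : set R) !=set0 by exists a; rewrite /= in_itv/= lexx.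
have cA : {within `[a, b], continuous (fun z : R => `|f z|)}.
  apply: continuous_subspaceT => z; exact: (continuous_comp (cf z) (@norm_continuous _ R (f z))).
have [w _ wP] := compact_EVT_max A0 (@segment_compact R a b) cA.
by exists `|f w| => // z zr; apply: wP; rewrite inE/= in_itv.
Qed.

End discs.

(** * Cauchy integrals over a circle *)

Section cauchy.
Variable R : realType.
Implicit Types (z w c h l X Y : R[i]) (r : R) (F P : R[i] -> R[i]) (phi : R -> R[i]).

Lemma iC_neq0 : ('i%C : R[i]) != 0.
Proof. by rewrite -normc_gt0 /= expr0n expr1n add0r sqrtr1. Qed.

Lemma is_derive_sin2 (s : R) : is_derive s 1 (fun s => sin s ^+ 2) (sin s * cos s *+ 2).
Proof.
have H : is_derive s 1 (fun s => sin s * sin s) (sin s * cos s *+ 2).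
  by have := dM (is_derive_sin s) (is_derive_sin s); rewrite [cos s * _]mulrC -mulr2n.
exact: is_derive_ext H.
Qed.

Lemma pder_const (g : R -> R[i]) a b : (forall t, pder g t 0) -> g a = g b.
Proof.
move=> dg; apply: eqC.
  by apply: (@zero_derive_const R (fun t => complex.Re (g t))) => t; have [] := dg t.
by apply: (@zero_derive_const R (fun t => complex.Im (g t))) => t; have [] := dg t.
Qed.

(** It is used with X = 1 / (zeta - z) and Y = 1 / (zeta - z - h), for which Y - X = h X Y. It
    expands Y^k in h to second order, with a constant depending on k and m only, hence uniform in
    zeta. The three summands of the new constant bound the three terms of the decomposition in the
    proof. *)
Lemma inv_pow_est (m : R) k : 0 <= m -> exists2 M, 0 <= M & forall X Y h,
  normc X <= m -> normc Y <= m -> Y - X = h * X * Y ->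
  normc (Y ^+ k - X ^+ k - k%:R * h * X ^+ k.+1) <= M * normc h ^+ 2.
Proof.
move=> m0; elim: k => [|k [M M0 IH]].
  by exists 0 => // X Y h _ _ _; rewrite !expr0 !mul0r subrr subr0 normc0.
exists (m * M + m ^+ 2 * k%:R * m ^+ k.+1 + m ^+ k * m ^+ 3).
  by rewrite !addr_ge0// !mulr_ge0// exprn_ge0.
move=> X Y h Xm Ym E; have {IH}A := IH X Y h Xm Ym E.
have YE : Y = X + h * X * Y by rewrite -E addrC subrK.
rewrite (_ : _ - _ - _ = Y * (Y ^+ k - X ^+ k - k%:R * h * X ^+ k.+1)
  + (Y - X) * (k%:R * h * X ^+ k.+1) + X ^+ k * (Y - X - h * X ^+ 2)); last first.
  by rewrite !exprS -natr1; ring.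
have nX j : normc (X ^+ j) <= m ^+ j by rewrite normcX lerXn2r ?nnegrE ?normc_ge0.
have B : normc (Y - X) <= m ^+ 2 * normc h.
  rewrite E !normcM expr2 mulrC [normc h * _]mulrC mulrA.
  by rewrite ler_wpM2r ?normc_ge0// ler_pM ?normc_ge0.
have Cc : Y - X - h * X ^+ 2 = h * X * (Y - X) by rewrite [RHS]mulrBr -E; ring.
have nk : normc (k%:R : R[i]) = k%:R.
  by rewrite -(rmorph_nat (@real_complex R)) normc_real normr_nat.
have hX j : 0 <= m ^+ j by exact: exprn_ge0.
rewrite [leRHS]mulrDl [X in _ <= X + _]mulrDl; apply: le_trans (le_normcD _ _) (lerD _ _).
  apply: le_trans (le_normcD _ _) (lerD _ _).
    by rewrite normcM -(mulrA m) ler_pM ?normc_ge0.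
  rewrite !normcM nk (_ : m ^+ 2 * _ * _ * _ = (m ^+ 2 * normc h) * (k%:R * normc h * m ^+ k.+1)); last by ring.
  rewrite ler_pM ?normc_ge0 ?mulr_ge0 ?normc_ge0//.
  by rewrite ler_wpM2l ?mulr_ge0 ?normc_ge0.
rewrite Cc normcM [normc (h * X * _)]normcM [normc (h * X)]normcM.
rewrite (_ : m ^+ k * _ * _ = m ^+ k * ((normc h * m) * (m ^+ 2 * normc h))); last by ring.
rewrite ler_pM ?normc_ge0 ?mulr_ge0 ?normc_ge0//.
by rewrite ler_pM ?normc_ge0 ?mulr_ge0 ?normc_ge0// ler_wpM2l ?normc_ge0.
Qed.

Variables (c : R[i]) (r : R).
Hypothesis r0 : 0 < r.

Definition circ (t : R) : R[i] := c + r%:C * eit t.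

Lemma circ_cont : continuous circ.
Proof.
exact: (ccontD (@ccontC R _ c) (ccontM (@ccontC R _ r%:C) (@eit_cont R))).
Qed.

Lemma circB_cont z : continuous (fun t => circ t - z).
Proof. exact: (ccontB circ_cont (@ccontC R _ z)). Qed.

Lemma cK z : continuous (fun _ : R => z).
Proof. exact: ccontC. Qed.

Lemma circBc t : circ t - c = r%:C * eit t.
Proof. by rewrite /circ addrC addKr. Qed.

Lemma normc_circBc t : normc (circ t - c) = r.
Proof. by rewrite circBc normcZr normc_eit mulr1 gtr0_norm. Qed.

Lemma circ_period : circ th1 = circ th0.
Proof. by rewrite /circ eit_period. Qed.

Lemma circ_der t : pder circ t ('i%C * (circ t - c)).
Proof.
have := pderD (pderC c t) (pderZ r%:C (eit_der t)).
by apply: pder_eq; rewrite circBc add0r mulrCA.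
Qed.

Lemma circB_ge z t : r - normc (z - c) <= normc (circ t - z).
Proof.
have := normc_tri3 (circ t) c z; rewrite normc_circBc; lra.
Qed.

Lemma circB_neq0 z t : normc (z - c) < r -> circ t - z != 0.
Proof.
by move=> zr; rewrite -normc_gt0; apply: lt_le_trans (circB_ge z t); rewrite subr_gt0.
Qed.

Lemma kernel_cont phi z k : continuous phi -> normc (z - c) < r ->
  continuous (fun t => phi t * (circ t - z)^-1 ^+ k).
Proof.
move=> cphi zr; have n0 t : circ t - z != 0 by exact: circB_neq0.
exact: (ccontM cphi (@ccontX _ _ _ k (ccontV n0 (@circB_cont z)))).
Qed.

(** The integration variable is the angle; the factor d zeta / dt of a contour integral has to be
    included in the density [phi]. *)
Definition cauchy_int k phi z := CI th0 th1 (fun t => phi t * (circ t - z)^-1 ^+ k).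

Lemma cauchy_int_der phi z k : continuous phi -> normc (z - c) < r ->
  cdiff (cauchy_int k phi) z (k%:R * cauchy_int k.+1 phi z).
Proof.
move=> cphi zr e e0; pose d := r - normc (z - c); have d0 : 0 < d by rewrite subr_gt0.
have [Ph Ph0 HPh] : exists2 M, 0 <= M & forall t, th0 <= t <= th1 -> normc (phi t) <= M.
  have cn : continuous (fun t => normc (phi t)) by move=> t; exact: (contnormc_at (cphi t)).
  have [M M0 H] := segment_bounded th0 th1 cn.
  by exists M => // t /H; rewrite ger0_norm ?normc_ge0.
have m0 : 0 <= 2 / d by rewrite divr_ge0// ltW.
have [M M0 HM] := inv_pow_est k m0.
pose K := 2 * (Ph * M) * (2 * pi) + 1.
have K0 : 0 < K by rewrite ltr_wpDl// !mulr_ge0// pi_ge0.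
(* The first bound keeps z + h at distance at least d / 2 from the circle, so that both kernels are
   at most 2 / d; the second makes the quadratic remainder at most e |h|. *)
exists (Num.min (d / 2) (e / K)); first by rewrite lt_min !divr_gt0.
move=> h; rewrite lt_min => /andP[hd]; rewrite ltr_pdivlMr// => hK.
have zhr : normc (z + h - c) < r.
  rewrite (_ : z + h - c = (z - c) + h); last by ring.
  by apply: le_lt_trans (le_normcD _ _) _; rewrite /d in hd; lra.
have c1 := @kernel_cont phi _ k cphi zhr; have c2 := @kernel_cont phi _ k cphi zr.
have c3 := @kernel_cont phi _ k.+1 cphi zr.
have -> : cauchy_int k phi (z + h) - cauchy_int k phi z - k%:R * cauchy_int k.+1 phi z * h =
  CI th0 th1 (fun t => phi t * (circ t - (z + h))^-1 ^+ k - phi t * (circ t - z)^-1 ^+ k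
     - (k%:R * h) * (phi t * (circ t - z)^-1 ^+ k.+1)).
  rewrite (CIB _ _ (ccontB c1 c2) (ccontM (@cK _) c3)) (CIB _ _ c1 c2) (CIZ _ _ _ c3).
  by rewrite [k%:R * _ * h]mulrAC.
apply: (@le_trans _ _ (2 * (Ph * (M * normc h ^+ 2)) * (th1 - th0))).
  apply: CI_norm; first exact: th01.
    exact: (ccontB (ccontB c1 c2) (ccontM (@cK _) c3)).
  move=> t /HPh pht; rewrite (_ : _ - _ - _ = phi t * ((circ t - (z + h))^-1 ^+ k -
    (circ t - z)^-1 ^+ k - k%:R * h * (circ t - z)^-1 ^+ k.+1)); last by ring.
  rewrite normcM ler_pM ?normc_ge0//.
  have A1 := circB_neq0 t zr; have A2 := circB_neq0 t zhr.
  apply: HM.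
  - rewrite normcV -[leRHS]invf_div lef_pV2 ?posrE ?normc_gt0 ?divr_gt0//.
    by have := circB_ge z t; rewrite -/d; lra.
  - rewrite normcV -[leRHS]invf_div lef_pV2 ?posrE ?normc_gt0 ?divr_gt0//.
    have := circB_ge z t; have := normc_tri3 (circ t) z (z + h).
    rewrite -/d [z + h - z]addrC addKr; lra.
  - by field; rewrite A1 A2.
rewrite th1B0 (_ : _ * _ = (2 * (Ph * M) * (2 * pi) * normc h) * normc h); last by ring.
rewrite ler_wpM2r ?normc_ge0//; apply: ltW; apply: le_lt_trans hK.
rewrite mulrC ler_wpM2l ?normc_ge0// /K; lra.
Qed.

(* The integral is constant in z: its derivative is the integral of an exact derivative over the circle. *)
Lemma CI_kappa z : normc (z - c) < r ->
  CI th0 th1 (fun t => (circ t - c) / (circ t - z)) = (2 * pi)%:C.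
Proof.
move=> zr; pose phi t := circ t - c.
have cphi : continuous phi by exact: circB_cont.
have C20 w : normc (w - c) < r -> cauchy_int 2 phi w = 0.
  move=> wr; have := @CI_FTC2 R th0 th1 (fun t => (circ t - w)^-1)
    (fun t => - 'i%C * (phi t * (circ t - w)^-1 ^+ 2)) (th01 R).
  have ck := @kernel_cont phi _ 2 cphi wr.
  rewrite (CIZ _ _ _ ck) circ_period subrr => H.
  have /eqP : - 'i%C * cauchy_int 2 phi w = 0.
    apply: H.
      exact: (ccontM (@cK _) ck).
    move=> t; have dB' := pderD (circ_der t) (pderC (- w) t).
    have n0 := circB_neq0 t wr.
    by apply: pder_eq (pderV n0 dB'); rewrite /phi addr0 exprVn; ring.
  by rewrite mulf_eq0 oppr_eq0 (negbTE iC_neq0) => /eqP.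
(* The path from c (at s = 0) to z (at s = pi / 2) stays in the disc for every real s, as
   [pder_const] requires. *)
pose p (s : R) := c + (sin s ^+ 2)%:C * (z - c).
have pr s : normc (p s - c) < r.
  rewrite /p addrC addKr normcZr ger0_norm ?sqr_ge0//; apply: le_lt_trans zr.
  by rewrite ler_piMl ?normc_ge0// sin2cos2 gerBl sqr_ge0.
have dp s : pder p s ((sin s * cos s *+ 2)%:C * (z - c)).
  have d1 : is_derive s 1 (fun s => sin s ^+ 2) (sin s * cos s *+ 2).
    exact: is_derive_sin2.
  have := pderD (pderC c s) (pderM (pder_real d1) (pderC (z - c) s)).
  by apply: pder_eq; rewrite mulr0 addr0 add0r.
have dJ s : pder (fun s => cauchy_int 1 phi (p s)) s 0.
  have := pder_comp (cauchy_int_der 1 cphi (pr s)) (dp s).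
  by apply: pder_eq; rewrite C20// mulr0 mul0r.
have := pder_const (pi / 2) 0 dJ; rewrite /p sin0 sin_pihalf expr0n expr1n mul0r addr0 mul1r.
rewrite [c + (z - c)]addrC subrK /cauchy_int => E.
transitivity (CI th0 th1 (fun t => phi t * (circ t - z)^-1 ^+ 1)); first by apply: eq_CI => t _; rewrite expr1.
rewrite E (@eq_CI _ _ _ _ (fun=> 1)).
  by rewrite /CI/= !Int_cst ?th01// th1B0 mul1r mul0r.
move=> t _; rewrite expr1 mulfV//; apply: circB_neq0.
by rewrite subrr normc0.
Qed.

(** The circle is contracted to z by [zeta]. The s-derivative of the integral is a multiple of the
    integral of F(zeta) (circ - c), and i sin^2 s times this integrand is the t-derivative of
    P(zeta), which integrates to 0 over a full turn. At the contracted end [CI_kappa] evaluates the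
    kernel. *)
Lemma cauchy_formula P F (r' : R) z : r < r' ->
  (forall w, normc (w - c) < r' -> cdiff P w (F w)) ->
  (forall w, normc (w - c) < r' -> {for w, continuous F}) ->
  normc (z - c) < r ->
  CI th0 th1 (fun t => P (circ t) * ((circ t - c) / (circ t - z))) = (2 * pi)%:C * P z.
Proof.
move=> rr' dP cF zr.
pose kap t := (circ t - c) / (circ t - z).
have ckap : continuous kap.
  have n0 t : circ t - z != 0 by exact: circB_neq0.
  exact: (ccontM (@circB_cont c) (ccontV n0 (@circB_cont z))).
pose zeta (s t : R) := z + (sin s ^+ 2)%:C * (circ t - z).
have zr1 s t : normc (zeta s t - c) <= r.
  rewrite (_ : zeta s t - c = (1 - sin s ^+ 2)%:C * (z - c) + (sin s ^+ 2)%:C * (circ t - c)); last first.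
    by rewrite /zeta rmorphB/=; ring.
  apply: le_trans (le_normcD _ _) _; rewrite !normcZr normc_circBc.
  have s0 : 0 <= sin s ^+ 2 by rewrite sqr_ge0.
  have s1 : 0 <= 1 - sin s ^+ 2 by rewrite -cos2sin2 sqr_ge0.
  rewrite !ger0_norm//; have := ler_wpM2l s1 (ltW zr); lra.
have zr2 s t : normc (zeta s t - c) < r' by exact: le_lt_trans rr'.
have [MF MF0 HMF] : exists2 M, 0 <= M & forall w, normc (w - c) <= r -> normc (F w) <= M.
  have [w wr|M M0 HM] := @disc_bounded R (fun w => normc (F w)) c r (ltW r0).
    by apply/contnormc_at/cF; exact: le_lt_trans rr'.
  by exists M => // w /HM; rewrite ger0_norm ?normc_ge0.
have czeta s : continuous (zeta s).
  exact: (ccontD (@cK z) (ccontM (@cK _) (@circB_cont z))).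
have cPz s : continuous (fun t => P (zeta s t)).
  move=> t; exact: (@cont_comp R _ _ P (zeta s) t (cdiff_cont (dP _ (zr2 s t))) (@czeta s t)).
have cFz s : continuous (fun t => F (zeta s t) * (circ t - c)).
  have cFz : continuous (fun t => F (zeta s t)).
    by move=> t; exact: (@cont_comp R _ _ F (zeta s) t (cF _ (zr2 s t)) (@czeta s t)).
  exact: (ccontM cFz (@circB_cont c)).
pose Phi s := CI th0 th1 (fun t => P (zeta s t) * kap t).
have d1 (s : R) : is_derive s 1 (fun s => sin s ^+ 2) (sin s * cos s *+ 2).
  exact: is_derive_sin2.
have dPhi s : pder Phi s (CI th0 th1 (fun t => (sin s * cos s *+ 2)%:C * (F (zeta s t) * (circ t - c)))).
  apply: (@CI_DUI _ (fun s t => P (zeta s t) * kap t)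
    (fun s t => (sin s * cos s *+ 2)%:C * (F (zeta s t) * (circ t - c))) _ _ _ (2 * (MF * r))).
  - by move=> s'; exact: (ccontM (@cPz s') ckap).
  - move=> s' t; have dz := pderD (pderC z s') (pderM (pder_real (d1 s')) (pderC (circ t - z) s')).
    have := pderM (@pder_comp R P (zeta^~ t) s' _ _ (dP _ (zr2 s' t)) dz) (pderC (kap t) s').
    apply: pder_eq; rewrite /kap; have n0 := circB_neq0 t zr.
    by field.
  - move=> s' t; rewrite normcZr normcM normc_circBc; apply: ler_pM.
    + exact: normr_ge0.
    + by rewrite mulr_ge0 ?normc_ge0 ?(ltW r0).
    + have : `|sin s' * cos s'| <= 1 * 1.
        by rewrite normrM; apply: ler_pM; rewrite ?normr_ge0// ler_norml ?sin_geN1 ?sin_le1 ?cos_geN1 ?cos_le1.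
      by rewrite normrMn -mulr_natr; lra.
    + by rewrite ler_wpM2r ?(ltW r0) ?HMF.
have dPhi0 s : pder Phi s 0.
  apply: pder_eq (dPhi s); rewrite (CIZ _ _ _ (@cFz s)).
  (* At sin s = 0 the exact derivative degenerates, but there the factor sin s cos s already
     vanishes. *)
  have [s0|s0] := eqVneq (sin s) 0; first by rewrite s0 mul0r mul0rn mul0r.
  have : CI th0 th1 (fun t => ((sin s ^+ 2)%:C * 'i%C) * (F (zeta s t) * (circ t - c))) = 0.
    have cc := ccontM (@cK ((sin s ^+ 2)%:C * 'i%C)) (@cFz s).
    have dd t : pder (fun t => P (zeta s t)) t ((sin s ^+ 2)%:C * 'i%C * (F (zeta s t) * (circ t - c))).
      have dz := pderD (pderC z t) (pderZ (sin s ^+ 2)%:C (pderD (circ_der t) (pderC (- z) t))).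
      have := @pder_comp R P (zeta s) t _ _ (dP _ (zr2 s t)) dz.
      by apply: pder_eq; ring.
    by rewrite (CI_FTC2 (th01 R) cc dd) /zeta circ_period subrr.
  rewrite (CIZ _ _ _ (@cFz s)) => /eqP; rewrite mulf_eq0 mulf_eq0 => /orP[/orP[]|/eqP -> //]; last first.
  - by rewrite mulr0.
  - by rewrite (negbTE iC_neq0).
  - by rewrite -normc_eq0 normc_real normr_eq0 sqrf_eq0 (negbTE s0).
have := pder_const (pi / 2) 0 dPhi0; rewrite /Phi.
rewrite (@eq_CI _ _ _ _ (fun t => P (circ t) * kap t)); last first.
  by move=> t _; rewrite /zeta sin_pihalf expr1n mul1r [z + _]addrC subrK.
move=> ->; rewrite (@eq_CI _ _ _ _ (fun t => P z * kap t)); last first.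
  by move=> t _; rewrite /zeta sin0 expr0n mul0r addr0.
by rewrite (CIZ _ _ _ ckap) CI_kappa// mulrC.
Qed.

End cauchy.

(** * Orders of zeros of holomorphic functions *)

Section holomorphic.
Variable R : realType.
Implicit Types (z w c h l : R[i]) (r : R) (F G P : R[i] -> R[i]).

Definition holo F c r := forall z, normc (z - c) < r -> exists l, cdiff F z l.

Lemma cdiff_unique F z l m : cdiff F z l -> cdiff F z m -> l = m.
Proof. by move=> /cdiffP[_ <-] /cdiffP[_ <-]. Qed.

Lemma cdiff_near F G z l : (exists2 d : R, 0 < d & forall w, normc (w - z) < d -> F w = G w) ->
  cdiff F z l -> cdiff G z l.
Proof.
move=> [d d0 FG] dF e /dF[d1 d10 H].
exists (Num.min d d1); first by rewrite lt_min d0.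
move=> h; rewrite lt_min => /andP[hd hd1].
by rewrite -!FG ?subrr ?normc0// ?[z + h - z]addrC ?addKr//; exact: H.
Qed.

Lemma disc_sub z c r w : normc (w - z) < r - normc (z - c) -> normc (w - c) < r.
Proof. by have := normc_tri3 w c z; lra. Qed.

Lemma cdiff_disc F G c r z l : (forall w, normc (w - c) < r -> F w = G w) ->
  normc (z - c) < r -> cdiff F z l -> cdiff G z l.
Proof.
move=> FG zr; apply: cdiff_near; exists (r - normc (z - c)); first by rewrite subr_gt0.
by move=> w /disc_sub; exact: FG.
Qed.

Lemma cdiffC (k : R[i]) z : cdiff (fun=> k) z 0.
Proof. by move=> e e0; exists 1 => // h _; rewrite subrr mul0r subr0 normc0 mulr_ge0 ?normc_ge0 ?ltW. Qed.
Lemma cdiff_id z : cdiff (fun w => w) z 1.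
Proof.
move=> e e0; exists 1 => // h _; rewrite mul1r [z + h]addrC addrK subrr normc0.
by rewrite mulr_ge0 ?normc_ge0 ?ltW.
Qed.
Lemma cdiffB F G z l m : cdiff F z l -> cdiff G z m -> cdiff (fun w => F w - G w) z (l - m).
Proof. by move=> /cdiffP dF /cdiffP dG; apply/cdiffP; exact: (is_deriveB dF dG). Qed.
Lemma cdiffM F G z l m : cdiff F z l -> cdiff G z m ->
  cdiff (fun w => F w * G w) z (l * G z + F z * m).
Proof.
move=> /cdiffP dF /cdiffP dG; apply/cdiffP.
have -> : l * G z + F z * m = F z *: m + G z *: l.
  by rewrite /GRing.scale/= addrC [l * _]mulrC.
exact: (is_deriveM dF dG).
Qed.
Lemma cdiff_comp F G z l m : cdiff F (G z) l -> cdiff G z m -> cdiff (fun w => F (G w)) z (l * m).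
Proof.
move=> dF dG; have cG := cdiff_cont dG.
move/continuousCCP : cG => cG e e0.
have n0 : 0 < normc l + normc m + 2 by rewrite ltr_wpDl// addr_ge0 ?normc_ge0.
pose e1 := Num.min 1 (e / (normc l + normc m + 2)).
have e10 : 0 < e1 by rewrite lt_min ltr01 divr_gt0.
have e1le : e1 * (normc l + normc m + 2) <= e.
  by rewrite -ler_pdivlMr// ge_min lexx orbT.
have e11 : e1 <= 1 by rewrite ge_min lexx.
have [d1 d10 H1] := dF e1 e10; have [d2 d20 H2] := dG e1 e10.
have [d3 d30 H3] := cG d1 d10.
exists (Num.min d2 d3); first by rewrite lt_min d20.
move=> h; rewrite lt_min => /andP[hd2 hd3].
have := H3 (z + h); rewrite [z + h - z]addrC addKr => /(_ hd3)/H1.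
rewrite [G z + _]addrC subrK => A.
have {}B := H2 h hd2; set u := G (z + h) - G z in A B.
have un : normc u <= (1 + normc m) * normc h.
  rewrite (_ : u = (u - m * h) + m * h); last by rewrite subrK.
  apply: le_trans (le_normcD _ _) _; rewrite normcM mulrDl lerD2r.
  by apply: le_trans B _; rewrite ler_wpM2r ?normc_ge0.
rewrite (_ : F _ - _ - _ = (F (G (z + h)) - F (G z) - l * u) + l * (u - m * h)); last by ring.
apply: le_trans (le_normcD _ _) _; rewrite normcM.
have C1 : e1 * normc u <= e1 * ((1 + normc m) * normc h) by rewrite ler_pM2l.
have C2 : normc l * normc (u - m * h) <= normc l * (e1 * normc h) by rewrite ler_wpM2l ?normc_ge0.
apply: le_trans (lerD A C2) _; apply: le_trans (lerD C1 (lexx _)) _.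
rewrite (_ : _ + _ = e1 * (normc l + normc m + 1) * normc h); last by ring.
rewrite ler_wpM2r ?normc_ge0// (le_trans _ e1le)// ler_pM2l//; lra.
Qed.

Lemma holo_sub F c r z s : holo F c r -> s <= r - normc (z - c) -> holo F z s.
Proof. by move=> hF sr w ws; apply: hF; apply: disc_sub (lt_le_trans ws sr). Qed.

Lemma holo_cont F c r z : holo F c r -> normc (z - c) < r -> {for z, continuous F}.
Proof. by move=> hF /hF[l]; exact: cdiff_cont. Qed.

Lemma twopi_neq0 : (2 * pi)%:C != 0 :> R[i].
Proof. by rewrite -normc_eq0 normc_real normr_eq0 mulf_neq0// gt_eqF// pi_gt0. Qed.

Lemma circ_holo_cont F c r r' : 0 < r -> r < r' -> holo F c r' -> continuous (fun t => F (circ c r t)).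
Proof.
move=> r0 rr' hF t; apply: (@cont_comp R _ _ F (circ c r) t); last exact: (@circ_cont R c r t).
by apply: (holo_cont hF); rewrite normc_circBc.
Qed.

(** Cauchy's formula with a density independent of z, the form to which [cauchy_int_der] applies. *)
Lemma cauchy_repr F P c r r' : 0 < r -> r < r' ->
  (forall w, normc (w - c) < r' -> cdiff P w (F w)) ->
  (forall w, normc (w - c) < r' -> {for w, continuous F}) ->
  exists2 phi : R -> R[i], continuous phi &
    forall z, normc (z - c) < r -> P z = cauchy_int c r 1 phi z.
Proof.
move=> r0 rr' dP cF.
exists (fun t => (2 * pi)%:C^-1 * (P (circ c r t) * (circ c r t - c))).
  have hP : holo P c r' by move=> w /dP; exists (F w).
  exact: (ccontM (@cK _ _) (ccontM (circ_holo_cont r0 rr' hP) (@circB_cont R c r c))).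
move=> z zr; have cP := @circ_holo_cont P c r r' r0 rr' (fun w wr => ex_intro _ _ (dP w wr)).
have n0 t : circ c r t - z != 0 by exact: circB_neq0.
have cc := ccontM cP (ccontM (@circB_cont R c r c) (ccontV n0 (@circB_cont R c r z))).
have E := cauchy_formula r0 rr' dP cF zr.
apply: (mulfI twopi_neq0); rewrite -E /cauchy_int -[LHS]mul1r -(mulfV twopi_neq0) -mulrA.
congr (_ * _); rewrite -(CIZ _ _ _ cc); apply: eq_CI => t _; rewrite expr1; ring.
Qed.

(** Continuity of the derivative is not known beforehand, so Cauchy's formula is applied to a local
    primitive P, whose derivative F is continuous. As P is a Cauchy integral, so are F and its
    derivative up to constants, and Cauchy integrals are differentiable. *)
Lemma holo_regular F c r : holo F c r -> exists2 F1, (forall z, normc (z - c) < r -> cdiff F z (F1 z)) & holo F1 c r.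
Proof.
move=> hF; have /choice[F1 F1P] : forall z, exists l, normc (z - c) < r -> cdiff F z l.
  move=> z; have [/hF[l dl]|zr] := ltP (normc (z - c)) r; first by exists l.
  by exists 0 => h.
exists F1 => // z zr; pose s := r - normc (z - c); have s0 : 0 < s by rewrite subr_gt0.
have hFz : holo F z s by exact: holo_sub hF _.
have [P dP] := holo_primitive s0 hFz.
have s40 : 0 < s / 4 by rewrite divr_gt0.
have s42 : s / 4 < s / 2 by lra.
have cF w : normc (w - z) < s / 2 -> {for w, continuous F}.
  by move=> ws; apply: (holo_cont hFz); lra.
have [phi cphi PE] := cauchy_repr s40 s42 dP cF.
have FE w : normc (w - z) < s / 4 -> cauchy_int z (s / 4) 2 phi w = F w.
  move=> ws; have d1 := cauchy_int_der s40 1 cphi ws; rewrite mul1r in d1.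
  apply: (cdiff_unique d1); apply: (cdiff_disc PE ws).
  by apply: dP; lra.
have F1E w : normc (w - z) < s / 4 -> 2%:R * cauchy_int z (s / 4) 3 phi w = F1 w.
  move=> ws; have d2 := cauchy_int_der s40 2 cphi ws.
  apply: (cdiff_unique (cdiff_disc FE ws d2)); apply: F1P; apply: (@disc_sub z).
  by rewrite -/s; lra.
have zz : normc (z - z) < s / 4 by rewrite subrr normc0.
have d3 := cdiffM (cdiffC 2%:R z) (cauchy_int_der s40 3 cphi zz).
by exists (0 * cauchy_int z (s / 4) 3 phi z + 2%:R * (3%:R * cauchy_int z (s / 4) 4 phi z));
  exact: cdiff_disc F1E zz d3.
Qed.

Lemma holo_repr F c r r' : 0 < r -> r < r' -> holo F c r' ->
  forall z, normc (z - c) < r ->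
    CI th0 th1 (fun t => F (circ c r t) * ((circ c r t - c) / (circ c r t - z))) = (2 * pi)%:C * F z.
Proof.
move=> r0 rr' /holo_regular[F1 dF hF1] z zr.
by apply: (cauchy_formula r0 rr' dF) => // w; exact: holo_cont.
Qed.

(** Subtracting the Cauchy integrals at z and at c, the identity 1 / (zeta - z) - 1 / (zeta - c) =
    (z - c) / ((zeta - z) (zeta - c)) exhibits the quotient near c as a Cauchy integral, regular at
    c itself. *)
Lemma holo_divide F c r : 0 < r -> holo F c r -> F c = 0 ->
  exists2 G, holo G c r & forall z, normc (z - c) < r -> F z = (z - c) * G z.
Proof.
move=> r0 hF F0; have [F1 dF hF1] := holo_regular hF.
have cF1 w : normc (w - c) < r -> {for w, continuous F1} by exact: holo_cont.
have r20 : 0 < r / 2 by rewrite divr_gt0.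
have r2r : r / 2 < r by lra.
have [phi cphi FE] := cauchy_repr r20 r2r dF cF1.
have cc : normc (c - c) < r / 2 by rewrite subrr normc0.
pose psi t := phi t * (circ c (r / 2) t - c)^-1.
have n0 (w : R[i]) t : normc (w - c) < r / 2 -> circ c (r / 2) t - w != 0 by exact: circB_neq0.
have cpsi : continuous psi by exact: (ccontM cphi (ccontV (fun t => n0 c t cc) (@circB_cont R c (r / 2) c))).
pose G0 := cauchy_int c (r / 2) 1 psi.
have FG z : normc (z - c) < r / 2 -> F z = (z - c) * G0 z.
  move=> zr; have k1 := @kernel_cont R c (r / 2) r20 psi z 1 cpsi zr.
  have k2 := @kernel_cont R c (r / 2) r20 phi z 1 cphi zr.
  have k3 := @kernel_cont R c (r / 2) r20 phi c 1 cphi cc.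
  rewrite -[LHS]subr0 -F0 (FE z zr) (FE c cc) /G0 /cauchy_int -(CIZ _ _ _ k1) -(CIB _ _ k2 k3).
  apply: eq_CI => t _; rewrite /psi !expr1; have A := n0 z t zr; have B := n0 c t cc.
  by field; rewrite A B.
exists (fun z => if z == c then G0 c else F z / (z - c)).
  move=> z zr; have [->|zc] := eqVneq z c.
    have d1 := cauchy_int_der r20 1 cpsi cc.
    exists (1%:R * cauchy_int c (r / 2) 2 psi c); apply: cdiff_disc cc d1 => w wr.
    have [->//|wc] := eqVneq w c; rewrite FG// mulrAC mulfV ?mul1r// subr_eq0//.
  have [l dl] := hF z zr; have zc0 : z - c != 0 by rewrite subr_eq0.
  have dz := cdiffB (cdiff_id z) (cdiffC c z).
  have dq := cdiffM dl (@cdiff_comp (fun w => w^-1) (fun w => w - c) z _ _ (cdiff_inv zc0) dz).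
  eexists; apply: cdiff_near dq; exists (normc (z - c)); first by rewrite normc_gt0.
  move=> w wz; case: eqP => // wc; move: wz; rewrite wc normcBC; by rewrite ltxx.
move=> z zr; case: eqP => [->|/eqP zc]; first by rewrite subrr mul0r.
by rewrite mulrCA mulfV ?mulr1// subr_eq0.
Qed.

(** All F j are divided by z - c together, so that the order found is that of the vector. If the
    division never stops, Cauchy's formula on |z - c| = r / 2 bounds F j by 4 M / 2^k on |z - c| < r
    / 4 for every k, and F j vanishes there. *)
Lemma holo_order n (F : 'I_n -> R[i] -> R[i]) c r : 0 < r -> (forall j, holo (F j) c r) ->
  (forall j z, normc (z - c) < r / 4 -> F j z = 0) \/
  exists m, exists G : 'I_n -> R[i] -> R[i], [/\ forall j, holo (G j) c r,
    exists j, G j c != 0 & forall j z, normc (z - c) < r -> F j z = (z - c) ^+ m * G j z].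
Proof.
move=> r0 hF; case: (pselect (exists m, exists G : 'I_n -> R[i] -> R[i], [/\ forall j, holo (G j) c r,
    exists j, G j c != 0 & forall j z, normc (z - c) < r -> F j z = (z - c) ^+ m * G j z])) => [|no].
  by right.
left=> j z zr.
have fac k : exists G : 'I_n -> R[i] -> R[i], (forall j, holo (G j) c r) /\
    forall j z, normc (z - c) < r -> F j z = (z - c) ^+ k * G j z.
  elim: k => [|k [G [hG FG]]].
    by exists F; split=> // i w _; rewrite expr0 mul1r.
  have G0 i : G i c = 0.
    apply: contrapT => /eqP Gi; apply: no; exists k, G; split=> //; by exists i.
  have /choice[G' G'P] : forall i, exists G', holo G' c r /\
      forall z, normc (z - c) < r -> G i z = (z - c) * G' z.
    by move=> i; have [G' A B] := holo_divide r0 (hG i) (G0 i); exists G'.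
  exists G'; split=> [i|i w wr]; first by have [] := G'P i.
  by rewrite FG//; have [_ ->//] := G'P i; rewrite exprSr mulrA.
have r20 : 0 < r / 2 by rewrite divr_gt0.
have r2r : r / 2 < r by lra.
have [M M0 HM] : exists2 M, 0 <= M & forall w, normc (w - c) <= r / 2 -> normc (F j w) <= M.
  have [w wr|M M0 HM] := @disc_bounded R (fun w => normc (F j w)) c (r / 2) (ltW r20).
    by apply/contnormc_at/(holo_cont (hF j)); exact: le_lt_trans r2r.
  by exists M => // w /HM; rewrite ger0_norm ?normc_ge0.
have zr2 : normc (z - c) < r / 2 by lra.
have est k : normc (F j z) <= 4 * M / 2 ^+ k.
  have [G [hG FG]] := fac k.
  have E := holo_repr r20 r2r (hG j) zr2.
  have nG : normc ((2 * pi)%:C * G j z) <= 2 * (M / (r / 2) ^+ k * 2) * (th1 - th0).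
    rewrite -E; have n0 t : circ c (r / 2) t - z != 0 by exact: circB_neq0.
    have cc := ccontM (circ_holo_cont r20 r2r (hG j))
      (ccontM (@circB_cont R c (r / 2) c) (ccontV n0 (@circB_cont R c (r / 2) z))).
    apply: (CI_norm (th01 R) cc) => t _; rewrite normcM normc_div normc_circBc//.
    apply: ler_pM; [exact: normc_ge0|by rewrite divr_ge0 ?normc_ge0 ?(ltW r20)| |].
      have := HM (circ c (r / 2) t); rewrite normc_circBc// lexx => /(_ isT).
      rewrite FG ?normc_circBc// normcM normcX normc_circBc// mulrC => H.
      by rewrite ler_pdivlMr ?exprn_gt0.
    rewrite ler_pdivrMr ?normc_gt0//; have := circB_ge c r20 z t; lra.
  have GM : normc (G j z) <= 4 * M / (r / 2) ^+ k.
    move: nG; rewrite normcZr gtr0_norm ?mulr_gt0 ?pi_gt0// th1B0.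
    rewrite (_ : 2 * (_ * 2) * _ = 2 * pi * (4 * M / (r / 2) ^+ k)); last by ring.
    by rewrite ler_pM2l ?mulr_gt0 ?pi_gt0.
  rewrite FG; last by lra.
  rewrite normcM normcX.
  have z4 : normc (z - c) ^+ k <= (r / 2 / 2) ^+ k.
    by rewrite lerXn2r ?nnegrE ?normc_ge0//; [rewrite !divr_ge0// ltW|lra].
  apply: le_trans (ler_pM _ (normc_ge0 _) z4 GM) _; first by rewrite exprn_ge0 ?normc_ge0.
  rewrite expr_div_n le_eqVlt; apply/orP; left; apply/eqP.
  have A : (r / 2) ^+ k != 0 by rewrite expf_neq0// gt_eqF.
  by field; rewrite A expf_neq0.
apply/eqP; rewrite -normc_eq0 eq_le normc_ge0 andbT leNgt; apply/negP => F0.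
pose k := Num.truncn (4 * M / normc (F j z)).
have := est k.+1; apply/negP; rewrite -ltNge ltr_pdivrMr ?exprn_gt0//.
have : 4 * M / normc (F j z) < k.+1%:R by exact: truncnS_gt.
rewrite ltr_pdivrMr// => /lt_le_trans; apply; rewrite mulrC ler_wpM2l ?normc_ge0//.
by rewrite -natrX ler_nat; apply: ltnW; exact: ltn_expl.
Qed.

End holomorphic.

(** * Smooth functions on plane discs *)

Section smooth_plane_functions.
Variable R : realType.
Implicit Types (z w c v : R[i]) (r : R) (F : R[i] -> R[i]) (u : R[i] -> R).

(** C^k on a disc with the partials as witnesses instead of [real_derive]: their values outside the
    disc are free, and sums, products and composites are handled by writing down new witnesses. *)
Fixpoint pC (k : nat) c r u : Prop :=
  (forall z, normc (z - c) < r -> {for z, continuous u}) /\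
  if k is k'.+1 then exists ux uy,
    [/\ forall z, normc (z - c) < r -> rder u 1 z (ux z) /\ rder u 'i%C z (uy z),
        pC k' c r ux & pC k' c r uy] else True.

Lemma pC_cont k c r u z : pC k c r u -> normc (z - c) < r -> {for z, continuous u}.
Proof. by case: k => [|k] [H _]; exact: H. Qed.

Lemma pC_le k c r u : pC k.+1 c r u -> pC k c r u.
Proof.
elim: k u => [|k IH] u; first by case.
by move=> [cu [ux [uy [du Hx Hy]]]]; split=> //; exists ux, uy; split=> //; exact: IH.
Qed.

Lemma rder_near u (f : R[i] -> R) z v l : (exists2 d : R, 0 < d & forall w, normc (w - z) < d -> u w = f w) ->
  rder u v z l -> rder f v z l.
Proof.
move=> [d d0 uf]; apply: is_derive_near.
have n0 : 0 < normc v + 1 by rewrite ltr_wpDl ?normc_ge0.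
exists (d / (normc v + 1)); first by rewrite divr_gt0.
move=> t; rewrite subr0 ltr_pdivlMr// => td; apply: uf.
rewrite [z + _]addrC addrK normcZr; apply: le_lt_trans td.
by rewrite ler_wpM2l// lerDl.
Qed.

Lemma cont_near u (f : R[i] -> R) z : (exists2 d : R, 0 < d & forall w, normc (w - z) < d -> u w = f w) ->
  {for z, continuous u} -> {for z, continuous f}.
Proof.
move=> [d d0 uf] /continuous_fromC H; apply/continuous_fromC => e /H[d1 d10 H1].
exists (Num.min d d1); first by rewrite lt_min d0.
move=> w; rewrite lt_min => /andP[wd /H1]; by rewrite -(uf w wd) -(uf z) ?subrr ?normc0.
Qed.

Lemma disc_near c r z (Q : R[i] -> Prop) : (forall w, normc (w - c) < r -> Q w) ->
  normc (z - c) < r -> exists2 d : R, 0 < d & forall w, normc (w - z) < d -> Q w.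
Proof.
move=> H zr; exists (r - normc (z - c)); first by rewrite subr_gt0.
by move=> w /disc_sub; exact: H.
Qed.

Lemma pC_ext k c r u (f : R[i] -> R) : (forall z, normc (z - c) < r -> u z = f z) -> pC k c r u -> pC k c r f.
Proof.
move=> uf; case: k => [|k] [cu H]; split=> //; try by move=> z zr; apply: cont_near (disc_near uf zr) (cu z zr).
case: H => ux [uy [du Hx Hy]]; exists ux, uy; split=> // z zr; have [d1 d2] := du z zr.
by split; [exact: rder_near (disc_near uf zr) d1|exact: rder_near (disc_near uf zr) d2].
Qed.

Lemma pC_sub k c r u z s : pC k c r u -> s <= r - normc (z - c) -> pC k z s u.
Proof.
move=> H sr; have sub w : normc (w - z) < s -> normc (w - c) < r.
  by move=> ws; apply: disc_sub (lt_le_trans ws sr).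
elim: k u H => [|k IH] u [cu H]; split=> //; try by move=> w /sub; exact: cu.
by case: H => ux [uy [du Hx Hy]]; exists ux, uy; split=> [w /sub/du//||]; exact: IH.
Qed.

Lemma rder_val u v z l m : l = m -> rder u v z l -> rder u v z m.
Proof. by move=> ->. Qed.

Lemma line0 z v : z + (0 : R)%:C * v = z.
Proof. by rewrite mul0r addr0. Qed.

Lemma rderC (a : R) v z : rder (fun=> a) v z 0.
Proof. exact: dC. Qed.
Lemma rderD u (f : R[i] -> R) v z l m : rder u v z l -> rder f v z m -> rder (fun w => u w + f w) v z (l + m).
Proof. exact: dD. Qed.
Lemma rderM u (f : R[i] -> R) v z l m : rder u v z l -> rder f v z m ->
  rder (fun w => u w * f w) v z (l * f z + u z * m).
Proof. by move=> d1 d2; have := dM d1 d2; rewrite !line0. Qed.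

Lemma rder_comp (g : R -> R) u v z l m : is_derive (u z) 1 g l -> rder u v z m ->
  rder (fun w => g (u w)) v z (l * m).
Proof.
move=> dg du; have E : u (z + (0 : R)%:C * v) = u z by rewrite line0.
rewrite -E in dg; exact: (@dcomp R g (fun t => u (z + t%:C * v)) 0 _ _ dg du).
Qed.

Lemma is_derive_inv (x : R) : x != 0 -> is_derive x 1 (fun y => y^-1) (- (x * x)^-1).
Proof.
move=> x0; have D : is_derive x 1 (id : R -> R) 1 by exact: is_derive_id.
have dv : derivable (fun y : R => y^-1) x 1.
  by apply: (@derivableV R R id x 1 x0); exact: ex_derive.
apply: DeriveDef => //; rewrite (@deriveV R R id x 1 x0); last exact: ex_derive.
by rewrite (@derive_val _ _ _ _ _ _ _ D) /GRing.scale/= mulr1 expr2.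
Qed.

Lemma pC_const k c r (a : R) : pC k c r (fun=> a).
Proof.
elim: k a => [|k IH] a; (split; first by move=> z _; exact: (@contC R _ a z)); first by [].
by exists (fun=> 0), (fun=> 0); split=> // z _; split; exact: rderC.
Qed.

Lemma pCD k c r u (f : R[i] -> R) : pC k c r u -> pC k c r f -> pC k c r (fun w => u w + f w).
Proof.
elim: k u f => [|k IH] u f [cu H] [cf H']; split=> //; try by move=> z zr; exact: (contD_at (cu z zr) (cf z zr)).
case: H => ux [uy [du Hx Hy]]; case: H' => fx [fy [df Hfx Hfy]].
exists (fun w => ux w + fx w), (fun w => uy w + fy w); split; [|exact: IH..].
by move=> z zr; have [a b] := du z zr; have [a' b'] := df z zr; split; exact: rderD.
Qed.

Lemma pCM k c r u (f : R[i] -> R) : pC k c r u -> pC k c r f -> pC k c r (fun w => u w * f w).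
Proof.
elim: k u f => [|k IH] u f Hu Hf.
  by case: Hu Hf => [cu _] [cf _]; split=> // z zr; exact: (contM_at (cu z zr) (cf z zr)).
have Hu' := pC_le Hu; have Hf' := pC_le Hf.
split; first by move=> z zr; exact: (contM_at (pC_cont Hu zr) (pC_cont Hf zr)).
case: Hu => _ [ux [uy [du Hx Hy]]]; case: Hf => _ [fx [fy [df Hfx Hfy]]].
exists (fun w => ux w * f w + u w * fx w), (fun w => uy w * f w + u w * fy w).
split; [|by apply: pCD; exact: IH..].
by move=> z zr; have [a b] := du z zr; have [a' b'] := df z zr; split; exact: rderM.
Qed.

Lemma pCN k c r u : pC k c r u -> pC k c r (fun w => - u w).
Proof.
move=> H; apply: pC_ext (pCM (pC_const k c r (-1)) H) => z _.
by rewrite mulN1r.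
Qed.

Lemma pCX k c r u m : pC k c r u -> pC k c r (fun w => u w ^+ m).
Proof.
move=> H; elim: m => [|m IH]; first by apply: pC_ext (pC_const k c r 1) => z _; rewrite expr0.
by apply: pC_ext (pCM H IH) => z _; rewrite exprS.
Qed.

Lemma pC_sum k c r (I : Type) (s : seq I) (f : I -> R[i] -> R) : (forall i, pC k c r (f i)) ->
  pC k c r (fun w => \sum_(i <- s) f i w).
Proof.
move=> H; elim: s => [|i s IH]; first by apply: pC_ext (pC_const k c r 0) => z _; rewrite big_nil.
by apply: pC_ext (pCD (H i) IH) => z _; rewrite big_cons.
Qed.

Lemma pC_inv k c r u : (forall z, normc (z - c) < r -> u z != 0) -> pC k c r u -> pC k c r (fun w => (u w)^-1).
Proof.
move=> u0; elim: k u u0 => [|k IH] u u0 Hu.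
  case: Hu => [cu _]; split=> // z zr; exact: (@cvgV R _ _ _ u _ (u0 z zr) (cu z zr)).
have Hu' := IH u u0 (pC_le Hu).
split; first by move=> z zr; exact: (@cvgV R _ _ _ u _ (u0 z zr) (pC_cont Hu zr)).
case: Hu => _ [ux [uy [du Hx Hy]]].
exists (fun w => - ((u w)^-1 * (u w)^-1) * ux w), (fun w => - ((u w)^-1 * (u w)^-1) * uy w).
split; [|by apply: pCM => //; apply: pCN; exact: pCM..].
move=> z zr; have [a b] := du z zr; rewrite -invfM.
by split; apply: (@rder_comp (fun y => y^-1)) => //; apply: is_derive_inv; exact: u0.
Qed.

Lemma pC_ln k c r u : (forall z, normc (z - c) < r -> 0 < u z) -> pC k c r u -> pC k c r (fun w => ln (u w)).
Proof.
move=> u0; have cl z : normc (z - c) < r -> {for z, continuous u} -> {for z, continuous (fun w => ln (u w))}.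
  by move=> zr cu; exact: (continuous_comp cu (continuous_ln (u0 z zr))).
case: k => [|k] Hu; first by case: Hu => [cu _]; split=> // z zr; exact: cl (cu z zr).
have Hu' := pC_inv (fun z zr => lt0r_neq0 (u0 z zr)) (pC_le Hu).
split; first by move=> z zr; exact: cl (pC_cont Hu zr).
case: Hu => _ [ux [uy [du Hx Hy]]].
exists (fun w => (u w)^-1 * ux w), (fun w => (u w)^-1 * uy w).
split; [|by apply: pCM..].
move=> z zr; have [a b] := du z zr.
by split; apply: (@rder_comp (@ln R)) => //; apply: is_derive1_ln; exact: u0.
Qed.

Lemma pder_line z v (t : R) : pder (fun s => z + s%:C * v) t v.
Proof.
by apply: pder_eq (pderD (pderC z t) (pderM (pder_real (did t)) (pderC v t))); rewrite mulr0 addr0 add0r mul1r.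
Qed.

Lemma cdiff_line F z v l : cdiff F z l -> pder (fun t => F (z + t%:C * v)) 0 (l * v).
Proof.
move=> dF; apply: (@pder_comp R F (fun s => z + s%:C * v)); last exact: pder_line.
by rewrite line0.
Qed.

(** By the Cauchy-Riemann equations the partials are, up to sign, the parts of F', which is
    holomorphic again; regularity climbs by induction. *)
Lemma pC_holo k c r F : holo F c r ->
  pC k c r (fun z => complex.Re (F z)) /\ pC k c r (fun z => complex.Im (F z)).
Proof.
elim: k F => [|k IH] F hF.
  by split; split=> // z zr; [exact: (contRe_at (holo_cont hF zr))|exact: (contIm_at (holo_cont hF zr))].
have [F1 dF hF1] := holo_regular hF; have [H1 H2] := IH F1 hF1.
split; split; [by move=> z zr; exact: (contRe_at (holo_cont hF zr))| |
  by move=> z zr; exact: (contIm_at (holo_cont hF zr))|].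
  exists (fun z => complex.Re (F1 z)), (fun z => - complex.Im (F1 z)).
  split=> //; last exact: pCN.
  move=> z /dF dz; have [a _] := cdiff_line 1 dz; have [b _] := cdiff_line 'i%C dz.
  split; first by move: a; rewrite mulr1.
  by move: b; rewrite ReM/= mulr0 mulr1 add0r.
exists (fun z => complex.Im (F1 z)), (fun z => complex.Re (F1 z)); split=> //.
move=> z /dF dz; have [_ a] := cdiff_line 1 dz; have [_ b] := cdiff_line 'i%C dz.
split; first by move: a; rewrite mulr1.
by move: b; rewrite ImM/= mulr0 mulr1 addr0.
Qed.

End smooth_plane_functions.

(** * Smooth functions along holomorphic curves in C^n *)

Section vector_composition.
Variables (R : realType) (n : nat).
Notation E := 'rV[R[i]]_n.
Implicit Types (p q v w : E).

Definition rvN (v : E) : R := \sum_(j < n) normc (v 0 j).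

Lemma rvN_ge v j : normc (v 0 j) <= rvN v.
Proof.
rewrite /rvN (bigD1 j)//= lerDl sumr_ge0// => i _; exact: normc_ge0.
Qed.

Lemma near_rV p (P : E -> Prop) : (\forall q \near p, P q) ->
  exists2 d : R, 0 < d & forall w, rvN w < d -> P (p + w).
Proof.
move=> /nbhs_ballP[e /= e0 eP].
have [ei er] : complex.Im e = 0 /\ 0 < complex.Re e.
  by move: e0; rewrite ltcE/= => /andP[/eqP -> ->].
exists (complex.Re e) => // w wd; apply: eP; rewrite -ball_normE/=.
rewrite opprD addNKr normrN.
have [w0|w0] := eqVneq `|w| 0; first by rewrite w0.
have [[i j] /= H] := @mx_norm_neq0 _ _ _ w w0.
have -> : `|w| = (normc (w 0 j))%:C by rewrite -(ord1 i); exact: H.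
rewrite ltcE/= ei eqxx/=.
exact: le_lt_trans (rvN_ge w j) wd.
Qed.

Lemma continuous_rV (T : topologicalType) (F : T -> E) z :
  (forall j, {for z, continuous (fun y => F y 0 j)}) <-> {for z, continuous F}.
Proof.
split=> [cF A /near_rV[d d0 dA]|cF j]; last first.
  exact: (continuous_comp cF (@coord_continuous R[i] 1 n 0 j (F z))).
have nd : 0 < d / n.+1%:R by rewrite divr_gt0.
have H : \forall y \near z, forall j, normc (F y 0 j - F z 0 j) < d / n.+1%:R.
  by apply: filter_forall => j; move/continuousCP: (cF j) => /(_ _ nd).
apply: filterS H => y H; have := dA (F y - F z); rewrite [F z + _]addrC subrK; apply.
apply: (@le_lt_trans _ _ (\sum_(j < n) d / n.+1%:R)).
  by apply: ler_sum => j _; rewrite !mxE; exact/ltW.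
rewrite sumr_const card_ord -mulrnAl -mulr_natr -mulrA gtr_pMr//.
by rewrite ltr_pdivrMr// mul1r ltr_nat.
Qed.

Definition rvdir (k : 'I_n * bool) : E := \row_j (if j == k.1 then dir R k.2 else 0).

Lemma rvN0 : rvN 0 = 0.
Proof. by rewrite /rvN big1// => j _; rewrite mxE normc0. Qed.
Lemma rvND v w : rvN (v + w) <= rvN v + rvN w.
Proof. by rewrite /rvN -big_split/=; apply: ler_sum => j _; rewrite mxE le_normcD. Qed.
Lemma rvN_dir k (t : R) : rvN (t%:C *: rvdir k) <= `|t|.
Proof.
rewrite /rvN (bigD1 k.1)//= big1 ?addr0 => [|j jk]; last first.
  by rewrite !mxE (negbTE jk) mulr0 normc0.
rewrite !mxE eqxx normcZr /dir; case: ifP => _; rewrite /= expr0n expr1n ?add0r ?addr0 sqrtr1 mulr1//.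
Qed.

Definition rvcoord (k : 'I_n * bool) (v : E) : R :=
  if k.2 then complex.Re (v 0 k.1) else complex.Im (v 0 k.1).

Lemma rv_decomp v : \sum_(k <- index_enum ('I_n * bool)%type) (rvcoord k v)%:C *: rvdir k = v.
Proof.
apply/rowP => j; rewrite summxE.
pose G (k : 'I_n * bool) : R[i] := ((rvcoord k v)%:C *: rvdir k) 0 j.
rewrite -/(G _); have -> : \sum_k ((rvcoord k v)%:C *: rvdir k) 0 j = \sum_(i < n) \sum_(b : bool) G (i, b).
  by rewrite pair_bigA; apply: eq_bigr => -[].
rewrite (bigD1 j)//= [X in _ + X]big1 => [|i ij]; last first.
  by rewrite big1// => b _; rewrite /G !mxE/= eq_sym (negbTE ij) mulr0.
rewrite big_bool /G addr0 !mxE/= eqxx /rvcoord/= mulr1.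
by apply: eqC; rewrite !ReImE/= !(mulr0, mul0r, mulr1, addr0, subr0, add0r).
Qed.

(** The derivative in direction v is the sum of [co i v] times the partials of h along the real
    coordinate directions. The first factor is a part of a holomorphic function, the second a
    composite of the same kind with one order less, which closes the induction. *)
Lemma pC_compose k (D : set E) (h : E -> R) c r (F : R[i] -> E) : open D -> is_Ck k D h ->
  (forall j, holo (fun z => F z 0 j) c r) -> (forall z, normc (z - c) < r -> D (F z)) ->
  pC k c r (fun z => h (F z)).
Proof.
move=> oD hk hF FD; have cF z : normc (z - c) < r -> {for z, continuous F}.
  by move=> zr; apply/continuous_rV => j; exact: holo_cont (hF j) zr.
elim: k h hk => [|k IH] h hk.
  by case: hk => ch _; split=> // z zr; exact: (continuous_comp (cF z zr) (ch _ (FD z zr))).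
case: hk => ch hd; split; first by move=> z zr; exact: (continuous_comp (cF z zr) (ch _ (FD z zr))).
have /choice[F1 F1P] : forall j, exists F1, (forall z, normc (z - c) < r -> cdiff (fun z => F z 0 j) z (F1 z)) /\ holo F1 c r.
  by move=> j; have [F1 A B] := holo_regular (hF j); exists F1.
pose co (k : 'I_n * bool) (v z : R[i]) := if k.2 then complex.Re (F1 k.1 z * v) else complex.Im (F1 k.1 z * v).
pose du (v z : R[i]) : R := \sum_(i <- index_enum ('I_n * bool)%type) co i v z * real_derive h (rvdir i) (F z).
have pco m i (v : R[i]) : pC m c r (co i v).
  have [_ hF1] := F1P i.1; have hv : holo (fun z => F1 i.1 z * v) c r.
    by move=> z /hF1[l dl]; exists (l * v + F1 i.1 z * 0); exact: (cdiffM dl (cdiffC v z)).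
  by have [A B] := pC_holo m hv; rewrite /co; case: i.2.
have pdu (v : R[i]) : pC k c r (du v).
  apply: pC_sum => i; apply: pCM; first exact: pco.
  by have [_ Hi] := hd (rvdir i); exact: IH.
have rdu (v z : R[i]) : normc (z - c) < r -> rder (fun z => h (F z)) v z (du v z).
  move=> zr; have Dp := FD z zr; have nD : \forall q \near F z, D q by exact: open_nbhs_nbhs.
  have [d d0 dD] := near_rV nD.
  have h_der : exists2 d : R, 0 < d & forall w i, rvN w < d ->
      is_derive (0 : R) 1 (fun t : R => h (F z + w + t%:C *: rvdir i)) (real_derive h (rvdir i) (F z + w)).
    exists d; first exact: d0.
    move=> w i wd; have Dw := dD w wd; have [Hd _] := hd (rvdir i).
    by apply: DeriveDef; [exact: Hd|rewrite /real_derive derive1E].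
  have h_cont i (e : R) : 0 < e -> exists2 d : R, 0 < d &
      forall w, rvN w < d -> `|real_derive h (rvdir i) (F z + w) - real_derive h (rvdir i) (F z)| <= e.
    move=> e0; have [_ Hi] := hd (rvdir i).
    have ci : {for F z, continuous (real_derive h (rvdir i))} by case: (k) Hi => [|m] [H _]; exact: H.
    move/cvgrPdist_lt : ci => /(_ e e0) /near_rV[d1 d10 H]; exists d1; first exact: d10.
    move=> w /H.
    by rewrite distrC => /ltW.
  pose x (i : 'I_n * bool) (t : R) := rvcoord i (F (z + t%:C * v) - F z).
  have x0 i : x i 0 = 0.
    by rewrite /x line0 subrr /rvcoord mxE; case: i.2.
  have dx i : is_derive (0 : R) 1 (x i) (co i v z).
    have [dF1 _] := F1P i.1; have := cdiff_line v (dF1 z zr) => -[dr di].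
    rewrite /x /rvcoord /co; case: i.2.
      have := dB dr (dC (complex.Re (F z 0 i.1)) 0); rewrite subr0; apply: is_derive_ext => t.
      by rewrite !mxE ReB.
    have := dB di (dC (complex.Im (F z 0 i.1)) 0); rewrite subr0; apply: is_derive_ext => t.
    by rewrite !mxE ImB.
  have := @chain_rule R 'rV[R[i]]_n rvN ('I_n * bool)%type rvdir rvN0 rvND rvN_dir h (F z)
    (fun i q => real_derive h (rvdir i) q) h_der h_cont (index_enum ('I_n * bool)%type) x (fun i => co i v z) x0 dx.
  by apply: is_derive_ext => t; rewrite rv_decomp addrC subrK.
exists (du 1), (du 'i%C); split=> // z zr; by split; exact: rdu.
Qed.

End vector_composition.

(** * Green's formula in polar coordinates *)

Section polar_calculus.
Variables (R : realType) (rho : R).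
Implicit Types (z c v : R[i]) (u f : R[i] -> R) (s t : R).

Lemma pCS k c r u : pC k.+1 c r u -> exists ux uy : R[i] -> R,
  [/\ forall z, normc (z - c) < r -> rder u 1 z (ux z) /\ rder u 'i%C z (uy z),
      pC k c r ux & pC k c r uy].
Proof. by case. Qed.

Lemma pC0 k c r u : pC k c r u -> pC 0 c r u.
Proof. by move=> H; split=> // z zr; exact: (pC_cont H zr). Qed.

Lemma pC_chain k c r u ux uy (g : R -> R[i]) t l :
  (forall z, normc (z - c) < r -> rder u 1 z (ux z) /\ rder u 'i%C z (uy z)) ->
  pC k c r ux -> pC k c r uy -> normc (g t - c) < r -> pder g t l ->
  is_derive t 1 (fun s => u (g s)) (complex.Re l * ux (g t) + complex.Im l * uy (g t)).
Proof.
move=> du Hx Hy gr [d1 d2]; apply: (plane_chain _ (pC_cont Hx gr) (pC_cont Hy gr) d1 d2).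
exact: (disc_near du gr).
Qed.

(** Polar coordinates with s of either sign, so that derivatives in s at 0 are two-sided. *)
Definition sp s t : R[i] := s%:C * eit t.

Lemma normc_sp s t : normc (sp s t) = `|s|.
Proof. by rewrite normcZr normc_eit mulr1. Qed.

Lemma sp_in s t : `|s| < rho -> normc (sp s t - 0) < rho.
Proof. by rewrite subr0 normc_sp. Qed.

Lemma sp_cont s : continuous (sp s).
Proof. exact: (ccontM (@ccontC R _ s%:C) (@eit_cont R)). Qed.

Lemma sp_ds s t : pder (sp^~ t) s (eit t).
Proof.
apply: pder_eq (pderM (pder_real (did s)) (pderC (eit t) s)).
by rewrite mul1r mulr0 addr0.
Qed.

Lemma sp_dt s t : pder (sp s) t (s%:C * ('i%C * eit t)).
Proof. exact: (pderZ s%:C (eit_der t)). Qed.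

Lemma pC_circ k w s : pC k 0 rho w -> `|s| < rho -> continuous (fun t => w (sp s t)).
Proof.
move=> Hw sr t; exact: (@cont_comp R _ _ w (sp s) t (pC_cont Hw (sp_in t sr)) (@sp_cont s t)).
Qed.

Lemma pC_bound k w r : 0 <= r -> r < rho -> pC k 0 rho w ->
  exists2 M, 0 <= M & forall z, normc z <= r -> `|w z| <= M.
Proof.
move=> r0 rr Hw; have [z zr|M M0 HM] := @disc_bounded R w 0 r r0.
  exact: (pC_cont Hw (le_lt_trans zr rr)).
by exists M => // z zr; apply: HM; rewrite subr0.
Qed.

Definition lbd (f : R -> R -> R) := forall r, 0 <= r -> r < rho ->
  exists2 M, 0 <= M & forall s t, `|s| <= r -> `|f s t| <= M.

Lemma lbdD (f g : R -> R -> R) : lbd f -> lbd g -> lbd (fun s t => f s t + g s t).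
Proof.
move=> Hf Hg r r0 rr; have [M M0 HM] := Hf r r0 rr; have [K K0 HK] := Hg r r0 rr.
exists (M + K) => [|s t sr]; first exact: addr_ge0.
by apply: le_trans (ler_normD _ _) (lerD (HM _ _ sr) (HK _ _ sr)).
Qed.
Lemma lbdM (f g : R -> R -> R) : lbd f -> lbd g -> lbd (fun s t => f s t * g s t).
Proof.
move=> Hf Hg r r0 rr; have [M M0 HM] := Hf r r0 rr; have [K K0 HK] := Hg r r0 rr.
exists (M * K) => [|s t sr]; first exact: mulr_ge0.
by rewrite normrM; apply: ler_pM; [exact: normr_ge0|exact: normr_ge0|exact: HM|exact: HK].
Qed.
Lemma lbd_s : lbd (fun s _ => s).
Proof. by move=> r r0 rr; exists r. Qed.
Lemma lbd_cos : lbd (fun _ t => cos t).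
Proof. by move=> r r0 rr; exists 1 => // s t _; rewrite ler_norml cos_geN1 cos_le1. Qed.
Lemma lbd_sin : lbd (fun _ t => sin t).
Proof. by move=> r r0 rr; exists 1 => // s t _; rewrite ler_norml sin_geN1 sin_le1. Qed.
Lemma lbd_pC k w : pC k 0 rho w -> lbd (fun s t => w (sp s t)).
Proof.
move=> Hw r r0 rr; have [M M0 HM] := pC_bound r0 rr Hw.
by exists M => // s t sr; apply: HM; rewrite normc_sp.
Qed.

Lemma circ_DUI (k k1 : R -> R -> R) s0 : `|s0| < rho ->
  (forall s, `|s| < rho -> continuous (k s)) ->
  (forall s t, `|s| < rho -> is_derive s 1 (k^~ t) (k1 s t)) -> lbd k1 ->
  is_derive s0 1 (fun s => Int th0 th1 (k s)) (Int th0 th1 (k1 s0)).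
Proof.
move=> sr ck dk bk; pose d := (rho - `|s0|) / 2.
have d0 : 0 < d by rewrite divr_gt0// subr_gt0.
have [|M M0 HM] := bk (`|s0| + d) ltac:(by rewrite addr_ge0 ?(ltW d0)); first by rewrite /d; lra.
have near s : `|s - s0| < d -> `|s| <= `|s0| + d.
  by move=> h; have := ler_normD (s - s0) s0; rewrite subrK; lra.
have lt s : `|s - s0| < d -> `|s| < rho by move=> /near; rewrite /d; lra.
apply: (@Int_DUI R k k1 s0 th0 th1 d M) => //.
- by move=> s /lt; exact: ck.
- by move=> s t /lt h _; exact: dk.
- by move=> s t /near h _; exact: HM.
Qed.

Section first_order.
Variables (k : nat) (u ux uy : R[i] -> R).
Hypothesis du : forall z, normc (z - 0) < rho -> rder u 1 z (ux z) /\ rder u 'i%C z (uy z).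
Hypothesis Hx : pC k 0 rho ux.
Hypothesis Hy : pC k 0 rho uy.

Lemma polar_ds s t : `|s| < rho ->
  is_derive s 1 (fun s => u (sp s t)) (cos t * ux (sp s t) + sin t * uy (sp s t)).
Proof. by move=> sr; exact: (@pC_chain k 0 rho u ux uy (sp^~ t) s _ du Hx Hy (sp_in t sr) (sp_ds s t)). Qed.

Lemma polar_dt s t : `|s| < rho ->
  is_derive t 1 (fun t => u (sp s t)) (s * (cos t * uy (sp s t) - sin t * ux (sp s t))).
Proof.
move=> sr; have := @pC_chain k 0 rho u ux uy (sp s) t _ du Hx Hy (sp_in t sr) (sp_dt s t).
rewrite !ReImE/=.
by rewrite (_ : _ + _ = s * (cos t * uy (sp s t) - sin t * ux (sp s t)))//; ring.
Qed.

End first_order.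

Section green.
Variables u ux uy uxx uxy uyx uyy : R[i] -> R.
Hypothesis Hu : pC 0 0 rho u.
Hypothesis Hux : pC 0 0 rho ux.
Hypothesis Huy : pC 0 0 rho uy.
Hypothesis Huxx : pC 0 0 rho uxx.
Hypothesis Huxy : pC 0 0 rho uxy.
Hypothesis Huyx : pC 0 0 rho uyx.
Hypothesis Huyy : pC 0 0 rho uyy.
Hypothesis du : forall z, normc (z - 0) < rho -> rder u 1 z (ux z) /\ rder u 'i%C z (uy z).
Hypothesis dux : forall z, normc (z - 0) < rho -> rder ux 1 z (uxx z) /\ rder ux 'i%C z (uxy z).
Hypothesis duy : forall z, normc (z - 0) < rho -> rder uy 1 z (uyx z) /\ rder uy 'i%C z (uyy z).

Let cc : continuous (@cos R). Proof. exact: continuous_cos. Qed.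
Let cs : continuous (@sin R). Proof. exact: continuous_sin. Qed.

Lemma green_mean s : `|s| < rho ->
  is_derive s 1 (fun s => Int th0 th1 (fun t => u (sp s t)))
    (Int th0 th1 (fun t => cos t * ux (sp s t) + sin t * uy (sp s t))).
Proof.
move=> sr; apply: (@circ_DUI (fun s t => u (sp s t)) (fun s t => cos t * ux (sp s t) + sin t * uy (sp s t))) => //.
- by move=> x xr; exact: (pC_circ Hu xr).
- by move=> x t xr; exact: (polar_ds du Hux Huy t xr).
- exact: (lbdD (lbdM lbd_cos (lbd_pC Hux)) (lbdM lbd_sin (lbd_pC Huy))).
Qed.

(** With V the radial and W the angular component of the gradient, d/ds (s V) + dW/dt = s (uxx +
    uyy), and the integral of dW over a full turn is 0. The terms in uxy cancel among themselves,
    and so do those in uyx. *)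
Lemma green_flux s : `|s| < rho ->
  is_derive s 1 (fun s => s * Int th0 th1 (fun t => cos t * ux (sp s t) + sin t * uy (sp s t)))
    (s * Int th0 th1 (fun t => uxx (sp s t) + uyy (sp s t))).
Proof.
move=> sr.
pose V s t := cos t * ux (sp s t) + sin t * uy (sp s t).
pose dV s t := cos t * (cos t * uxx (sp s t) + sin t * uxy (sp s t))
  + sin t * (cos t * uyx (sp s t) + sin t * uyy (sp s t)).
pose W t := cos t * uy (sp s t) - sin t * ux (sp s t).
pose dW t := (- sin t * uy (sp s t) + cos t * (s * (cos t * uyy (sp s t) - sin t * uyx (sp s t))))
  - (cos t * ux (sp s t) + sin t * (s * (cos t * uxy (sp s t) - sin t * uxx (sp s t)))).
have cw w x : pC 0 0 rho w -> `|x| < rho -> continuous (fun t => w (sp x t)) by exact: pC_circ.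
have ccw w x (Hw : pC 0 0 rho w) (xr : `|x| < rho) := contM cc (cw w x Hw xr).
have csw w x (Hw : pC 0 0 rho w) (xr : `|x| < rho) := contM cs (cw w x Hw xr).
have cV x (xr : `|x| < rho) : continuous (V x) := contD (@ccw _ _ Hux xr) (@csw _ _ Huy xr).
have cdV x (xr : `|x| < rho) : continuous (dV x) :=
  contD (contM cc (contD (@ccw _ _ Huxx xr) (@csw _ _ Huxy xr)))
        (contM cs (contD (@ccw _ _ Huyx xr) (@csw _ _ Huyy xr))).
have cks : continuous (fun _ : R => s) by exact: contC.
have cns : continuous (fun t : R => - sin t) by move=> t; exact: (is_derive_cont (dN (is_derive_sin t))).
have cdW : continuous dW :=
  contB (contD (contM cns (cw _ _ Huy sr)) (contM cc (contM cks (contB (@ccw _ _ Huyy sr) (@csw _ _ Huyx sr)))))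
    (contD (@ccw _ _ Hux sr) (contM cs (contM cks (contB (@ccw _ _ Huxy sr) (@csw _ _ Huxx sr))))).
have dVs : is_derive s 1 (fun s => Int th0 th1 (V s)) (Int th0 th1 (dV s)).
  apply: (@circ_DUI V dV) => //.
    move=> x t xr; have d1 := dM (dC (cos t) x) (polar_ds dux Huxx Huxy t xr).
    have d2 := dM (dC (sin t) x) (polar_ds duy Huyx Huyy t xr).
    by have := dD d1 d2; rewrite !mul0r !add0r.
  exact: (lbdD (lbdM lbd_cos (lbdD (lbdM lbd_cos (lbd_pC Huxx)) (lbdM lbd_sin (lbd_pC Huxy))))
    (lbdM lbd_sin (lbdD (lbdM lbd_cos (lbd_pC Huyx)) (lbdM lbd_sin (lbd_pC Huyy))))).
have W0 : Int th0 th1 dW = 0.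
  have dWd t : is_derive t 1 W (dW t).
    have d1 := dM (is_derive_cos t) (polar_dt duy Huyx Huyy t sr).
    have d2 := dM (is_derive_sin t) (polar_dt dux Huxx Huxy t sr).
    exact: (dB d1 d2).
  by rewrite (Int_FTC2 (th01 R) cdW dWd) /W /sp eit_period cos_th0 cos_th1 sin_th0 sin_th1 subrr.
have := dM (did s) dVs; rewrite mul1r.
rewrite (_ : _ + _ = s * Int th0 th1 (fun t => uxx (sp s t) + uyy (sp s t)))//.
have cl := contD (cw _ _ Huxx sr) (cw _ _ Huyy sr).
rewrite -[LHS]addr0 -W0 -(IntZ _ _ _ (cdV s sr)) -(IntZ _ _ _ cl).
rewrite -(IntD _ _ (cV s sr) (contM cks (cdV s sr))).
rewrite -(IntD _ _ (contD (cV s sr) (contM cks (cdV s sr))) cdW).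
apply: eq_Int => t _; rewrite /V /dV /dW.
have C : cos t * cos t = 1 - sin t * sin t by rewrite -!expr2 -(cos2Dsin2 t) addrK.
transitivity (s * ((cos t * cos t + sin t * sin t) * (uxx (sp s t) + uyy (sp s t)))); first by ring.
by rewrite C subrK mul1r.
Qed.

End green.

(* [xprim a] is the primitive of [a] in the x-direction vanishing on the imaginary axis, written as an
   integral over a fixed interval; the substitution x sin tau (rather than x tau) keeps the integrand
   defined for all real tau. *)
Definition xprim (a : R[i] -> R) z : R :=
  Int 0 (pi / 2) (fun t => a (complex.Re z * sin t +i* complex.Im z) * (complex.Re z * cos t)).

Definition xsh z t : R[i] := complex.Re z * sin t +i* complex.Im z.

Lemma normc_le_sqr z w : normc z ^+ 2 <= normc w ^+ 2 -> normc z <= normc w.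
Proof. by rewrite ler_pXn2r ?nnegrE ?normc_ge0. Qed.

Lemma xsh_le z t : normc (xsh z t) <= normc z.
Proof.
apply: normc_le_sqr; rewrite !sqr_normc/= lerD2r exprMn.
by rewrite ler_piMr ?sqr_ge0// sin2cos2 gerBl sqr_ge0.
Qed.

Lemma xsh_in z t : normc (z - 0) < rho -> normc (xsh z t - 0) < rho.
Proof. by rewrite !subr0; apply: le_lt_trans; exact: xsh_le. Qed.

Lemma xsh_cont z : continuous (xsh z).
Proof.
move=> t; have c1 := contM (@contC R _ (complex.Re z)) (@continuous_sin R).
exact: (cont_pair (c1 t) (@contC R _ (complex.Im z) t)).
Qed.

(** The mean value theorem along the segment from w to z. In [xprim_cont] it makes the continuity of
    the integrand uniform in t. *)
Lemma pC_lip k a r : 0 <= r -> r < rho -> pC k.+1 0 rho a ->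
  exists2 M, 0 <= M & forall z w, normc z <= r -> normc w <= r -> `|a z - a w| <= M * normc (z - w).
Proof.
move=> r0 rr /pCS[ax [ay [da Hx Hy]]].
have [M M0 HM] := pC_bound r0 rr Hx; have [K K0 HK] := pC_bound r0 rr Hy.
exists (M + K) => [|z w zr wr]; first exact: addr_ge0.
pose g t : R[i] := w + t%:C * (z - w).
have gr t : 0 <= t <= 1 -> normc (g t) <= r.
  move=> /andP[t0 t1]; rewrite /g (_ : _ + _ = (1 - t)%:C * w + t%:C * z); last by rewrite rmorphB/=; ring.
  apply: le_trans (le_normcD _ _) _; rewrite !normcZr !ger0_norm ?subr_ge0//.
  have := ler_wpM2l t0 zr; have : 0 <= 1 - t by rewrite subr_ge0.
  by move=> /ler_wpM2l/(_ _ _ wr); lra.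
have dg t : 0 <= t <= 1 -> is_derive t 1 (fun t => a (g t))
    (complex.Re (z - w) * ax (g t) + complex.Im (z - w) * ay (g t)).
  move=> /gr tr; apply: (pC_chain da Hx Hy); last exact: pder_line.
  by rewrite subr0; exact: le_lt_trans rr.
have [||c] := @MVT R (fun t => a (g t)) (fun t => complex.Re (z - w) * ax (g t) + complex.Im (z - w) * ay (g t)) 0 1 ltr01.
- by move=> t; rewrite in_itv/= => /andP[t0 t1]; apply: dg; rewrite !ltW.
- apply: continuous_in_subspaceT => t; rewrite inE/= in_itv/= => /dg; exact: is_derive_cont.
rewrite in_itv/= => /andP[c0 c1]; rewrite subr0 mulr1.
have -> : g 1 = z by rewrite /g mul1r addrC subrK.
have -> : g 0 = w by rewrite /g mul0r addr0.
move=> ->; apply: le_trans (ler_normD _ _) _; rewrite !normrM mulrDl [M * _]mulrC [K * _]mulrC.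
have cr := gr c ltac:(by rewrite !ltW).
by apply: lerD; apply: ler_pM; rewrite ?normr_ge0 ?Re_le_normc ?Im_le_normc ?HM ?HK.
Qed.

Lemma xprim_integrand_cont k a z : pC k 0 rho a -> normc (z - 0) < rho ->
  continuous (fun t => a (xsh z t) * (complex.Re z * cos t)).
Proof.
move=> Ha zr; have c1 : continuous (fun t => a (xsh z t)).
  by move=> t; exact: (@cont_comp R _ _ a (xsh z) t (pC_cont Ha (xsh_in t zr)) (@xsh_cont z t)).
exact: (contM c1 (contM (@contC R _ (complex.Re z)) (@continuous_cos R))).
Qed.

Lemma xprim_cont k a : pC k.+1 0 rho a -> pC 0 0 rho (xprim a).
Proof.
move=> Ha; split=> // z; rewrite subr0 => zr.
pose r := (normc z + rho) / 2.
have zr1 : normc z < r by rewrite /r; lra.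
have rr : r < rho by rewrite /r; lra.
have r0 : 0 <= r by rewrite /r; have := normc_ge0 z; lra.
have [M M0 HM] := pC_lip r0 rr Ha; have [K K0 HK] := pC_bound r0 rr Ha.
apply/continuous_fromC => e e0.
pose L := (M * r + K) * (pi / 2) + 1.
have L0 : 0 < L by rewrite ltr_wpDl// mulr_ge0 ?divr_ge0 ?pi_ge0// addr_ge0// mulr_ge0.
exists (Num.min (r - normc z) (e / L)); first by rewrite lt_min subr_gt0 zr1 divr_gt0.
move=> w; rewrite lt_min => /andP[wz]; rewrite ltr_pdivlMr// => we.
have wr : normc w <= r by have := normc_ge_sub w z; lra.
have c1 := xprim_integrand_cont Ha (_ : normc (w - 0) < rho).
have c2 := xprim_integrand_cont Ha (_ : normc (z - 0) < rho).
rewrite !subr0 in c1 c2; have {}c1 := c1 ltac:(lra); have {}c2 := c2 ltac:(lra).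
rewrite /xprim -(IntB _ _ c1 c2).
apply: le_lt_trans (_ : (M * r + K) * normc (w - z) * (pi / 2 - 0) < e); last first.
  by apply: le_lt_trans we; rewrite /L subr0; have := normc_ge0 (w - z); lra.
apply: Int_abs_le; [by rewrite divr_ge0 ?pi_ge0|exact: contB|].
move=> t _; rewrite -/(xsh w t) -/(xsh z t).
rewrite (_ : _ - _ = ((a (xsh w t) - a (xsh z t)) * complex.Re w + a (xsh z t) * (complex.Re w - complex.Re z)) * cos t); last by ring.
have bc : `|cos t| <= 1 by rewrite ler_norml cos_geN1 cos_le1.
rewrite normrM; apply: le_trans (ler_piMr (normr_ge0 _) bc) _.
apply: le_trans (ler_normD _ _) _; rewrite [leRHS]mulrDl; apply: lerD; rewrite normrM.
- rewrite mulrAC; apply: ler_pM; rewrite ?normr_ge0//; last by apply: le_trans (Re_le_normc _) wr.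
  apply: le_trans (HM _ _ _ _) _.
  + exact: le_trans (xsh_le _ _) wr.
  + by apply: le_trans (xsh_le _ _) _; lra.
  rewrite ler_wpM2l//; apply: normc_le_sqr; rewrite !sqr_normc/= !ReImE lerD2r -mulrBl exprMn.
  by rewrite ler_piMr ?sqr_ge0// sin2cos2 gerBl sqr_ge0.
- apply: ler_pM; rewrite ?normr_ge0//.
    by apply: HK; apply: le_trans (xsh_le _ _) _; lra.
  by rewrite -ReB Re_le_normc.
Qed.

Lemma xprim_partials k a ax ay :
  (forall z, normc (z - 0) < rho -> rder a 1 z (ax z) /\ rder a 'i%C z (ay z)) ->
  pC 0 0 rho a -> pC k 0 rho ax -> pC k 0 rho ay ->
  forall z, normc (z - 0) < rho -> rder (xprim a) 1 z (a z) /\ rder (xprim a) 'i%C z (xprim ay z).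
Proof.
move=> da Ha Hx Hy z; rewrite subr0 => zr.
pose r := (normc z + rho) / 2.
have zr1 : normc z < r by rewrite /r; lra.
have rr : r < rho by rewrite /r; lra.
have r0 : 0 <= r by rewrite /r; have := normc_ge0 z; lra.
have [K K0 HK] := pC_bound r0 rr Ha; have [Mx Mx0 HMx] := pC_bound r0 rr Hx.
have [My My0 HMy] := pC_bound r0 rr Hy.
have d0 : 0 < r - normc z by rewrite subr_gt0.
have near (s : R) v : normc v = 1 -> `|s - 0| < r - normc z -> normc (z + s%:C * v) <= r.
  move=> v1; rewrite subr0 => sd; apply: le_trans (le_normcD _ _) _; rewrite normcZr v1 mulr1; lra.
have n1 : normc (1 : R[i]) = 1 by exact: normc1.
have ni : normc ('i%C : R[i]) = 1 by rewrite /= expr0n expr1n add0r sqrtr1.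
have near0 (s : R) v : normc v = 1 -> `|s - 0| < r - normc z -> normc (z + s%:C * v - 0) < rho.
  by move=> v1 sd; rewrite subr0; apply: le_lt_trans rr; exact: near.
have ReL (s : R) : complex.Re (z + s%:C * 1) = complex.Re z + s by rewrite ReD ReZ mulr1.
have ImL (s : R) : complex.Im (z + s%:C * 1) = complex.Im z by rewrite ImD ImZ mulr0 addr0.
have ReLi (s : R) : complex.Re (z + s%:C * 'i%C) = complex.Re z by rewrite ReD ReZ mulr0 addr0.
have ImLi (s : R) : complex.Im (z + s%:C * 'i%C) = complex.Im z + s by rewrite ImD ImZ mulr1.
have bc t : `|cos t| <= 1 :> R by rewrite ler_norml cos_geN1 cos_le1.
have bs t : `|sin t| <= 1 :> R by rewrite ler_norml sin_geN1 sin_le1.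
have c1 := xprim_integrand_cont Ha; split.
  pose k1 s t := sin t * ax (xsh (z + s%:C * 1) t) * (complex.Re (z + s%:C * 1) * cos t) + a (xsh (z + s%:C * 1) t) * cos t.
  have : is_derive (0 : R) 1 (fun s => Int 0 (pi / 2) (fun t => a (xsh (z + s%:C * 1) t) * (complex.Re (z + s%:C * 1) * cos t)))
      (Int 0 (pi / 2) (k1 0)).
    apply: (@Int_DUI R _ k1 0 0 (pi / 2) (r - normc z) (1 * Mx * (r * 1) + K * 1) d0).
    - by move=> s sd; exact: (c1 _ (near0 s 1 n1 sd)).
    - move=> s t sd _; rewrite /k1.
      have dp : pder (fun s => xsh (z + s%:C * 1) t) s (sin t)%:C.
        have D : is_derive s 1 (fun s => complex.Re (z + s%:C * 1) * sin t) (sin t).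
          have := dM (dD (dC (complex.Re z) s) (did s)) (dC (sin t) s).
          by rewrite add0r mul1r mulr0 addr0; apply: is_derive_ext => x; rewrite ReL.
        split; first exact: D.
        by apply: is_derive_ext (dC (complex.Im z) s) => x; rewrite /= ImL.
      have := @pC_chain k 0 rho a ax ay (fun s => xsh (z + s%:C * 1) t) s _ da Hx Hy (xsh_in t (near0 s 1 n1 sd)) dp; rewrite /= mul0r addr0 => D1.
      have D2 : is_derive s 1 (fun s => complex.Re (z + s%:C * 1) * cos t) (cos t).
        have := dM (dD (dC (complex.Re z) s) (did s)) (dC (cos t) s).
        by rewrite add0r mul1r mulr0 addr0; apply: is_derive_ext => x; rewrite ReL.
      exact: (dM D1 D2).
    - move=> s t sd _; have nr := near s 1 n1 sd; have xr := le_trans (xsh_le _ t) nr.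
      apply: le_trans (ler_normD _ _) (lerD _ _); rewrite !normrM.
        apply: ler_pM; [by rewrite mulr_ge0|by rewrite mulr_ge0| |].
          by apply: ler_pM => //; exact: HMx.
        by apply: ler_pM => //; apply: le_trans (Re_le_normc _) nr.
      by apply: ler_pM => //; exact: HK.
  rewrite (_ : Int 0 (pi / 2) (k1 0) = a z); first by [].
  have zr' : normc (z - 0) < rho by rewrite subr0.
  have ck1 : continuous (k1 0).
    have cx := @xprim_integrand_cont k ax z Hx zr'.
    have ca : continuous (fun t => a (xsh z t)).
      by move=> t; exact: (@cont_comp R _ _ a (xsh z) t (pC_cont Ha (xsh_in t zr')) (@xsh_cont z t)).
    have := contD (contM (@continuous_sin R) cx) (contM ca (@continuous_cos R)).
    rewrite (_ : (fun y => _) = k1 0)//; apply/funext => t; rewrite /k1 line0; ring.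
  (* At s = 0 the differentiated integrand is an exact t-derivative, of a(xsh z t) sin t, whose
     values are a z at pi / 2 and 0 at 0. *)
  have dk1 t : is_derive t 1 (fun t => a (xsh z t) * sin t) (k1 0 t).
    rewrite /k1 line0.
    have dp : pder (xsh z) t (complex.Re z * cos t)%:C.
      split; last exact: dC.
      by have := dM (dC (complex.Re z) t) (is_derive_sin t); rewrite mul0r add0r.
    have := @pC_chain k 0 rho a ax ay (xsh z) t _ da Hx Hy (xsh_in t zr') dp; rewrite /= mul0r addr0 => D1.
    have := dM D1 (is_derive_sin t).
    by rewrite (_ : complex.Re z * cos t * ax (xsh z t) * sin t = sin t * ax (xsh z t) * (complex.Re z * cos t)); last by ring.
  have p2 : (0 : R) <= pi / 2 by rewrite divr_ge0 ?pi_ge0.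
  rewrite (Int_FTC2 p2 ck1 dk1) sin_pihalf sin0 mulr0 subr0 mulr1 /xsh sin_pihalf mulr1.
  by congr a; case: (z).
pose k1 s t := ay (xsh (z + s%:C * 'i%C) t) * (complex.Re z * cos t).
have : is_derive (0 : R) 1 (fun s => Int 0 (pi / 2) (fun t => a (xsh (z + s%:C * 'i%C) t) * (complex.Re (z + s%:C * 'i%C) * cos t)))
    (Int 0 (pi / 2) (k1 0)).
  apply: (@Int_DUI R _ k1 0 0 (pi / 2) (r - normc z) (My * (r * 1)) d0).
  - by move=> s sd; exact: (c1 _ (near0 s 'i%C ni sd)).
  - move=> s t sd _; rewrite /k1.
    have dp : pder (fun s => xsh (z + s%:C * 'i%C) t) s 'i%C.
      split.
        by apply: is_derive_ext (dC (complex.Re z * sin t) s) => x; rewrite /= ReLi.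
      have := dD (dC (complex.Im z) s) (did s); rewrite add0r.
      by apply: is_derive_ext => x; rewrite /= ImLi.
    have := @pC_chain k 0 rho a ax ay (fun s => xsh (z + s%:C * 'i%C) t) s _ da Hx Hy (xsh_in t (near0 s 'i%C ni sd)) dp; rewrite /= mul0r add0r mul1r => D1.
    have := dM D1 (dC (complex.Re z * cos t) s); rewrite mulr0 addr0.
    by apply: is_derive_ext => x; rewrite ReLi.
  - move=> s t sd _; have nr := near s 'i%C ni sd; have xr := le_trans (xsh_le _ t) nr.
    rewrite !normrM; apply: ler_pM; [by []|by rewrite mulr_ge0|exact: HMy|].
    apply: ler_pM => //; apply: le_trans (Re_le_normc _) _; lra.
by rewrite /k1 line0.
Qed.

(* d/ds (P s cos) - d/dt (P sin) = s a, where P is the x-primitive of a. *)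
Lemma polar_area k a s : pC k.+2 0 rho a -> `|s| < rho ->
  is_derive s 1 (fun s => Int th0 th1 (fun t => xprim a (sp s t) * (s * cos t)))
    (s * Int th0 th1 (fun t => a (sp s t))).
Proof.
move=> Ha sr; have Ha1 := pC_le Ha.
have [ax [ay [da Hx Hy]]] := pCS Ha.
have Ha0 : pC 0 0 rho a := pC0 Ha.
have HP := xprim_cont Ha1; have HY : pC 0 0 rho (xprim ay) by exact: xprim_cont Hy.
have dP := xprim_partials da Ha0 Hx Hy.
pose P := xprim a; pose Y := xprim ay.
pose k1 s t := (cos t * a (sp s t) + sin t * Y (sp s t)) * (s * cos t) + P (sp s t) * cos t.
pose W t := P (sp s t) * sin t.
pose dW t := s * (cos t * Y (sp s t) - sin t * a (sp s t)) * sin t + P (sp s t) * cos t.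
have cc : continuous (@cos R) by exact: continuous_cos.
have cs : continuous (@sin R) by exact: continuous_sin.
have ck (x : R) : continuous (fun _ : R => x) by exact: contC.
have cw w x : pC 0 0 rho w -> `|x| < rho -> continuous (fun t => w (sp x t)) by exact: pC_circ.
have dk : is_derive s 1 (fun s => Int th0 th1 (fun t => P (sp s t) * (s * cos t))) (Int th0 th1 (k1 s)).
  apply: (@circ_DUI (fun s t => P (sp s t) * (s * cos t)) k1) => //.
  - by move=> x xr; exact: (contM (cw _ _ HP xr) (contM (@ck x) cc)).
  - move=> x t xr; have D1 := polar_ds dP Ha0 HY t xr.
    have D2 := dM (did x) (dC (cos t) x); rewrite mul1r mulr0 addr0 in D2.
    exact: (dM D1 D2).
  - exact: (lbdD (lbdM (lbdD (lbdM lbd_cos (lbd_pC Ha0)) (lbdM lbd_sin (lbd_pC HY))) (lbdM lbd_s lbd_cos)) (lbdM (lbd_pC HP) lbd_cos)).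
have cdW : continuous dW :=
  contD (contM (contM (@ck s) (contB (contM cc (cw _ _ HY sr)) (contM cs (cw _ _ Ha0 sr)))) cs) (contM (cw _ _ HP sr) cc).
have W0 : Int th0 th1 dW = 0.
  have dWd t : is_derive t 1 W (dW t).
    exact: (dM (polar_dt dP Ha0 HY t sr) (is_derive_sin t)).
  by rewrite (Int_FTC2 (th01 R) cdW dWd) /W /sp eit_period sin_th0 sin_th1 subrr.
rewrite (_ : s * _ = Int th0 th1 (k1 s))//.
have ck1 : continuous (k1 s) :=
  contD (contM (contD (contM cc (cw _ _ Ha0 sr)) (contM cs (cw _ _ HY sr))) (contM (@ck s) cc)) (contM (cw _ _ HP sr) cc).
rewrite -[RHS]subr0 -W0 -(IntB _ _ ck1 cdW) -(IntZ _ _ _ (cw _ _ Ha0 sr)).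
apply: eq_Int => t _; rewrite /k1 /dW.
have C : cos t * cos t = 1 - sin t * sin t by rewrite -!expr2 -(cos2Dsin2 t) addrK.
transitivity (s * ((cos t * cos t + sin t * sin t) * a (sp s t))); last by ring.
by rewrite C subrK mul1r.
Qed.

End polar_calculus.

(** * The area integral *)

Section plane_measurability.
Variable R : realType.
Implicit Types (A : set (R * R)).

(** An open set is the countable union of the rational boxes it contains; boxes not contained in A
    are replaced by the empty set. *)
Lemma open_measurable_prod A : open A -> measurable A.
Proof.
move=> oA.
pose S (a b c d : rat) : set (R * R) := [set p | [/\ ratr a < p.1 < ratr b & ratr c < p.2 < ratr d]].
have mS a b c d : measurable (S a b c d).
  rewrite (_ : S a b c d = `]ratr a, ratr b[%classic `*` `]ratr c, ratr d[%classic).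
    by apply: measurableX; exact: measurable_itv.
  by apply/seteqP; split=> -[x y] /=; rewrite !in_itv/= => -[].
have -> : A = \bigcup_a \bigcup_b \bigcup_c \bigcup_d
    (if `[< S a b c d `<=` A >] then S a b c d else set0).
  apply/seteqP; split=> [[x y] Axy|p [a _ [b _ [c _ [d _]]]]]; last first.
    by case: ifPn => // /asboolP; exact.
  have : nbhs (x, y) A by exact: open_nbhs_nbhs.
  move=> /nbhs_ballP[e /= e0 eA].
  have [a] := @rat_in_itvoo R (x - e) x ltac:(by rewrite ltrBlDr ltrDl).
  have [b] := @rat_in_itvoo R x (x + e) ltac:(by rewrite ltrDl).
  have [c] := @rat_in_itvoo R (y - e) y ltac:(by rewrite ltrBlDr ltrDl).
  have [d] := @rat_in_itvoo R y (y + e) ltac:(by rewrite ltrDl).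
  rewrite !in_itv/= => /andP[d1 d2] /andP[c1 c2] /andP[b1 b2] /andP[a1 a2].
  exists a => //; exists b => //; exists c => //; exists d => //.
  case: ifPn => [_|/asboolP[]]; first by rewrite /S /= a2 b1 c2 d1.
  move=> -[u v] [/= /andP[/= u1 u2] /andP[/= v1 v2]]; apply: eA.
  by split; rewrite /= -ball_normE/= ltr_norml; apply/andP; split; lra.
by do 4 (apply: bigcupT_measurable_rat => ?); case: ifP.
Qed.

Definition toC (p : R * R) : R[i] := p.1 +i* p.2.

Lemma toC_cont : continuous toC.
Proof. by move=> p; apply: cont_pair; [exact: cvg_fst|exact: cvg_snd]. Qed.

Definition discRR (t : R) : set (R * R) := [set p | normc (toC p) < t].

Lemma open_preim (U : R[i] -> R) rho t : (forall z, normc z < rho -> {for z, continuous U}) -> t <= rho ->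
  forall x, open (discRR t `&` [set p | x < U (toC p)]).
Proof.
move=> cU tr x; rewrite openE => p [/= pt px].
have c1 : {for p, continuous (fun q => normc (toC q))} by exact: (contnormc_at (@toC_cont p)).
have c2 : {for p, continuous (fun q => U (toC q))}.
  exact: (@cont_comp R _ _ U toC p (cU _ (lt_le_trans pt tr)) (@toC_cont p)).
have n1 : \forall q \near p, normc (toC q) < t.
  have e0 : 0 < t - normc (toC p) by rewrite subr_gt0.
  move/cvgrPdist_lt : c1 => /(_ _ e0); apply: filterS => q.
  by have := ler_norm (normc (toC q) - normc (toC p)); rewrite distrC; lra.
have n2 : \forall q \near p, x < U (toC q).
  have e0 : 0 < U (toC p) - x by rewrite subr_gt0.
  move/cvgrPdist_lt : c2 => /(_ _ e0); apply: filterS => q.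
  by have := ler_norm (U (toC p) - U (toC q)); lra.
by apply: filterS2 n1 n2 => q q1 q2; split.
Qed.

Lemma measurable_discRR t : measurable (discRR t).
Proof.
apply: open_measurable_prod.
have := @open_preim (fun=> 0) t t (fun z _ => @contC R _ 0 z) (lexx t) (-1).
rewrite (_ : [set p | _] = setT) ?setIT//.
by apply/seteqP; split=> // p _ /=; rewrite ltrN10.
Qed.

Lemma measurable_disc_fun (U : R[i] -> R) rho t : (forall z, normc z < rho -> {for z, continuous U}) ->
  t <= rho -> measurable_fun (discRR t) (fun p => U (toC p)).
Proof.
move=> cU tr mD; apply: (measurability _ (RGenOInfty.measurableE R)) => //.
move=> /= _ [_ [x ->] <-].
rewrite (_ : _ `&` _ = discRR t `&` [set p | x < U (toC p)]); last first.
  by apply/seteqP; split=> p /= [A]; rewrite in_itv/= andbT.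
by apply: open_measurable_prod; exact: open_preim cU tr x.
Qed.

End plane_measurability.

Section substitution.
Variable R : realType.
Notation mu := (@lebesgue_measure R).

Lemma subst_increasing (F f G : R -> R) (a b : R) : a <= b ->
  {in `[a, b] &, {homo F : x y / x < y}} -> (forall x : R, is_derive x 1 F (f x)) -> continuous f ->
  (forall y, F a <= y <= F b -> {for y, continuous G}) ->
  Int (F a) (F b) G = Int a b (fun x => G (F x) * f x).
Proof.
move=> ab hF dF cf cG.
have F'E : F^`()%classic = f by apply/funext => x; rewrite derive1E; have [_ ->] := dF x.
have cF : continuous F by move=> x; exact: is_derive_cont (dF x).
rewrite /Int /Rintegral (@integration_by_substitution_increasing R F G a b ab hF).
- by rewrite F'E.
- by rewrite F'E => x _; exact: cf.
- by rewrite F'E; apply/cvg_ex; exists (f a); exact: (cvg_at_right_filter (@cf a)).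
- by rewrite F'E; apply/cvg_ex; exists (f b); exact: (cvg_at_left_filter (@cf b)).
- split.
  + by move=> x _; have [] := dF x.
  + exact: (cvg_at_right_filter (@cF a)).
  + exact: (cvg_at_left_filter (@cF b)).
- by apply: continuous_in_subspaceT => y; rewrite inE/= in_itv/=; exact: cG.
Qed.

Lemma subst_reflect (G : R -> R) (c a b : R) : a <= b -> continuous G ->
  Int (c - b) (c - a) G = Int a b (fun x => G (c - x)).
Proof.
move=> ab cG; pose F x : R := c - x.
have dF (x : R) : is_derive x 1 F (- 1) by have := dB (dC c x) (did x); rewrite sub0r.
have F'E : F^`()%classic = (fun=> -1) by apply/funext => x; rewrite derive1E; have [_ ->] := dF x.
have cF : continuous F by move=> x; exact: is_derive_cont (dF x).
rewrite /Int /Rintegral (@integration_by_substitution_decreasing R F G a b ab).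
- congr fine; apply: eq_integral => x _; rewrite F'E.
  by rewrite /GRing.mul/= /GRing.opp/= /F; congr EFin; rewrite opprK mulr1.
- by move=> x y _ _ xy; rewrite /F ltrD2l ltrN2.
- by rewrite F'E => x _; exact: contC.
- by rewrite F'E; apply/cvg_ex; exists (-1); exact: cvg_cst.
- by rewrite F'E; apply/cvg_ex; exists (-1); exact: cvg_cst.
- split.
  + by move=> x _; have [] := dF x.
  + exact: (cvg_at_right_filter (@cF a)).
  + exact: (cvg_at_left_filter (@cF b)).
- exact: continuous_subspaceT.
Qed.

End substitution.

(** * The area integral as a circle integral *)

Section disc_integral_polar.
Variables (R : realType) (rho : R) (k : nat) (a : R[i] -> R).
Hypothesis Ha : pC k.+2 0 rho a.
Hypothesis a0 : forall z, normc z < rho -> 0 <= a z.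
Notation mu := (@lebesgue_measure R).

Let P := xprim a.

Let cP z : normc z < rho -> {for z, continuous P}.
Proof. by move=> zr; apply: (pC_cont (xprim_cont (pC_le Ha))); rewrite subr0. Qed.

Let ca z : normc z < rho -> {for z, continuous a}.
Proof. by move=> zr; apply: (pC_cont Ha); rewrite subr0. Qed.

Lemma chord_integral (X y : R) : 0 <= X -> X ^+ 2 + y ^+ 2 < rho ^+ 2 -> 0 < rho ->
  integral mu `[- X, X] (fun x : R => (a (x +i* y))%:E) = (P (X +i* y) - P (- X +i* y))%:E.
Proof.
move=> X0 Xy rho0.
have inr (x : R) : - X <= x <= X -> normc (x +i* y) < rho.
  move=> /andP[x1 x2]; rewrite -(@ltr_pXn2r _ 2) ?nnegrE ?normc_ge0 ?ltW// sqr_normc/=.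
  apply: le_lt_trans Xy; rewrite lerD2r -[x ^+ 2]real_normK ?num_real//.
  by rewrite lerXn2r ?nnegrE// ler_norml x1.
have dP (x : R) : - X <= x <= X -> is_derive x 1 (fun x => P (x +i* y)) (a (x +i* y)).
  move=> /inr xr; have [ax [ay [da Hx Hy]]] := pCS Ha.
  have [D _] := xprim_partials da (pC0 Ha) Hx Hy (z := x +i* y) ltac:(by rewrite subr0).
  apply/is_derive_translate; apply: is_derive_ext D => s; congr P.
  by apply: eqC; rewrite !ReImE/= ?mulr0 ?mul0r ?mulr1 ?subr0 ?addr0.
move: X0; rewrite le_eqVlt => /predU1P[<-|X0].
  by rewrite oppr0 set_itv1 integral_set1 subrr.
have cx (x : R) : - X <= x <= X -> {for x, continuous (fun x => a (x +i* y))}.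
  move=> /inr xr; have cl : {for x, continuous (fun x : R => x +i* y : R[i])}.
    by apply: cont_pair; [exact: cvg_id|exact: (@contC R _ y x)].
  exact: (@cont_comp R _ _ a (fun x : R => x +i* y) x (ca xr) cl).
rewrite (@continuous_FTC2 R (fun x => a (x +i* y)) (fun x => P (x +i* y))).
- by rewrite EFinB.
- by rewrite gtrN.
- by apply: continuous_in_subspaceT => x; rewrite inE/= in_itv/=; exact: cx.
- split.
  + by move=> x; rewrite in_itv/= => /andP[/ltW x1 /ltW x2]; have [] := dP x ltac:(by rewrite x1).
  + apply: cvg_at_right_filter; apply: (is_derive_cont (dP (- X) _)); rewrite lexx/=; lra.
  + apply: cvg_at_left_filter; apply: (is_derive_cont (dP X _)); rewrite lexx/= andbT; lra.
- move=> x; rewrite in_itv/= => /andP[/ltW x1 /ltW x2]; rewrite derive1E.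
  by have [_ ->] := dP x ltac:(by rewrite x1).
Qed.

(** Green's theorem for P dy on the disc. By Tonelli the area integral is an integral over y of
    chord integrals, each the difference of P at the two ends of the chord. After y = t sin x the
    right ends trace the half circle from - pi / 2 to pi / 2, and the left ends, reflected by x ->
    pi - x, trace the other half. *)
Lemma disc_integral_xprim (t : R) : 0 < t -> t < rho ->
  disc_integral a t = Int th0 th1 (fun x => P (sp t x) * (t * cos x)) / pi.
Proof.
move=> t0 tr; have rho0 := lt_trans t0 tr; have p0 := pi_gt0 R.
rewrite /disc_integral -/(discRR t).
pose U z : R := a z / pi.
have cU z : normc z < rho -> {for z, continuous U}.
  by move=> zr; exact: (contM_at (ca zr) (@contC R _ pi^-1 z)).
rewrite /Rintegral integral_mkcond.
pose fE (p : R * R) : \bar R := (a (p.1 +i* p.2) / pi)%:E.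
have mE := (measurable_EFinP _ _).2 (measurable_disc_fun cU (ltW tr)).
rewrite -[discRR t]setTI in mE.
have mf := (measurable_restrict _ (measurable_discRR t) measurableT).1 mE.
rewrite fubini_tonelli2//; last first.
  move=> p; rewrite patchE; case: ifPn => // /set_mem pt.
  rewrite lee_fin divr_ge0 ?(ltW p0)// a0//; exact: lt_trans tr.
pose X (y : R) : R := Num.sqrt (t ^+ 2 - y ^+ 2).
pose g (y : R) : R := (P (X y +i* y) - P (- X y +i* y)) / pi.
have inD x y : (normc (x +i* y) < t) = (- X y < x < X y).
  rewrite -ltr_norml -(@ltr_pXn2r _ 2) ?nnegrE ?normc_ge0 ?ltW// sqr_normc/=.
  rewrite -ltrBrDr -[x ^+ 2]real_normK ?num_real//.
  have [tn|tp] := ltP (t ^+ 2 - y ^+ 2) 0.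
    rewrite /X ler0_sqrtr ?ltW// [RHS]ltNge normr_ge0/=; apply/negbTE.
    by rewrite -leNgt (le_trans (ltW tn))// sqr_ge0.
  by rewrite -[in LHS](sqr_sqrtr tp) ltr_pXn2r ?nnegrE ?sqrtr_ge0.
rewrite -/fE; have GE : fubini_G mu (fE \_ (discRR t)) =
    (EFin \o g) \_ `]- t, t[.
  apply/funext => y; rewrite /fubini_G.
  have Xe : (fun x : R => (fE \_ (discRR t)) (x, y)) =
      (fun x : R => (a (x +i* y) / pi)%:E) \_ `]- X y, X y[.
    apply/funext => x; rewrite !patchE.
    rewrite (_ : ((x, y) \in discRR t) = (x \in `]- X y, X y[%classic))//.
    by apply/idP/idP; rewrite !inE /discRR/= /toC/= in_itv/= inD.
  rewrite Xe -integral_mkcond patchE; case: ifPn => yt; last first.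
    (* For |y| >= t the radicand is nonpositive, its [Num.sqrt] is 0 and the open chord is empty. *)
    have X0 : X y = 0.
      apply: ler0_sqrtr; rewrite subr_le0 -[y ^+ 2]real_normK ?num_real//.
      rewrite lerXn2r ?nnegrE ?(ltW t0)// leNgt; apply: contra yt => yt.
      by rewrite inE/= in_itv/= -ltr_norml.
    by rewrite X0 oppr0 set_itvoo0 integral_set0.
  have {}yt : `|y| < t by move: yt; rewrite inE/= in_itv/= -ltr_norml.
  have Xr : X y ^+ 2 + y ^+ 2 < rho ^+ 2.
    rewrite sqr_sqrtr ?subrK; first by rewrite ltr_pXn2r ?nnegrE ?(ltW t0) ?(ltW rho0).
    by rewrite subr_ge0 -[y ^+ 2]real_normK ?num_real// lerXn2r ?nnegrE ?(ltW t0) ?normr_ge0 ?(ltW yt).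
  have X0 : 0 <= X y by exact: sqrtr_ge0.
  have cx (x : R) : - X y <= x <= X y -> {for x, continuous (fun x => a (x +i* y))}.
    move=> /andP[x1 x2]; have cl : {for x, continuous (fun x : R => x +i* y : R[i])}.
      by apply: cont_pair; [exact: cvg_id|exact: (@contC R _ y x)].
    apply: (@cont_comp R _ _ a (fun x : R => x +i* y) x _ cl); apply: ca.
    rewrite -(@ltr_pXn2r _ 2) ?nnegrE ?normc_ge0 ?ltW// sqr_normc/=.
    apply: le_lt_trans Xr; rewrite lerD2r -[x ^+ 2]real_normK ?num_real//.
    by rewrite lerXn2r ?nnegrE// ler_norml x1.
  have mx : measurable_fun `]- X y, X y[ (fun x : R => a (x +i* y)).
    apply: open_continuous_measurable_fun; first exact: interval_open.
    by move=> x; rewrite inE/= in_itv/= => /andP[/ltW x1 /ltW x2]; apply: cx; rewrite x1.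
  under eq_integral do rewrite mulrC EFinM.
  rewrite ge0_integralZl_EFin//=; last 3 first.
  - move=> x; rewrite in_itv/= -inD => xt; rewrite lee_fin a0//; exact: lt_trans tr.
  - exact/measurable_EFinP.
  - by rewrite invr_ge0 ltW.
  rewrite -(@integral_itv_bndoo R (- X y) (X y) _ true false); last exact/measurable_EFinP.
  by rewrite chord_integral// /g -EFinM mulrC.
have -> : integral mu setT (fubini_G mu (fE \_ (discRR t))) = integral mu `]- t, t[ (EFin \o g).
  by rewrite GE -integral_mkcond.
have cX : continuous X.
  move=> y; have c1 := contB_at (@contC R _ (t ^+ 2) y) (@exprn_continuous R 2 y).
  exact: (continuous_comp c1 (@sqrt_continuous R _)).
have nXy y : `|y| <= t -> normc (X y +i* y) = t.
  move=> yt; apply/eqP; rewrite -(@eqrXn2 _ 2) ?normc_ge0 ?(ltW t0)// sqr_normc/= sqr_sqrtr ?subrK//.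
  by rewrite subr_ge0 -[y ^+ 2]real_normK ?num_real// lerXn2r ?nnegrE ?(ltW t0) ?normr_ge0.
have nNXy y : normc (- X y +i* y) = normc (X y +i* y) by rewrite /= sqrrN.
have cg y : - t <= y <= t -> {for y, continuous g}.
  rewrite -ler_norml => yt.
  have c1 : {for y, continuous (fun y => X y +i* y : R[i])}.
    by apply: cont_pair; [exact: cX|exact: cvg_id].
  have c2 : {for y, continuous (fun y => - X y +i* y : R[i])}.
    by apply: cont_pair; [exact: (@continuousN _ R _ X y (@cX y))|exact: cvg_id].
  have d1 := @cont_comp R _ _ P (fun y => X y +i* y) y (cP (_ : normc (X y +i* y) < rho)) c1.
  have d2 := @cont_comp R _ _ P (fun y => - X y +i* y) y (cP (_ : normc (- X y +i* y) < rho)) c2.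
  rewrite nNXy nXy// in d1 d2.
  exact: (contM_at (contB_at (d1 tr) (d2 tr)) (@contC R _ pi^-1 y)).
have mg : measurable_fun `]- t, t[ g.
  apply: open_continuous_measurable_fun; first exact: interval_open.
  by move=> x; rewrite inE/= in_itv/= => /andP[/ltW x1 /ltW x2]; apply: cg; rewrite x1.
rewrite -(@integral_itv_bndoo R (- t) t _ true false); last exact/measurable_EFinP.
change (Int (- t) t g = Int th0 th1 (fun x => P (sp t x) * (t * cos x)) / pi).
pose F x := t * sin x; pose f x := t * cos x.
have dF (x : R) : is_derive x 1 F (f x) by have := dM (dC t x) (is_derive_sin x); rewrite mul0r add0r.
have cf : continuous f by exact: (contM (@contC R _ t) (@continuous_cos R)).
have -> : - t = F (- (pi / 2)) by rewrite /F sinN sin_pihalf mulrN1.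
have -> : Int (F (- (pi / 2))) t g = Int (F (- (pi / 2))) (F (pi / 2)) g.
  by rewrite {3}/F sin_pihalf mulr1.
have p2 : - (pi / 2) <= pi / 2 :> R by lra.
rewrite (subst_increasing p2 _ dF cf); last 2 first.
- by move=> x y xI yI xy; rewrite /F ltr_pM2l// ltr_sin.
- by move=> y; rewrite /F sinN sin_pihalf mulrN1 mulr1; exact: cg.
pose q x := P (sp t x) * (t * cos x).
have cq : continuous q.
  apply: contM; last exact: cf.
  by apply: (pC_circ (xprim_cont (pC_le Ha))); rewrite gtr0_norm.
have cqr : continuous (fun x => q (pi - x)).
  move=> x; apply: (@continuous_comp _ _ _ (fun x => pi - x) q); last exact: cq.
  have cid : {for x, continuous (fun y : R => y)} by exact: cvg_id.
  exact: (contB_at (@contC R _ pi x) cid).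
have -> : Int th0 th1 q = Int (- (pi / 2)) (pi / 2) (fun x => q x + q (pi - x)).
  have p21 : pi / 2 <= th1 :> R by rewrite /th1 lerDr ltW.
  rewrite (IntD _ _ cq cqr) (@Int_cat R th0 (pi / 2) th1 q p2 p21 cq).
  have e1 : pi - pi / 2 = pi / 2 :> R by lra.
  by have := subst_reflect pi p2 cq; rewrite opprK e1 => ->.
have := @IntZ R (- (pi / 2)) (pi / 2) (pi^-1) _ (contD cq cqr).
rewrite [_^-1 * _]mulrC => <-.
apply: eq_Int => x /andP[x1 x2].
have cx0 : 0 <= cos x by rewrite cos_ge0_pihalf// x1.
have XE : X (F x) = t * cos x.
  rewrite /X /F exprMn -{1}(mulr1 (t ^+ 2)) -(cos2Dsin2 x) mulrDr addrK -exprMn sqrtr_sqr ger0_norm//.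
  by rewrite mulr_ge0// ltW.
rewrite /g XE /q /f.
have -> : t * cos x +i* F x = sp t x.
  by apply: eqC; rewrite !ReImE/= ?mul0r ?subr0 ?addr0.
have -> : - (t * cos x) +i* F x = sp t (pi - x).
  rewrite /sp /eit -{1 2}(opprB x pi) cosN sinN -[x - pi]addrC.
  have -> : cos (- pi + x) = - cos x by rewrite addrC -(cosN (x - pi)) opprB -[pi - x]addrC cosDpi cosN.
  have -> : sin (- pi + x) = - sin x by rewrite addrC -[x - pi]opprB sinN -[pi - x]addrC sinDpi sinN opprK.
  by apply: eqC; rewrite !ReImE/= ?mul0r ?subr0 ?addr0 /F; ring.
have -> : cos (pi - x) = - cos x by rewrite -[pi - x]addrC cosDpi cosN.
by ring.
Qed.

Let mean_cont s : `|s| < rho -> continuous (fun x => a (sp s x)).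
Proof. by move=> sr; apply: (pC_circ (pC0 Ha) sr). Qed.

Lemma is_derive_disc_integral t : 0 < t -> t < rho ->
  is_derive t 1 (disc_integral a) (t / pi * Int th0 th1 (fun x => a (sp t x))).
Proof.
move=> t0 tr; have tr' : `|t| < rho by rewrite gtr0_norm.
have D := dM (polar_area Ha tr') (dC pi^-1 t).
rewrite (_ : t / pi * _ = t * Int th0 th1 (fun x => a (sp t x)) / pi +
  Int th0 th1 (fun x => xprim a (sp t x) * (t * cos x)) * 0); last by ring.
apply: is_derive_near D; exists (Num.min t (rho - t)); first by rewrite lt_min t0 subr_gt0.
move=> y; rewrite lt_min ltr_norml ltr_distl => /andP[/andP[y1 _] /andP[_ y2]].
by rewrite disc_integral_xprim//; lra.
Qed.

(** The order t^2 makes A(t) / t tend to 0 at 0, so the integral defining the characteristic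
    function has no singularity there. It comes from the mean value theorem, since pi A has
    derivative s times a bounded circle integral. *)
Lemma disc_integral_bound (r : R) : 0 <= r -> r < rho -> exists2 M, 0 <= M &
  forall t : R, 0 < t -> t <= r -> 0 <= disc_integral a t <= M * t ^+ 2.
Proof.
move=> r0 rr.
have [M M0 HM] := pC_bound r0 rr (pC0 Ha).
have p0 := pi_gt0 R.
pose m (s : R) := Int th0 th1 (fun x => a (sp s x)).
have mM (s : R) : `|s| <= r -> 0 <= m s <= M * (2 * pi).
  move=> sr; have n x : normc (sp s x) <= r by rewrite normc_sp.
  apply/andP; split; first by apply: Int_ge0 => x _; apply: a0; exact: le_lt_trans (n x) rr.
  rewrite -th1B0; apply: le_trans (ler_norm _) _; apply: Int_abs_le.
  - exact: (@th01 R).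
  - exact: (mean_cont (le_lt_trans sr rr)).
  - by move=> x _; exact: HM.
pose Q (s : R) := Int th0 th1 (fun x => xprim a (sp s x) * (s * cos x)).
have Q0 : Q 0 = 0.
  rewrite /Q (eq_Int (g := fun=> 0)) ?Int_cst ?mul0r//; first exact: (@th01 R).
  by move=> x _; rewrite mul0r mulr0.
exists (2 * M) => [|t t0 tr]; first by rewrite mulr_ge0.
have tr' : `|t| <= r by rewrite gtr0_norm.
have [c] := @MVT_zero R Q (fun s => s * m s) t
  (fun s st => polar_area Ha (le_lt_trans st (le_lt_trans tr' rr))).
rewrite (gtr0_norm t0) Q0 subr0 => ct QE.
have /andP[m0 m1] := mM c (le_trans ct tr).
apply/andP; split.
  apply: Rintegral_ge0 => p; rewrite /= => pt; rewrite divr_ge0 ?(ltW p0)// a0//.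
  exact: lt_trans pt (le_lt_trans tr rr).
rewrite disc_integral_xprim// ?(le_lt_trans tr)// -/(Q t) QE ler_pdivrMr// expr2 mulrA.
rewrite [leRHS](_ : _ = t * (M * (2 * pi)) * t); last by ring.
apply: ler_wpM2r (ltW t0) _ _ _; apply: le_trans (ler_norm _) _.
by rewrite normrM [`|m c|]ger0_norm//; apply: ler_pM.
Qed.

End disc_integral_polar.

(** * The characteristic function *)

Section monotonicity.
Variable R : realType.
Notation mu := (@lebesgue_measure R).
Implicit Types (g h : R -> R) (r a b x : R).

Lemma derive_nondecreasing g g' a b : a <= b ->
  (forall x, a <= x <= b -> is_derive x 1 g (g' x)) ->
  (forall x, a <= x <= b -> 0 <= g' x) -> g a <= g b.
Proof.
move=> ab dg g0; have [x|x xI|c] := @MVT_segment R g g' a b ab.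
- by rewrite in_itv/= => /andP[/ltW x1 /ltW x2]; apply: dg; rewrite x1.
- apply: continuous_in_subspaceT x xI => x; rewrite inE/= in_itv/= => /dg; exact: is_derive_cont.
- rewrite in_itv/= => /g0 c0 E; rewrite -subr_ge0 E mulr_ge0// subr_ge0//.
Qed.

(** The derivatives used later are available only for x > 0, where the area integral is computed;
    the behaviour at 0 enters as a lower bound on the limit. *)
Lemma derive_nondecreasing_lim g g' r (L : R) : 0 < r ->
  (forall x, 0 < x <= r -> is_derive x 1 g (g' x)) ->
  (forall x, 0 < x <= r -> 0 <= g' x) ->
  (forall e : R, 0 < e -> exists2 d : R, 0 < d & forall s, 0 < s < d -> L - e <= g s) -> L <= g r.
Proof.
move=> r0 dg g0 lim; apply/ler_addgt0Pl => e /lim[d d0 Hd].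
pose s := Num.min (d / 2) r.
have s0 : 0 < s by rewrite lt_min r0 divr_gt0.
have sr : s <= r by rewrite ge_min lexx orbT.
have sd : s < d by apply: le_lt_trans (_ : d / 2 < d); [rewrite ge_min lexx|lra].
have := Hd s; rewrite s0 sd => /(_ isT).
have := @derive_nondecreasing g g' s r sr.
have dI x : s <= x <= r -> 0 < x <= r by move=> /andP[x1 ->]; rewrite (lt_le_trans s0).
by move=> /(_ (fun x xI => dg x (dI x xI)) (fun x xI => g0 x (dI x xI))); lra.
Qed.

Section characteristic.
Variables (A : R -> R) (rho : R).
Hypothesis cA : forall x, 0 < x -> x < rho -> {for x, continuous A}.
Hypothesis bA : forall r, 0 <= r -> r < rho -> exists2 M, 0 <= M &
  forall t, 0 < t -> t <= r -> 0 <= A t <= M * t ^+ 2.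

(** The integrand extended by 0 to t <= 0 and, in [Bm], frozen beyond r: it becomes continuous on
    the whole line, as the lemmas on [Int] ask. *)
Let B t := if 0 < t then A t / t else 0.

Let B_le r : 0 <= r -> r < rho -> exists2 M, 0 <= M & forall t, t <= r -> 0 <= B t <= M * `|t|.
Proof.
move=> r0 rr; have [M M0 HM] := bA r0 rr; exists M => // t tr.
rewrite /B; case: ifPn => [t0|_]; last by rewrite lexx mulr_ge0.
have /andP[H1 H2] := HM t t0 tr; rewrite divr_ge0 ?(ltW t0)//= ler_pdivrMr//.
by rewrite gtr0_norm// -mulrA -expr2.
Qed.

Let B_cont x : x < rho -> {for x, continuous B}.
Proof.
move=> xr; have [x0|x0|x0] := ltgtP x 0.
- apply/cont_eps => e e0; exists (- x) => [|y]; first by rewrite oppr_gt0.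
  rewrite ltr_distl => /andP[_ y0]; rewrite /B !ltNge (ltW x0) (_ : y <= 0)/= ?subrr ?normr0//; lra.
- have c1 : {for x, continuous (fun t => A t * t^-1)}.
    by apply: (contM_at (cA x0 xr)); exact: (is_derive_cont (is_derive_inv (lt0r_neq0 x0))).
  move/cont_eps : c1 => c1; apply/cont_eps => e /c1[d d0 Hd].
  exists (Num.min d x) => [|y]; first by rewrite lt_min d0.
  rewrite lt_min => /andP[/Hd H]; rewrite ltr_distl => /andP[y0 _].
  by rewrite /B x0 (_ : 0 < y)//; lra.
- subst x; apply/cont_eps => e e0.
  have r2 : 0 <= rho / 2 by rewrite divr_ge0// ltW.
  have [|M M0 HM] := B_le r2; first lra.
  have M1 : 0 < M + 1 by rewrite ltr_wpDl.
  exists (Num.min (rho / 2) (e / (M + 1))) => [|y]; first by rewrite lt_min !divr_gt0.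
  rewrite subr0 lt_min (ltr_pdivlMr _ _ M1) => /andP[y1 y2].
  have {1}-> : B 0 = 0 by rewrite /B ltxx.
  have /andP[b1 b2] := HM y ltac:(exact: (le_trans (ler_norm y) (ltW y1))).
  rewrite subr0 ger0_norm//; apply: le_lt_trans b2 _; apply: le_lt_trans y2.
  by rewrite mulrC ler_wpM2l// lerDl.
Qed.

Let Bm r x := B (Num.min x r).

Let Bm_cont r : r < rho -> continuous (Bm r).
Proof.
move=> rr x; apply/cont_eps => e e0.
have /cont_eps/(_ e e0)[d d0 Hd] : {for Num.min x r, continuous B}.
  by apply: B_cont; rewrite gt_min rr orbT.
exists d => // y yx; apply: Hd; apply: le_lt_trans yx.
have := ler_norm (y - x); have := ler_norm (x - y); rewrite distrC ler_norml !minEle.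
by case: (leP y r) => ?; case: (leP x r) => ? ? ?; lra.
Qed.

(** For [A := disc_integral (pullback omega f)] this unfolds to [T_char omega f]. *)
Definition characteristic r := Rintegral mu `]0, r[ (fun t => A t / t).

Let char_Int r x : 0 < x -> x <= r -> r < rho -> characteristic x = Int 0 x (Bm r).
Proof.
move=> x0 xr rr; rewrite /characteristic /Int.
have I : mu.-integrable `[0, x] (EFin \o Bm r) by apply: cont_integrable; exact: Bm_cont.
rewrite -Rintegral_itv_obnd_cbnd; last first.
  by apply: integrableS I => //; apply: subset_itvr; rewrite bnd_simp.
rewrite -Rintegral_itv_bndo_bndc; last first.
  by apply: integrableS I => //; apply: subset_itv; rewrite bnd_simp.
apply: eq_Rintegral => t; rewrite inE/= in_itv/= => /andP[t0 tx].
by rewrite /Bm /B min_l ?t0// (le_trans (ltW tx)).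
Qed.

Lemma is_derive_characteristic r : 0 < r -> r < rho -> is_derive r 1 characteristic (A r / r).
Proof.
move=> r0 rr; pose r1 := (r + rho) / 2.
have [rr1 r1r] : r < r1 /\ r1 < rho by rewrite /r1; split; lra.
have := Int_FTC1 (Bm_cont r1r) r0.
have -> : Bm r1 r = A r / r by rewrite /Bm min_l ?(ltW rr1)// /B r0.
apply: is_derive_near; exists (Num.min r (r1 - r)); first by rewrite lt_min r0 subr_gt0.
move=> y; rewrite lt_min !ltr_distl => /andP[/andP[y1 _] /andP[_ y2]].
by rewrite (@char_Int r1)//; lra.
Qed.

Lemma characteristic_bound r : 0 <= r -> r < rho -> exists2 M, 0 <= M &
  forall t, 0 < t -> t <= r -> 0 <= characteristic t <= M * t.
Proof.
move=> r0 rr; have [M M0 HM] := B_le r0 rr.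
have B0 t : t <= r -> 0 <= Bm r t <= M * r.
  move=> tr; rewrite /Bm min_l//; have [t0|t0] := ltP 0 t; last first.
    by rewrite /B ltNge t0/= lexx mulr_ge0.
  have /andP[-> /= h] := HM t tr; apply: le_trans h _.
  by rewrite gtr0_norm// ler_wpM2l.
exists (M * r) => [|t t0 tr]; first exact: mulr_ge0.
rewrite (char_Int t0 tr rr); apply/andP; split.
  by apply: Int_ge0 => x /andP[_ xt]; have /andP[] := B0 x (le_trans xt tr).
have := Int_abs_le (ltW t0) (Bm_cont rr) (M := M * r).
rewrite subr0 => /(_ _)/(le_trans (ler_norm _)); apply => x /andP[_ xt].
by have /andP[b1 b2] := B0 x (le_trans xt tr); rewrite ger0_norm.
Qed.

End characteristic.
End monotonicity.

(** * Jensen's inequality for smooth functions *)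

Section green_jensen.
Variables (R : realType) (rho : R) (k : nat) (a : R[i] -> R).
Hypothesis Ha : pC k.+2 0 rho a.
Hypothesis a0 : forall z, normc z < rho -> 0 <= a z.
Variables (u ux uy uxx uxy uyx uyy : R[i] -> R) (lambda : R).
Hypothesis Hu : pC 0 0 rho u.
Hypothesis Hux : pC 0 0 rho ux.
Hypothesis Huy : pC 0 0 rho uy.
Hypothesis Huxx : pC 0 0 rho uxx.
Hypothesis Huxy : pC 0 0 rho uxy.
Hypothesis Huyx : pC 0 0 rho uyx.
Hypothesis Huyy : pC 0 0 rho uyy.
Hypothesis du : forall z, normc (z - 0) < rho -> rder u 1 z (ux z) /\ rder u 'i%C z (uy z).
Hypothesis dux : forall z, normc (z - 0) < rho -> rder ux 1 z (uxx z) /\ rder ux 'i%C z (uxy z).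
Hypothesis duy : forall z, normc (z - 0) < rho -> rder uy 1 z (uyx z) /\ rder uy 'i%C z (uyy z).
Hypothesis lap : forall z, normc z < rho -> 4 * lambda * a z <= uxx z + uyy z.

Let A := disc_integral a.

Let flux s := Int th0 th1 (fun t => cos t * ux (sp s t) + sin t * uy (sp s t)).

Let kpi : R := 4 * pi * lambda.

(** The difference of the two sides tends to 0 at 0, and its derivative is s times the circle
    integral of the Laplacian minus 4 lambda a. The factor pi in [kpi] undoes the 1 / pi in
    [disc_integral]. *)
Let flux_ge r : 0 < r -> r < rho -> kpi * A r <= r * flux r.
Proof.
move=> r0 rr; have p0 := pi_gt0 R.
pose g' s := s * Int th0 th1 (fun t => uxx (sp s t) + uyy (sp s t)) -
  kpi * (s / pi * Int th0 th1 (fun x => a (sp s x))).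
rewrite -subr_ge0; apply: (@derive_nondecreasing_lim R (fun s => s * flux s - kpi * A s) g' r 0 r0).
- move=> s /andP[s0 sr]; have sr' := le_lt_trans sr rr.
  have d1 := green_flux Hux Huy Huxx Huxy Huyx Huyy dux duy (_ : `|s| < rho).
  have d2 := dM (dC kpi s) (is_derive_disc_integral Ha a0 s0 sr').
  rewrite mul0r add0r in d2; rewrite gtr0_norm// in d1.
  exact: (dB (d1 sr') d2).
- move=> s /andP[s0 sr]; have sr' : `|s| < rho by rewrite gtr0_norm// (le_lt_trans sr).
  have ca := pC_circ (pC0 Ha) sr'.
  rewrite /g' (_ : _ - _ = s * (Int th0 th1 (fun t => uxx (sp s t) + uyy (sp s t)) -
    4 * lambda * Int th0 th1 (fun x => a (sp s x)))); last first.
    set X := Int _ _ _; set Y := Int _ _ _.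
    have -> : kpi * (s / pi * Y) = s * (4 * lambda * Y) * (pi / pi) by rewrite /kpi; ring.
    by rewrite divff ?lt0r_neq0// mulr1 -mulrBr.
  apply: mulr_ge0; first exact: ltW.
  rewrite subr_ge0 -(IntZ _ _ _ ca); apply: Int_le.
  + exact: (contM (@contC R _ (4 * lambda)) ca).
  + exact: (contD (pC_circ Huxx sr') (pC_circ Huyy sr')).
  + by move=> t _; apply: lap; rewrite normc_sp.
- move=> e e0.
  have r2 := ltW r0.
  have [Mx Mx0 HMx] := pC_bound r2 rr Hux.
  have [My My0 HMy] := pC_bound r2 rr Huy.
  have [M M0 HM] := disc_integral_bound Ha a0 r2 rr.
  (* For 0 < s <= r, [K] times s bounds |s flux(s) - kpi A(s)|. *)
  pose K := (Mx + My) * (2 * pi) + `|kpi| * M * r + 1.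
  have K0 : 0 < K.
    have p1 := ltW p0; rewrite /K ltr_wpDl//; apply: addr_ge0; apply: mulr_ge0 => //.
    - exact: addr_ge0.
    - exact: mulr_ge0.
    - exact: mulr_ge0.
  exists (Num.min r (e / K)) => [|s]; first by rewrite lt_min r0 divr_gt0.
  rewrite lt_min => /and3P[s0 /ltW sr]; rewrite ltr_pdivlMr// sub0r => sK.
  have sn : `|s| <= r by rewrite gtr0_norm.
  have sn' := le_lt_trans sn rr.
  have f1 : `|flux s| <= (Mx + My) * (2 * pi).
    rewrite -th1B0; apply: Int_abs_le.
    - exact: (th01 R).
    - exact: (contD (contM (@continuous_cos R) (pC_circ Hux sn')) (contM (@continuous_sin R) (pC_circ Huy sn'))).
    move=> t _; apply: le_trans (ler_normD _ _) _; rewrite !normrM.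
    have nt : normc (sp s t) <= r by rewrite normc_sp.
    apply: lerD; rewrite -[leRHS]mul1r; apply: ler_pM => //.
    + by rewrite ler_norml cos_geN1 cos_le1.
    + exact: HMx.
    + by rewrite ler_norml sin_geN1 sin_le1.
    + exact: HMy.
  have /andP[A0 A1] := HM s s0 sr.
  suff : `|s * flux s - kpi * A s| <= e by rewrite ler_norml => /andP[].
  apply: le_trans (ltW sK); apply: le_trans (ler_normB _ _) _.
  rewrite (normrM s) (normrM kpi) (gtr0_norm s0) [`|A s|]ger0_norm// /K.
  apply: le_trans (_ : s * ((Mx + My) * (2 * pi) + `|kpi| * M * r) <= _).
    rewrite mulrDr; apply: lerD; first by rewrite ler_wpM2l// ltW.
    rewrite [leRHS](_ : _ = `|kpi| * (M * (s * r))); last by ring.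
    rewrite ler_wpM2l//; apply: le_trans A1 _; rewrite ler_wpM2l// expr2 ler_wpM2l//; exact: ltW.
  by rewrite ler_wpM2l ?(ltW s0)// lerDl.
Qed.

(** The second integration: the circle integral of u has derivative [flux], which [flux_ge] bounds
    below by [kpi] A / s, the derivative of [kpi] times the characteristic function. The limit at 0
    contributes 2 pi u(0). *)
Lemma green_jensen r : 0 < r -> r < rho ->
  2 * pi * u 0 + 4 * pi * lambda * characteristic A r <= Int th0 th1 (fun t => u (sp r t)).
Proof.
move=> r0 rr; rewrite -/kpi -lerBrDr.
have cA x : 0 < x -> x < rho -> {for x, continuous A}.
  by move=> x0 xr; exact: (is_derive_cont (is_derive_disc_integral Ha a0 x0 xr)).
have bA := disc_integral_bound Ha a0.
pose m s := Int th0 th1 (fun t => u (sp s t)).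
apply: (@derive_nondecreasing_lim R (fun s => m s - kpi * characteristic A s)
  (fun s => flux s - kpi * (A s / s)) r _ r0).
- move=> s /andP[s0 sr]; have sr' := le_lt_trans sr rr.
  have d2 := dM (dC kpi s) (is_derive_characteristic cA bA s0 sr').
  rewrite mul0r add0r in d2; apply: (dB _ d2).
  by apply: (green_mean Hu Hux Huy du); rewrite gtr0_norm.
- move=> s /andP[s0 sr]; have sr' := le_lt_trans sr rr.
  by rewrite subr_ge0 mulrA ler_pdivrMr// [flux s * s]mulrC flux_ge.
- move=> e e0.
  have m0 : m 0 = 2 * pi * u 0.
    rewrite /m (eq_Int (g := fun=> u 0)) ?Int_cst ?th1B0 1?mulrC//; first exact: (th01 R).
    by move=> t _; rewrite /sp mul0r.
  have /cont_eps/(_ (e / 2))[|d d0 Hd] : {for 0, continuous m}.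
    apply: (is_derive_cont (green_mean Hu Hux Huy du _)); rewrite normr0; exact: lt_trans rr.
    by rewrite divr_gt0.
  have [M M0 HM] := characteristic_bound cA bA (ltW r0) rr.
  pose K := `|kpi| * M + 1.
  have K0 : 0 < K by rewrite /K ltr_wpDl// mulr_ge0.
  exists (Num.min d (Num.min r (e / 2 / K))) => [|s]; first by rewrite !lt_min r0 !divr_gt0// d0.
  rewrite !lt_min => /and4P[s0 sd /ltW sr]; rewrite ltr_pdivlMr// => sK.
  have := Hd s; rewrite subr0 m0 gtr0_norm// => /(_ sd); rewrite ltr_distl => /andP[h1 _].
  have /andP[c0 c1] := HM s s0 sr.
  suff : kpi * characteristic A s <= e / 2 by lra.
  apply: le_trans (ltW sK); apply: le_trans (ler_norm _) _.
  rewrite (normrM kpi) [`|characteristic _ _|]ger0_norm// /K mulrDr mulr1.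
  apply: le_trans (_ : `|kpi| * (M * s) <= _); first by rewrite ler_wpM2l.
  by rewrite mulrA [_ * s]mulrC lerDl ltW.
Qed.

End green_jensen.

(** * Laplacians *)

Section laplacian.
Variable R : realType.
Implicit Types (u f : R[i] -> R) (z w c : R[i]) (k : nat) (r : R).

(** Partial derivatives found on small discs agree with [real_derive], which is defined globally and
    so serves as the witness on the whole disc. *)
Lemma pC_local k c r u : (forall z, normc (z - c) < r -> exists2 d, 0 < d & pC k z d u) -> pC k c r u.
Proof.
elim: k u => [|k IH] u H.
  by split=> // z /H[d d0 H']; apply: (pC_cont H'); rewrite subrr normc0.
split=> [z /H[d d0 H']|]; first by apply: (pC_cont H'); rewrite subrr normc0.
exists (real_derive u 1), (real_derive u 'i%C).
have rd (v z : R[i]) l : rder u v z l -> real_derive u v z = l.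
  by move=> D; rewrite /real_derive derive1E; have [_ ->] := D.
split.
- move=> z /H[d d0 /pCS[ux [uy [D _ _]]]].
  have [|Dx Dy] := D z; first by rewrite subrr normc0.
  by rewrite (rd _ _ _ Dx) (rd _ _ _ Dy).
- apply: IH => z /H[d d0 /pCS[ux [uy [D Hx _]]]]; exists d => //.
  by apply: pC_ext Hx => w /D[Dx _]; rewrite (rd _ _ _ Dx).
- apply: IH => z /H[d d0 /pCS[ux [uy [D _ Hy]]]]; exists d => //.
  by apply: pC_ext Hy => w /D[_ Dy]; rewrite (rd _ _ _ Dy).
Qed.

(** A relation rather than a value: it asserts that the derivatives exist, whereas [ddc] is a total
    expression. *)
Definition is_lap u z (L : R) := exists ux uy : R[i] -> R, exists xx yy : R,
  [/\ exists2 d, 0 < d & forall w, normc (w - z) < d -> rder u 1 w (ux w) /\ rder u 'i%C w (uy w),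
      rder ux 1 z xx, rder uy 'i%C z yy & L = xx + yy].

Lemma is_lap_near u f z L : (exists2 d, 0 < d & forall w, normc (w - z) < d -> u w = f w) ->
  is_lap u z L -> is_lap f z L.
Proof.
move=> [d d0 uf] [ux [uy [xx [yy [[e e0 D] Dx Dy ->]]]]].
exists ux, uy, xx, yy; split=> //; exists (Num.min d e); first by rewrite lt_min d0.
move=> w; rewrite lt_min => /andP[wd we].
have nw : exists2 d', 0 < d' & forall v, normc (v - w) < d' -> u v = f v by exact: disc_near uf wd.
by have [A B] := D w we; split; exact: rder_near nw _.
Qed.

Lemma is_lapC (a : R) z : is_lap (fun=> a) z 0.
Proof.
exists (fun=> 0), (fun=> 0), 0, 0; split; [|exact: rderC|exact: rderC|by rewrite addr0].
by exists 1 => // w _; split; exact: rderC.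
Qed.

Lemma is_lapD u f z L M : is_lap u z L -> is_lap f z M -> is_lap (fun w => u w + f w) z (L + M).
Proof.
move=> [ux [uy [xx [yy [[d d0 D] Dx Dy ->]]]]] [fx [fy [xx' [yy' [[e e0 E] Ex Ey ->]]]]].
exists (fun w => ux w + fx w), (fun w => uy w + fy w), (xx + xx'), (yy + yy').
split; [|exact: rderD|exact: rderD|by rewrite addrACA].
exists (Num.min d e) => [|w]; first by rewrite lt_min d0.
by rewrite lt_min => /andP[/D[A B] /E[A' B']]; split; exact: rderD.
Qed.

Lemma rderZ (a : R) u (v z : R[i]) l : rder u v z l -> rder (fun w => a * u w) v z (a * l).
Proof. by move=> D; have := rderM (rderC a v z) D; rewrite mul0r add0r. Qed.

Lemma is_lapZ (a : R) u z L : is_lap u z L -> is_lap (fun w => a * u w) z (a * L).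
Proof.
move=> [ux [uy [xx [yy [[d d0 D] Dx Dy ->]]]]].
exists (fun w => a * ux w), (fun w => a * uy w), (a * xx), (a * yy).
split; [|exact: rderZ|exact: rderZ|by rewrite mulrDr].
by exists d => // w /D[A B]; split; exact: rderZ.
Qed.

Lemma real_derive_rder u v z l : rder u v z l -> real_derive u v z = l.
Proof. by move=> D; rewrite /real_derive derive1E; have [_ ->] := D. Qed.

(** The composite of [d_z] and [d_zbar] is a quarter of the Laplacian; this is where the 4 in the
    Laplacian form of the curvature bound comes from. *)
Lemma is_lap_ddc u z L : is_lap u z L -> complex.Re (ddc u z) = L / 4.
Proof.
move=> [ux [uy [xx [yy [[d d0 D] Dx Dy ->]]]]].
have dzE w : normc (w - z) < d -> d_zbar (fun w => (u w)%:C) w = (2^-1 * ux w +i* (2^-1 * uy w)).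
  move=> /D[A B]; rewrite /d_zbar /real_partial/= (real_derive_rder A) (real_derive_rder B).
  rewrite (real_derive_rder (rderC 0 _ _)) (real_derive_rder (rderC 0 _ _)).
  by apply: eqC; rewrite !ReImE/=; field.
have nx : exists2 d, 0 < d & forall w, normc (w - z) < d ->
    2^-1 * ux w = complex.Re (d_zbar (fun w => (u w)%:C) w).
  by exists d => // w /dzE ->.
have ny : exists2 d, 0 < d & forall w, normc (w - z) < d ->
    2^-1 * uy w = complex.Im (d_zbar (fun w => (u w)%:C) w).
  by exists d => // w /dzE ->.
rewrite /ddc /d_z /real_partial (real_derive_rder (rder_near nx (rderZ 2^-1 Dx))).
rewrite (real_derive_rder (rder_near ny (rderZ 2^-1 Dy))).
by rewrite !ReImE/=; field.
Qed.

Lemma is_lap_unique u z L M : is_lap u z L -> is_lap u z M -> L = M.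
Proof. move=> /is_lap_ddc HL /is_lap_ddc; rewrite HL => /(congr1 ( *%R^~ 4)); rewrite !divfK//; lra. Qed.

Lemma pC_lap c r u : pC 2 c r u -> exists ux uy uxx uxy uyx uyy : R[i] -> R,
  [/\ [/\ pC 0 c r ux, pC 0 c r uy, pC 0 c r uxx, pC 0 c r uxy & pC 0 c r uyx /\ pC 0 c r uyy],
      forall z, normc (z - c) < r -> rder u 1 z (ux z) /\ rder u 'i%C z (uy z),
      forall z, normc (z - c) < r -> rder ux 1 z (uxx z) /\ rder ux 'i%C z (uxy z),
      forall z, normc (z - c) < r -> rder uy 1 z (uyx z) /\ rder uy 'i%C z (uyy z) &
      forall z, normc (z - c) < r -> is_lap u z (uxx z + uyy z)].
Proof.
move=> /pCS[ux [uy [D Hx Hy]]].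
have [uxx [uxy [Dx Hxx Hxy]]] := pCS Hx.
have [uyx [uyy [Dy Hyx Hyy]]] := pCS Hy.
exists ux, uy, uxx, uxy, uyx, uyy; split=> //; first by split=> //; apply: pC_le.
move=> z zr; exists ux, uy, (uxx z), (uyy z); split=> //.
- by exists (r - normc (z - c)) => [|w /disc_sub wz]; [rewrite subr_gt0|exact: D].
- by have [] := Dx z zr.
- by have [] := Dy z zr.
Qed.

Definition lnabs2 w z : R := ln (normc (z - w) ^+ 2).

Lemma pC_normc2 k c r w : pC k c r (fun z => normc (z - w) ^+ 2).
Proof.
have hid : holo (fun z => z - w) c r by move=> z _; exists (1 - 0); exact: (cdiffB (cdiff_id z) (cdiffC w z)).
have [Hx Hy] := pC_holo k hid.
apply: pC_ext (pCD (pCX 2 Hx) (pCX 2 Hy)) => z _.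
by rewrite sqr_normc.
Qed.

Lemma pC_lnabs2 k c r w : r <= normc (w - c) -> pC k c r (lnabs2 w).
Proof.
move=> wr; apply: pC_ln (pC_normc2 k c r w) => z zr.
rewrite exprn_gt0// normc_gt0 subr_eq0; apply: contraTneq zr => ->.
by rewrite -leNgt.
Qed.

Let X w z := complex.Re (z - w).
Let Y w z := complex.Im (z - w).
Let q w z := X w z ^+ 2 + Y w z ^+ 2.

Let rX w z : rder (X w) 1 z 1 /\ rder (X w) 'i%C z 0.
Proof.
split.
  have := dD (dC (X w z) (0 : R)) (did (0 : R)); rewrite add0r; apply: is_derive_ext => s.
  by rewrite /X !ReImE/=; ring.
apply: is_derive_ext (dC (X w z) (0 : R)) => s.
by rewrite /X !ReImE/=; ring.
Qed.

Let rY w z : rder (Y w) 1 z 0 /\ rder (Y w) 'i%C z 1.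
Proof.
split.
  apply: is_derive_ext (dC (Y w z) (0 : R)) => s.
  by rewrite /Y !ReImE/=; ring.
have := dD (dC (Y w z) (0 : R)) (did (0 : R)); rewrite add0r; apply: is_derive_ext => s.
by rewrite /Y !ReImE/=; ring.
Qed.

Lemma is_lap_lnabs2 w z : z != w -> is_lap (lnabs2 w) z 0.
Proof.
move=> zw.
have qE v : normc (v - w) ^+ 2 = q w v by rewrite sqr_normc.
have q0 v : v != w -> 0 < q w v by move=> vw; rewrite -qE exprn_gt0// normc_gt0 subr_eq0.
have rq (v : R[i]) : rder (q w) 1 v (2 * X w v) /\ rder (q w) 'i%C v (2 * Y w v).
  have [x1 x2] := rX w v; have [y1 y2] := rY w v.
  have h1 := rderD (rderM x1 x1) (rderM y1 y1); have h2 := rderD (rderM x2 x2) (rderM y2 y2).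
  split.
    by apply: rder_val h1; rewrite -/(X w v); ring.
  by apply: rder_val h2; rewrite -/(Y w v); ring.
have d0 : 0 < normc (z - w) by rewrite normc_gt0 subr_eq0.
have vw v : normc (v - z) < normc (z - w) -> v != w.
  by apply: contraTneq => ->; rewrite normcBC ltxx.
have rln (v d : R[i]) l : v != w -> rder (q w) d v l -> rder (lnabs2 w) d v ((q w v)^-1 * l).
  move=> /q0 qv D; have := rder_comp (is_derive1_ln qv) D.
  by apply: rder_near; exists 1 => // x _; rewrite /lnabs2 qE.
have rinv d l : rder (q w) d z l -> rder (fun v => (q w v)^-1) d z (- (q w z * q w z)^-1 * l).
  by move=> D; exact: (rder_comp (is_derive_inv (lt0r_neq0 (q0 _ zw))) D).
have [x1 _] := rX w z; have [_ y2] := rY w z; have [qx qy] := rq z.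
have hx := rderM (rinv _ _ qx) (rderZ 2 x1).
have hy := rderM (rinv _ _ qy) (rderZ 2 y2).
exists (fun v => (q w v)^-1 * (2 * X w v)), (fun v => (q w v)^-1 * (2 * Y w v)).
eexists; eexists; split; [|exact: hx|exact: hy|].
  exists (normc (z - w)) => // v /vw vw'; have [A B] := rq v.
  by split; exact: rln.
have := lt0r_neq0 (q0 _ zw); rewrite /q; set x := X w z; set y := Y w z => n0.
rewrite invfM; have := mulVf n0; set i := _^-1 => iq.
transitivity (4 * i * (1 - i * (x ^+ 2 + y ^+ 2))); first by rewrite iq subrr mulr0.
by ring.
Qed.

End laplacian.

(** * Holomorphic curves in a manifold *)

Section vector_derivative.
Variables (R : realType) (n : nat).
Implicit Types (F G : R[i] -> 'rV[R[i]]_n) (L : 'rV[R[i]]_n) (z w : R[i]).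

(** Differentiability as continuity of the slope at 0: the vector case then reduces to coordinates
    through [continuous_rV]. *)
Lemma slope_cvg (V : normedModType R[i]) (F : R[i] -> V) z (l : V) :
  is_derive z (1 : R[i]) F l <->
  {for 0, continuous (fun h : R[i] => if h == 0 then l else h^-1 *: (F (h + z) - F z))}.
Proof.
set S := (X in {for _, continuous X}).
have SE : \forall h \near (0 : R[i])^', S h = h^-1 *: (F (h *: (1 : R[i]) + z) - F z).
  near=> h; rewrite /S ifF; first by rewrite /GRing.scale/= mulr1.
  by apply/negbTE; near: h; exact: nbhs_dnbhs_neq.
have S0 : S 0 = l by rewrite /S eqxx.
rewrite continuous_withinNx S0; split.
  move=> [dF Fl]; apply: (cvg_trans (near_eq_cvg (filterS (fun h => esym) SE))).
  by rewrite -Fl; exact: dF.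
move=> H; have H' : h^-1 *: (F (h *: (1 : R[i]) + z) - F z) @[h --> 0^'] --> l.
  exact: (cvg_trans (near_eq_cvg SE) H).
split; last by apply: cvg_lim H'; exact: norm_hausdorff.
by apply/cvg_ex; exists l.
Unshelve. all: by end_near. Qed.

Let etrans_cont (f g : R[i] -> R[i]) z : (forall h, f h = g h) ->
  {for z, continuous f} -> {for z, continuous g}.
Proof. by move=> /funext ->. Qed.

Lemma rv_derive F z L : is_derive z (1 : R[i]) F L <->
  forall j, cdiff (fun w => F w 0 j) z (L 0 j).
Proof.
rewrite slope_cvg -continuous_rV; split=> H j.
  by apply/cdiffP/slope_cvg; apply: etrans_cont (H j) => h; case: eqP => // _; rewrite !mxE.
by have /slope_cvg := (cdiffP _ _ _).2 (H j); apply: etrans_cont => h; case: eqP => // _; rewrite !mxE.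
Qed.

Lemma derive1_rV F z L : (forall j, cdiff (fun w => F w 0 j) z (L 0 j)) -> derive1 F z = L.
Proof. by move=> /rv_derive D; rewrite derive1E; have [_ ->] := D. Qed.

Lemma derivable_rV F z : derivable F z 1 -> forall j, cdiff (fun w => F w 0 j) z (derive1 F z 0 j).
Proof. by move=> dF; apply/rv_derive; rewrite derive1E; exact: derivableP. Qed.

Lemma derivable_rV_holo F c (r : R) : (forall z, normc (z - c) < r -> derivable F z 1) ->
  forall j, holo (fun z => F z 0 j) c r.
Proof. by move=> dF j z /dF/derivable_rV/(_ j) D; eexists; exact: D. Qed.

Lemma cdiff_derivable_rV F z : (forall j, exists l, cdiff (fun w => F w 0 j) z l) -> derivable F z 1.
Proof.
move=> /choice[l Hl]; have /rv_derive D : forall j, cdiff (fun w => F w 0 j) z ((\row_j l j) 0 j).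
  by move=> j; rewrite mxE.
exact: ex_derive.
Qed.

End vector_derivative.

Section complex_valued.
Variable R : realType.
Implicit Types (F G : R[i] -> R[i]) (z w c : R[i]).

Lemma ReNC z : complex.Re (Num.conj z) = complex.Re z. Proof. by case: z. Qed.
Lemma ImNC z : complex.Im (Num.conj z) = - complex.Im z. Proof. by case: z. Qed.

Lemma mulCconj z : z * Num.conj z = (normc z ^+ 2)%:C.
Proof. by rewrite sqr_normc; apply: eqC; rewrite !ReImE ReNC ImNC/=; ring. Qed.

Definition pCc k c r F := pC k c r (fun z => complex.Re (F z)) /\ pC k c r (fun z => complex.Im (F z)).

Lemma pCcM k c r F G : pCc k c r F -> pCc k c r G -> pCc k c r (fun z => F z * G z).
Proof.
move=> [F1 F2] [G1 G2]; split.
  by apply: pC_ext (pCD (pCM F1 G1) (pCN (pCM F2 G2))) => z _; rewrite ReM.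
by apply: pC_ext (pCD (pCM F1 G2) (pCM F2 G1)) => z _; rewrite ImM.
Qed.

Lemma pCc_sum k c r (I : Type) (s : seq I) (F : I -> R[i] -> R[i]) : (forall i, pCc k c r (F i)) ->
  pCc k c r (fun z => \sum_(i <- s) F i z).
Proof.
move=> H; elim: s => [|i s [H1 H2]].
  by split; apply: pC_ext (pC_const k c r 0) => z _; rewrite big_nil.
have [F1 F2] := H i; split.
  by apply: pC_ext (pCD F1 H1) => z _; rewrite big_cons ReD.
by apply: pC_ext (pCD F2 H2) => z _; rewrite big_cons ImD.
Qed.

Lemma pCc_conj k c r F : pCc k c r F -> pCc k c r (fun z => Num.conj (F z)).
Proof.
move=> [F1 F2]; split; first by apply: pC_ext F1 => z _; rewrite ReNC.
by apply: pC_ext (pCN F2) => z _; rewrite ImNC.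
Qed.

Lemma zero_cdiff_const F c r z : (forall w, normc (w - c) < r -> cdiff F w 0) ->
  normc (z - c) < r -> F z = F c.
Proof.
move=> dF zr; pose g (t : R) : R[i] := c + ((sin t ^+ 2)%:C) * (z - c).
have gr t : normc (g t - c) < r.
  rewrite /g addrAC subrr add0r normcZr ger0_norm ?sqr_ge0//.
  apply: le_lt_trans zr; rewrite -[leRHS]mul1r ler_wpM2r ?normc_ge0//.
have dg t : pder (fun s => F (g s)) t 0.
  have D := pderD (pderC c t) (pderM (pder_real (is_derive_sin2 t)) (pderC (z - c) t)).
  by have := @pder_comp R F g t _ _ (dF _ (gr t)) D; rewrite mul0r.
have := pder_const 0 (pi / 2) dg; rewrite /g sin0 sin_pihalf !expr2 mul0r mul1r.
by rewrite rmorph0 rmorph1 mul0r mul1r addr0 addrC subrK.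
Qed.

Lemma near_cont_neq0 F c : {for c, continuous F} -> F c != 0 -> exists2 d : R, 0 < d &
  forall z, normc (z - c) < d -> F z != 0.
Proof.
move=> /continuousCCP cF Fc; have /cF[d d0 Hd] : 0 < normc (F c) by rewrite normc_gt0.
by exists d => // z /Hd; apply: contraTneq => ->; rewrite sub0r -[- _]sub0r normcBC subr0 ltxx.
Qed.

Lemma disc_open (rho : \bar R) : open (disc rho).
Proof.
rewrite openE => z /= zr; apply/nearCP.
move: rho zr => [rho||]//=; rewrite /disc/=.
- rewrite lte_fin => zr; exists (rho - normc z) => [|w]; first by rewrite subr_gt0.
  by have := normc_ge_sub w z; rewrite lte_fin; lra.
- by move=> _; exists 1 => // w _; rewrite ltry.
Qed.

Lemma disc_segment (rho : \bar R) z w (t : R) : disc rho z -> disc rho w ->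
  disc rho (z + ((sin t ^+ 2)%:C) * (w - z)).
Proof.
rewrite /disc/= => zr wr; apply: (@le_lt_trans _ _ (Num.max (normc z) (normc w))%:E); last first.
  by rewrite maxEle; case: ifP.
rewrite lee_fin; set s := sin t ^+ 2.
have s0 : 0 <= s by exact: sqr_ge0.
have s1 : s <= 1 by rewrite -(cos2Dsin2 t) lerDr sqr_ge0.
have -> : z + s%:C * (w - z) = (1 - s)%:C * z - (- s)%:C * w.
  by apply: eqC; rewrite !ReImE/=; ring.
apply: le_trans (normc_triB _ _) _; rewrite !normcZr normrN !ger0_norm ?subr_ge0//.
have m1 : normc z <= Num.max (normc z) (normc w) by rewrite le_max lexx.
have m2 : normc w <= Num.max (normc z) (normc w) by rewrite le_max lexx orbT.
have -> : Num.max (normc z) (normc w) = (1 - s) * Num.max (normc z) (normc w) + s * Num.max (normc z) (normc w) by ring.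
by apply: lerD; rewrite ler_wpM2l// subr_ge0.
Qed.

End complex_valued.

Section holomorphic_curve.
Variables (R : realType) (V : topologicalType) (n : nat) (M : complex_atlas R V n).
Variables (D : set R[i]) (f : R[i] -> V).
Hypothesis oD : open D.
Hypothesis holf : holomorphic_on M D f.
Implicit Types (z w : R[i]) (i : chart_index M).

Lemma chart_nbhd i z : D z -> chart_dom M i (f z) -> exists2 r : R, 0 < r &
  forall w, normc (w - z) < r -> D w /\ chart_dom M i (f w).
Proof.
move=> Dz iz; have [cf _] := holf Dz.
have H1 : \forall w \near z, D w by exact: open_nbhs_nbhs.
have H2 : \forall w \near z, chart_dom M i (f w).
  by apply: cf; apply: open_nbhs_nbhs; split=> //; exact: chart_dom_open.
by apply/(nearCP z (fun w => D w /\ chart_dom M i (f w))); apply: filterS2 H1 H2 => w.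
Qed.

Lemma chart_holo i z (r : R) : (forall w, normc (w - z) < r -> D w /\ chart_dom M i (f w)) ->
  forall j, holo (fun w => chart M i (f w) 0 j) z r.
Proof.
move=> H; apply: (@derivable_rV_holo R n (chart M i \o f)) => w /H[Dw iw].
by have [_] := holf Dw; exact.
Qed.

Variable omega : positive_form M.

Definition herm i p (v : 'rV[R[i]]_n) : R[i] := (v *m form_coef omega i (chart M i p) *m v^t*%sesqui) 0 0.

(** [pullback] changes the chart with the point; this allows a single chart on a neighbourhood. The
    Jacobian of the transition map is absorbed by [form_compatible]. *)
Lemma pullback_chart i z : D z -> chart_dom M i (f z) ->
  pullback omega f z = complex.Re (herm i (f z) (derive1 (chart M i \o f) z)).
Proof.
move=> Dz iz; set i' := chart_at M (f z).
transitivity (complex.Re (herm i' (f z) (derive1 (chart M i' \o f) z))); first by [].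
apply: congr1; have i'z : chart_dom M i' (f z) by exact: mem_chart_at.
pose Phi := chart M i' \o chart_inv M i.
have dPhi : differentiable Phi (chart M i (f z)) by exact: transition_holomorphic.
have dF : differentiable (chart M i \o f) z.
  by apply/derivable1_diffP; have [_] := holf Dz; exact.
have E : derive1 (chart M i' \o f) z = derive1 (chart M i \o f) z *m 'J Phi (chart M i (f z)).
  have -> : derive1 (chart M i' \o f) z = derive1 (Phi \o (chart M i \o f)) z.
    rewrite !derive1E; apply: near_eq_derive.
    have [r r0 H] := chart_nbhd Dz iz; apply/nearCP; exists r => // w /H[_ iw].
    by rewrite /Phi/= chartK.
  rewrite !derive1E (deriveE _ (differentiable_comp dF dPhi)) diff_comp//=.
  by rewrite -(deriveE _ dF) -(deriveE _ dPhi) deriveEjacobian.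
rewrite /herm (form_compatible omega iz i'z) -/Phi E.
by rewrite trmx_mul map_mxM !mulmxA.
Qed.

Lemma chart_const_on_disc i z (r : R) (F1 : 'I_n -> R[i] -> R[i]) :
  (forall w, normc (w - z) < r -> D w /\ chart_dom M i (f w)) ->
  (forall j w, normc (w - z) < r -> cdiff (fun w => chart M i (f w) 0 j) w (F1 j w)) ->
  (forall j w, normc (w - z) < r -> F1 j w = 0) ->
  forall w, normc (w - z) < r -> f w = f z.
Proof.
move=> H dF F0 w wr; have r0 := le_lt_trans (normc_ge0 _) wr.
have [_ iw] := H w wr; have [_ iz] := H z ltac:(by rewrite subrr normc0).
rewrite -(chartK iw) -(chartK iz); congr chart_inv; apply/rowP => j.
apply: (@zero_cdiff_const R (fun w => chart M i (f w) 0 j) z r w) => // v vr.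
by rewrite -(F0 j v vr); exact: dF.
Qed.

Definition eventually_const (p : V) w := exists2 d : R, 0 < d & forall z, normc (z - w) < d -> f z = p.

(* The zeros of f' in a chart are isolated unless f' vanishes identically nearby. *)
Lemma eventually_const_spread p w : D w -> exists2 d : R, 0 < d &
  forall w1 w2, normc (w1 - w) < d -> normc (w2 - w) < d -> eventually_const p w1 -> eventually_const p w2.
Proof.
move=> Dw; set i := chart_at M (f w); have iw : chart_dom M i (f w) by exact: mem_chart_at.
have [r r0 H] := chart_nbhd Dw iw.
have /choice[F1 HF1] : forall j, exists F1, (forall z, normc (z - w) < r ->
    cdiff (fun w => chart M i (f w) 0 j) z (F1 z)) /\ holo F1 w r.
  by move=> j; have [F1 ? ?] := holo_regular (chart_holo H j); exists F1.
have dF1 j := (HF1 j).1; have hF1 j := (HF1 j).2.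
case: (holo_order r0 hF1) => [Z|[m [G [hG [j Gj] FG]]]].
  have r4 : 0 < r / 4 by rewrite divr_gt0.
  have rr : r / 4 < r by lra.
  have K : forall z, normc (z - w) < r / 4 -> f z = f w.
    apply: (@chart_const_on_disc i w (r / 4) F1) => //.
      by move=> v vr; apply: H; exact: lt_trans rr.
    by move=> k v vr; apply: dF1; exact: lt_trans rr.
  exists (r / 4) => // w1 w2 h1 h2 [e e0 He].
  have fw : f w = p by rewrite -(K _ h1) He// subrr normc0.
  by rewrite -fw; exact: disc_near K h2.
have ww : normc (w - w) < r by rewrite subrr normc0.
have [d d0 Hd] := near_cont_neq0 (holo_cont (hG j) ww) Gj.
(* In this case no point near w is eventually constant, so the implication is vacuous. The auxiliary
   point v is taken different from w to keep (v - w)^m nonzero. *)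
exists (Num.min d r) => [|w1 w2]; first by rewrite lt_min d0.
rewrite lt_min => /andP[h1d h1r] _ [e e0 He]; exfalso.
pose e1 := Num.min e (Num.min (d - normc (w1 - w)) (r - normc (w1 - w))).
have e10 : 0 < e1 by rewrite !lt_min e0 !subr_gt0 h1d.
have [v ve vw] : exists2 v, normc (v - w1) < e1 & v != w.
  have [->|w1w] := eqVneq w1 w; last by exists w1; rewrite ?subrr ?normc0.
  exists (w + (e1 / 2)%:C); rewrite ?[w + _ - w]addrAC ?subrr ?add0r ?normc_real.
    by rewrite gtr0_norm; lra.
  by rewrite -subr_eq0 addrAC subrr add0r -normc_eq0 normc_real gt_eqF// normr_gt0 gt_eqF// divr_gt0.
move: ve; rewrite !lt_min => /and3P[ve vd vr].
have vd' : normc (v - w) < d by exact: disc_sub vd.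
have vr' : normc (v - w) < r by exact: disc_sub vr.
have F0 : F1 j v = 0.
  apply: (cdiff_unique (dF1 j v vr')); apply: cdiff_near (cdiffC (chart M i p 0 j) v).
  have [d' d'0 Hd'] := disc_near He ve.
  by exists d' => // u /Hd' ->.
have := FG j v vr'; rewrite F0 => /esym/eqP; rewrite mulf_eq0 expf_eq0 subr_eq0 (negbTE vw) andbF/=.
by rewrite (negbTE (Hd v vd')).
Qed.

End holomorphic_curve.

(** * Ramification and the local form of the pullback *)

Section nondegenerate.
Variables (R : realType) (V : topologicalType) (n : nat) (M : complex_atlas R V n).
Variables (rho : \bar R) (f : R[i] -> V).
Hypothesis holf : holomorphic_on M (disc rho) f.
Hypothesis nonconstant : exists z w, [/\ disc rho z, disc rho w & f z <> f w].
Implicit Types (z w : R[i]).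

(* Along a path the indicator of being eventually constant has derivative zero, hence is constant. *)
Lemma not_eventually_const p z : disc rho z -> ~ eventually_const f p z.
Proof.
move=> Dz Ez; suff K w : disc rho w -> f w = p.
  by have [x [y [Dx Dy]]] := nonconstant; rewrite (K x Dx) (K y Dy).
move=> Dw; pose g (t : R) : R[i] := z + ((sin t ^+ 2)%:C) * (w - z).
have Dg t : disc rho (g t) by exact: disc_segment.
pose chi (t : R) : R := `[< eventually_const f p (g t) >]%:R.
have dchi (t : R) : is_derive t 1 chi 0.
  have [d d0 Hd] := eventually_const_spread (@disc_open R rho) holf p (Dg t).
  have cg : {for t, continuous g}.
    have D := pderD (pderC z t) (pderM (pder_real (is_derive_sin2 t)) (pderC (w - z) t)).
    exact: pder_cont D.
  have gtt : normc (g t - g t) < d by rewrite subrr normc0.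
  apply: is_derive_near (dC (chi t) t).
  have /nbhs_ballP[e /= e0 He] := (continuousCP _ _).1 cg d d0.
  exists e => // s st; have gst : normc (g s - g t) < d by apply: He; rewrite /= -ball_normE/= distrC.
  rewrite /chi; congr (_%:R); congr nat_of_bool.
  by apply/asboolP/asboolP; exact: Hd.
have := zero_derive_const 0 (pi / 2) dchi; rewrite /chi.
have -> : g 0 = z by rewrite /g sin0 expr2 mul0r rmorph0 mul0r addr0.
have -> : g (pi / 2) = w by rewrite /g sin_pihalf expr2 mul1r rmorph1 mul1r addrC subrK.
rewrite (asboolT Ez); case: asboolP => [[d d0 Hd] _|_ /eqP]; last by rewrite oner_eq0.
by apply: Hd; rewrite subrr normc0.
Qed.

(** If all coordinates of f' vanished near z, f would be constant there, against
    [not_eventually_const]. Hence an order exists and [xget] selects one instead of its default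
    value. *)
Lemma has_zero_order_ram_mult z : disc rho z ->
  has_zero_order (fun w => derive1 (local_rep M f z) w) z (ram_mult M f z).
Proof.
move=> Dz; rewrite /ram_mult; apply: xgetPex.
set i := chart_at M (f z); have iz : chart_dom M i (f z) by exact: mem_chart_at.
have [r r0 H] := chart_nbhd (@disc_open R rho) holf Dz iz.
have /choice[F1 HF1] : forall j, exists F1, (forall w, normc (w - z) < r ->
    cdiff (fun w => chart M i (f w) 0 j) w (F1 w)) /\ holo F1 z r.
  by move=> j; have [F1 ? ?] := holo_regular (chart_holo holf H j); exists F1.
have dF1 j := (HF1 j).1; have hF1 j := (HF1 j).2.
have DE w : normc (w - z) < r -> derive1 (local_rep M f z) w = \row_j F1 j w.
  by move=> wr; apply: derive1_rV => j; rewrite mxE; exact: dF1.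
case: (holo_order r0 hF1) => [Z|[m [G [hG [j Gj] FG]]]].
  exfalso; apply: (not_eventually_const Dz (p := f z)).
  have rr : r / 4 < r by lra.
  exists (r / 4); first by rewrite divr_gt0.
  apply: (@chart_const_on_disc R V n M (disc rho) f i z (r / 4) F1) => //.
    by move=> v vr; apply: H; exact: lt_trans rr.
  by move=> k v vr; apply: dF1; exact: lt_trans rr.
exists m, (fun w => \row_j G j w); split.
- apply/nearCP; exists r => // w wr; apply: cdiff_derivable_rV => k.
  have [l Hl] := hG k w wr; exists l; apply: cdiff_near Hl.
  by exists 1 => // v _; rewrite mxE.
- by apply: contra Gj => /eqP/rowP/(_ j); rewrite !mxE => ->.
- apply/nearCP; exists r => // w wr; rewrite DE//.
  by apply/rowP => k; rewrite !mxE; exact: FG.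
Qed.

Variable omega : positive_form M.
Notation a := (pullback omega f).

Lemma hermZ i p (x : R[i]) v : herm omega i p (x *: v) = (normc x ^+ 2)%:C * herm omega i p v.
Proof.
rewrite /herm linearZ/= map_mxZ -scalemxAr -!scalemxAl scalerA !mxE/=.
by rewrite -mulCconj [_ * x]mulrC.
Qed.

(** If f' = (w - z)^m G in a chart, the hermitian form takes the value |w - z|^(2 m) h(G, G), where
    h(G, G) is smooth and positive near z because G(z) is nonzero. In the analysis that follows, the
    manifold is represented by a, m and g alone. *)
Lemma pullback_local z : disc rho z -> exists2 r : R, 0 < r & exists g : R[i] -> R,
  (forall k, pC k z r g) /\ forall w, normc (w - z) < r ->
    [/\ disc rho w, 0 < g w & a w = (normc (w - z) ^+ 2) ^+ (ram_mult M f z) * g w].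
Proof.
move=> Dz; have [G [dG Gz FG]] := has_zero_order_ram_mult Dz.
set m := ram_mult M f z in FG *.
set i := chart_at M (f z); have iz : chart_dom M i (f z) by exact: mem_chart_at.
have [r1 r10 H1] := chart_nbhd (@disc_open R rho) holf Dz iz.
have [r2 r20 H2] := (nearCP z _).1 (filterI dG FG).
have [j Gj] : exists j, G z 0 j != 0.
  apply/existsP; apply: contraNT Gz; rewrite negb_exists => /forallP h.
  by apply/eqP/rowP => j; rewrite mxE; apply/eqP; rewrite -[_ == _]negbK.
have hG := derivable_rV_holo (fun w wr => (H2 w wr).1).
have zz : normc (z - z) < r2 by rewrite subrr normc0.
have [r3 r30 H3] := near_cont_neq0 (holo_cont (hG j) zz) Gj.
pose r := Num.min r1 (Num.min r2 r3).
have r0 : 0 < r by rewrite !lt_min r10 r20.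
have rr1 : r <= r1 by rewrite ge_min lexx.
have rr2 : r <= r2 by rewrite !ge_min lexx orbT.
have rr3 : r <= r3 by rewrite !ge_min lexx !orbT.
exists r => //; exists (fun w => complex.Re (herm omega i (f w) (G w))); split.
  move=> k.
  have hF : forall j, holo (fun w => chart M i (f w) 0 j) z r.
    by apply: (chart_holo holf) => w wr; apply: H1; exact: lt_le_trans rr1.
  have pG q : pCc k z r (fun w => G w 0 q).
    by apply: pC_holo => w wr; apply: hG; exact: lt_le_trans rr2.
  have im w : normc (w - z) < r -> (chart M i @` chart_dom M i) (chart M i (f w)).
    by move=> wr; exists (f w) => //; have [] := H1 w (lt_le_trans wr rr1).
  have pH q s : pCc k z r (fun w => form_coef omega i (chart M i (f w)) q s).
    have [s1 s2] := form_smooth omega i q s.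
    split.
      exact: (@pC_compose R n k _ (fun x => complex.Re (form_coef omega i x q s)) z r
        (fun w => chart M i (f w)) (@chart_image_open R V n M i) (s1 k) hF im).
    exact: (@pC_compose R n k _ (fun x => complex.Im (form_coef omega i x q s)) z r
        (fun w => chart M i (f w)) (@chart_image_open R V n M i) (s2 k) hF im).
  have [+ _] := pCc_sum (index_enum 'I_n) (fun q => pCcM (pCc_sum (index_enum 'I_n)
    (fun s => pCcM (pG s) (pH s q))) (pCc_conj (pG q))).
  apply: pC_ext => w _; rewrite /herm mxE; congr complex.Re.
  by apply: eq_bigr => q _; rewrite !mxE.
move=> w wr; have [Dw iw] := H1 w (lt_le_trans wr rr1).
have [_ FGw] := H2 w (lt_le_trans wr rr2).
split=> //.
  have Gw : G w != 0.
    apply: contra (H3 w (lt_le_trans wr rr3)) => /eqP ->.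
    by rewrite mxE.
  by have := form_positive omega iw Gw; rewrite -/(herm omega i (f w) (G w)) ltcE => /andP[].
rewrite (@pullback_chart R V n M (disc rho) f (@disc_open R rho) holf omega i w Dw iw).
have -> : derive1 (chart M i \o f) w = (w - z) ^+ m *: G w by exact: FGw.
by rewrite hermZ normcX ReM/= mul0r subr0 -exprM mulnC exprM.
Qed.

End nondegenerate.

(** * Jensen's formula with zeros *)

Section membership_sums.
Variables (R : realType) (I : eqType).
Implicit Types (s : seq I) (P : pred I) (F : I -> R[i] -> R) (c z : R[i]) (r : R).

Lemma pC_sum_mem k c r s P F : (forall i, i \in s -> P i -> pC k c r (F i)) ->
  pC k c r (fun w => \sum_(i <- s | P i) F i w).
Proof.
elim: s => [|i s IH] H; first by apply: pC_ext (pC_const k c r 0) => z _; rewrite big_nil.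
have {}IH := IH (fun j js => H j (mem_behead (s := i :: s) js)).
have [Pi|nPi] := boolP (P i); last by apply: pC_ext IH => z _; rewrite big_cons (negbTE nPi).
by apply: pC_ext (pCD (H i (mem_head i s) Pi) IH) => z _; rewrite big_cons Pi.
Qed.

Lemma is_lap_sum_mem z s P F : (forall i, i \in s -> P i -> is_lap (F i) z 0) ->
  is_lap (fun w => \sum_(i <- s | P i) F i w) z 0.
Proof.
elim: s => [|i s IH] H.
  by apply: is_lap_near (is_lapC 0 z); exists 1 => // w _; rewrite big_nil.
have {}IH := IH (fun j js => H j (mem_behead (s := i :: s) js)).
have [Pi|nPi] := boolP (P i); last first.
  by apply: is_lap_near IH; exists 1 => // w _; rewrite big_cons (negbTE nPi).
have := is_lapD (H i (mem_head i s) Pi) IH; rewrite addr0; apply: is_lap_near.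
by exists 1 => // w _; rewrite big_cons Pi.
Qed.

End membership_sums.

(** * Removing the zeros of the coefficient *)

Section divisor.
Variables (R : realType) (rho : \bar R) (a : R[i] -> R) (m : R[i] -> nat) (lambda : R).
Variables (d : R[i] -> R) (g : R[i] -> R[i] -> R).
Hypothesis loc : forall z, disc rho z -> [/\ 0 < d z, forall k, pC k z (d z) (g z) &
  forall w, normc (w - z) < d z ->
    [/\ disc rho w, 0 < g z w & a w = (normc (w - z) ^+ 2) ^+ m z * g z w]].
Hypothesis lap : forall z L, disc rho z -> 0 < a z -> is_lap (fun w => ln (a w)) z L -> 4 * lambda * a z <= L.
Implicit Types (x z w : R[i]) (r s : R).

Lemma disc_real z r : (r%:E <= rho)%E -> normc z < r -> disc rho z.
Proof. by move=> rr zr; rewrite /disc/= (lt_le_trans _ rr)// lte_fin. Qed.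

Let self z : disc rho z -> normc (z - z) < d z.
Proof. by move=> /loc[d0 _ _]; rewrite subrr normc0. Qed.

Lemma coef_pC k r : (r%:E <= rho)%E -> pC k 0 r a.
Proof.
move=> rr; apply: pC_local => z; rewrite subr0 => zr; have Dz := disc_real rr zr.
have [d0 Hg Ha] := loc Dz; exists (d z) => //.
apply: pC_ext (pCM (pCX (m z) (pC_normc2 k z (d z) z)) (Hg k)) => w /Ha[_ _ ->] //.
Qed.

Lemma coef_ge0 z : disc rho z -> 0 <= a z.
Proof.
move=> Dz; have [_ _ /(_ z (self Dz))[_ g0 ->]] := loc Dz.
by rewrite mulr_ge0 ?(ltW g0)// exprn_ge0// sqr_ge0.
Qed.

Lemma coef_gt0 z : disc rho z -> (0 < a z) = (m z == 0%N).
Proof.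
move=> Dz; have [_ _ /(_ z (self Dz))[_ g0 ->]] := loc Dz.
rewrite pmulr_lgt0// subrr normc0 expr0n/=; case: (m z) => [|k]; first by rewrite expr0 ltr01.
by rewrite exprS mul0r ltxx.
Qed.

Lemma mult_isolated z w : disc rho z -> normc (w - z) < d z -> w != z -> m w = 0%N.
Proof.
move=> Dz wd wz; have [_ _ /(_ w wd)[Dw g0 aE]] := loc Dz.
apply/eqP; rewrite -(coef_gt0 Dw) aE mulr_gt0// exprn_gt0// exprn_gt0//.
by rewrite normc_gt0 subr_eq0.
Qed.

(** The disc of radius d z around z contains no zero other than possibly z, so all zeros are among
    the centres of a finite subcover. *)
Lemma zeros_finite r : (r%:E < rho)%E -> exists2 Z : seq R[i], uniq Z &
  forall z, (z \in Z) = (normc z <= r) && (0 < m z)%N.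
Proof.
move=> rr; have Dr z : normc z <= r -> disc rho z.
  by move=> zr; rewrite /disc/=; apply: le_lt_trans rr; rewrite lee_fin.
have := @compact_closed_disc R 0 r; rewrite compact_cover.
move=> /(_ _ [set z | normc z <= r] (fun z => [set w | normc (w - z) < d z])) [||D' D'D cov].
- move=> z _; rewrite openE => w /= wd; apply/nearCP.
  exists (d z - normc (w - z)) => [|v]; first by rewrite subr_gt0.
  exact: disc_sub.
- by move=> z /=; rewrite subr0 => zr; exists z => //=; exact/self/Dr.
exists [seq z <- finmap.enum_fset D' | (normc z <= r) && (0 < m z)%N]; first by rewrite filter_uniq// finmap.fset_uniq.
move=> z; rewrite mem_filter; have [/andP[zr mz]/=|//] := boolP ((normc z <= r) && (0 < m z)%N).
have zr0 : normc (z - 0) <= r by rewrite subr0.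
have [w /= wD' wz] := cov z zr0.
have Dw : disc rho w by apply: Dr; have := D'D _ wD'; rewrite inE.
by have [->//|zw] := eqVneq z w; rewrite (mult_isolated Dw wz zw) in mz.
Qed.

Section circle.
Variables (s s1 : R) (Z : seq R[i]).
Hypothesis s0 : 0 < s.
Hypothesis ss1 : s < s1.
Hypothesis s1r : (s1%:E <= rho)%E.
Hypothesis uZ : uniq Z.
Hypothesis Zs : forall x, x \in Z -> normc x < s.
Hypothesis Zm : forall x, normc x < s1 -> (0 < m x)%N = (x \in Z).
Hypothesis Zrefl : forall x, x \in Z -> s1 * normc x <= s ^+ 2.

Let D z : normc (z - 0) < s1 -> disc rho z.
Proof. by rewrite subr0; exact: disc_real. Qed.

(* The logarithm of |z - x|^2 on |z| = s extended harmonically to |z| < s by reflecting x in the circle. *)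
Definition reflected x z : R := if x == 0 then ln (s ^+ 2) else
  lnabs2 ((s ^+ 2 / normc x ^+ 2)%:C * x) z + ln (normc x ^+ 2 / s ^+ 2).

Let normc_refl x : x != 0 -> normc ((s ^+ 2 / normc x ^+ 2)%:C * x) = s ^+ 2 / normc x.
Proof.
rewrite -normc_gt0 => x0; rewrite normcZr ger0_norm ?divr_ge0 ?sqr_ge0//.
by rewrite [normc x ^+ 2]expr2 invfM mulrA divfK// gt_eqF.
Qed.

(** By [Zrefl] the reflected point, of modulus s^2 / |x|, lies outside |z| < s1, where the logarithm
    is therefore smooth. *)
Lemma pC_reflected k x : x \in Z -> pC k 0 s1 (reflected x).
Proof.
move=> xZ; have [->|x0] := eqVneq x 0.
  by apply: pC_ext (pC_const k 0 s1 (ln (s ^+ 2))) => z _; rewrite /reflected eqxx.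
have h : s1 <= normc ((s ^+ 2 / normc x ^+ 2)%:C * x - 0).
  by rewrite subr0 normc_refl// ler_pdivlMr ?normc_gt0// Zrefl.
apply: pC_ext (pCD (pC_lnabs2 k h) (pC_const k 0 s1 (ln (normc x ^+ 2 / s ^+ 2)))) => z _.
by rewrite /reflected (negbTE x0).
Qed.

Lemma is_lap_reflected x z : x \in Z -> normc z < s1 -> is_lap (reflected x) z 0.
Proof.
move=> xZ zs; have [->|x0] := eqVneq x 0.
  by apply: is_lap_near (is_lapC (ln (s ^+ 2)) z); exists 1 => // w _; rewrite /reflected eqxx.
have zx : z != (s ^+ 2 / normc x ^+ 2)%:C * x.
  apply: contraTneq zs => ->; rewrite -leNgt normc_refl//.
  by rewrite ler_pdivlMr ?normc_gt0// Zrefl.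
have := is_lapD (is_lap_lnabs2 zx) (is_lapC (ln (normc x ^+ 2 / s ^+ 2)) z).
by rewrite addr0; apply: is_lap_near; exists 1 => // w _; rewrite /reflected (negbTE x0).
Qed.

(** The added constant makes the value at 0 independent of x. Its difference from ln |x|^2 is twice
    ln (s / |x|), the contribution of x to the counting function. *)
Lemma reflected0 x : reflected x 0 = ln (s ^+ 2).
Proof.
rewrite /reflected; case: ifPn => // x0; rewrite /lnabs2 sub0r.
rewrite -[- _]sub0r normcBC subr0 normc_refl//.
have x1 : 0 < normc x by rewrite normc_gt0.
rewrite -lnM ?posrE ?exprn_gt0 ?divr_gt0 ?exprn_gt0//; congr ln.
by rewrite expr_div_n; field; rewrite !gt_eqF.
Qed.

(** On |z| = s one has |z - x| = (|x| / s) |z - x'|, with x' the reflection of x; the proof expands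
    the squares. *)
Lemma reflected_circle x z : normc z = s -> x \in Z -> reflected x z = lnabs2 x z.
Proof.
move=> zs xZ; rewrite /reflected; case: eqP => [->|/eqP x0]; first by rewrite /lnabs2 subr0 zs.
have x1 : 0 < normc x by rewrite normc_gt0.
rewrite /lnabs2 -lnM ?posrE ?exprn_gt0 ?divr_gt0 ?exprn_gt0//; last first.
  rewrite normc_gt0 subr_eq0; apply: contra_eqN zs => /eqP ->.
  rewrite normc_refl// gt_eqF// ltr_pdivlMr// expr2 ltr_pM2l//; exact: Zs.
congr ln; have q0 := exprn_gt0 2 x1; rewrite !sqr_normc !ReImE/=.
have := sqr_normc x; have := sqr_normc z; rewrite zs.
set q := normc x ^+ 2 in q0 *; set S := s ^+ 2 => SE qE.
have S0 : 0 < S by rewrite exprn_gt0.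
set u1 := complex.Re z in SE *; set v1 := complex.Im z in SE *.
set u2 := complex.Re x in qE *; set v2 := complex.Im x in qE *.
transitivity ((u1 ^+ 2 + v1 ^+ 2) * q / S - 2 * (u1 * u2 + v1 * v2) + (u2 ^+ 2 + v2 ^+ 2) * S / q).
  by rewrite -[in LHS]qE; field; rewrite !gt_eqF.
rewrite -SE -qE [S * q]mulrC !mulfK ?gt_eqF// [q * S]mulrC mulfK ?gt_eqF// SE qE; ring.
Qed.

Let k z := \sum_(x <- Z) (m x)%:R * reflected x z.
(* Since ln 0 = 0, at a zero z only the factor g z z is missing from the sum of logarithms. *)
Let u z := ln (a z) + (if z \in Z then ln (g z z) else 0)
  - \sum_(x <- Z) (m x)%:R * lnabs2 x z + k z.

(** Around any z of the larger disc, zero or not, u is ln (g z) plus harmonic terms: the logarithm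
    of |w - z|^2 contained in ln a cancels the one in the sum. Smoothness of u across the zeros
    follows. *)
Let u_local z w : normc (z - 0) < s1 -> normc (w - z) < d z ->
  u w = ln (g z w) - \sum_(x <- Z | x != z) (m x)%:R * lnabs2 x w + k w.
Proof.
move=> zs wd; have Dz := D zs; have [_ _ /(_ w wd)[Dw g0 aE]] := loc Dz.
rewrite /u; congr (_ + _).
have [zZ|zZ] := boolP (z \in Z); last first.
  have mz : m z = 0%N.
    by apply/eqP; rewrite -leqn0 leqNgt Zm//; move: zs; rewrite subr0.
  have wZ : w \notin Z.
    have [->//|wz] := eqVneq w z; apply: contraTN isT => wZ.
    have ws : normc w < s1 by apply: lt_trans ss1; exact: Zs.
    by move: wZ; rewrite -Zm// (mult_isolated Dz wd wz).
  rewrite (negbTE wZ) addr0 aE mz expr0 mul1r; congr (_ - _).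
  rewrite [RHS]big_seq_cond [LHS]big_seq; apply: eq_bigl => x.
  by case: (boolP (x \in Z)) => //= xZ; apply/esym; apply: contraNneq zZ => <-.
rewrite (bigD1_seq z)//=.
have mz : (0 < m z)%N by move: zs; rewrite subr0 => /Zm ->.
have [->|wz] := eqVneq w z.
  have -> : a z = 0.
    have [_ _ /(_ z (self Dz))[_ _ ->]] := loc Dz.
    by rewrite subrr normc0 expr0n/= expr0n gtn_eqF// mul0r.
  have -> : lnabs2 z z = 0 by rewrite /lnabs2 subrr normc0 expr0n ln0.
  by rewrite (ln0 (lexx 0)) add0r zZ mulr0 add0r.
have wZ : w \notin Z.
  apply: contraTN isT => wZ; have ws : normc w < s1 by apply: lt_trans ss1; exact: Zs.
  by move: wZ; rewrite -Zm// (mult_isolated Dz wd wz).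
have n0 : 0 < normc (w - z) ^+ 2 by rewrite exprn_gt0// normc_gt0 subr_eq0.
have lnE : ln ((normc (w - z) ^+ 2) ^+ m z * g z w) = (m z)%:R * lnabs2 z w + ln (g z w).
  have p1 : (normc (w - z) ^+ 2) ^+ m z \in Num.pos by rewrite posrE exprn_gt0.
  have p2 : g z w \in Num.pos by rewrite posrE.
  by rewrite (lnM p1 p2) (lnXn (m z) n0) /lnabs2 mulr_natl.
by rewrite (negbTE wZ) addr0 aE lnE; ring.
Qed.

Let sum_local z : normc (z - 0) < s1 -> forall x, x \in Z -> x != z -> d z <= normc (x - z).
Proof.
move=> zs x xZ xz; rewrite leNgt; apply/negP => xd.
have xs : normc x < s1 by apply: lt_trans ss1; exact: Zs.
by have := mult_isolated (D zs) xd xz; apply/eqP; rewrite -lt0n Zm.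
Qed.

Let harm z w := - \sum_(x <- Z | x != z) (m x)%:R * lnabs2 x w + k w.

Let small z := Num.min (d z) (s1 - normc (z - 0)).

Let small_gt0 z : normc (z - 0) < s1 -> 0 < small z.
Proof. by move=> zs; have [d0 _ _] := loc (D zs); rewrite lt_min d0 subr_gt0. Qed.

Let pC_harm K z : normc (z - 0) < s1 -> pC K z (small z) (harm z).
Proof.
move=> zs; apply: pCD.
  apply: pCN; apply: pC_sum_mem => x xZ xz; apply: pCM; first exact: pC_const.
  by apply: pC_lnabs2; rewrite ge_min (sum_local zs xZ xz).
have H : pC K 0 s1 k.
  by apply: pC_sum_mem => x xZ _; apply: pCM; [exact: pC_const|exact: pC_reflected].
by apply: (pC_sub H); rewrite ge_min lexx orbT.
Qed.

Let is_lap_harm z : normc (z - 0) < s1 -> is_lap (harm z) z 0.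
Proof.
move=> zs; rewrite -[0]addr0; apply: is_lapD.
  have : is_lap (fun w => \sum_(x <- Z | x != z) (m x)%:R * lnabs2 x w) z 0.
    apply: is_lap_sum_mem => x xZ xz; rewrite -[0](mulr0 (m x)%:R); apply: is_lapZ.
    by apply: is_lap_lnabs2; rewrite eq_sym.
  by move/(is_lapZ (-1)); rewrite mulr0; apply: is_lap_near; exists 1 => // w _; rewrite mulN1r.
apply: is_lap_sum_mem => x xZ _; rewrite -[0](mulr0 (m x)%:R); apply: is_lapZ.
by apply: is_lap_reflected => //; move: zs; rewrite subr0.
Qed.

Let u_near z : normc (z - 0) < s1 -> forall w, normc (w - z) < small z ->
  ln (g z w) + harm z w = u w.
Proof.
move=> zs w; rewrite lt_min => /andP[wd _]; rewrite (u_local zs wd) /harm; ring.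
Qed.

Let pC_u : pC 2 0 s1 u.
Proof.
apply: pC_local => z zs; exists (small z); first exact: small_gt0.
have [d0 Hg Ha] := loc (D zs).
apply: (pC_ext (u_near zs)); apply: pCD; last exact: pC_harm.
apply: pC_ln => [w|]; first by rewrite lt_min => /andP[/Ha[]].
by apply: (pC_sub (Hg 2)); rewrite subrr normc0 subr0 ge_min lexx.
Qed.

Let lap_u z L : normc (z - 0) < s1 -> 0 < a z -> is_lap u z L -> 4 * lambda * a z <= L.
Proof.
move=> zs az HL; have Dz := D zs; have [d0 Hg Ha] := loc Dz.
have mz : m z = 0%N by apply/eqP; rewrite -coef_gt0.
have [ux [uy [uxx [uxy [uyx [uyy [_ _ _ _ HE]]]]]]] : exists ux uy uxx uxy uyx uyy : R[i] -> R, _ :=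
  pC_lap (pC_ln (fun w wd => let: And3 _ g0 _ := Ha w wd in g0) (Hg 2)).
have := HE z (self Dz); set L' := _ + _ => HL'.
apply: (lap Dz az); rewrite (is_lap_unique HL (_ : is_lap u z (L' + 0))).
  rewrite addr0; apply: is_lap_near HL'; exists (d z) => // w /Ha[_ _ ->].
  by rewrite mz expr0 mul1r.
apply: is_lap_near (is_lapD HL' (is_lap_harm zs)).
by exists (small z); [exact: small_gt0|exact: u_near].
Qed.

(** The curvature bound is available off the zeros only; as these are isolated, continuity extends
    it to them. *)
Let punctured_ge0 (q : R[i] -> R) z : {for z, continuous q} ->
  (exists2 e : R, 0 < e & forall w, normc (w - z) < e -> w != z -> 0 <= q w) -> 0 <= q z.
Proof.
move=> /continuous_fromC cq [e e0 He]; rewrite leNgt; apply/negP => qz.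
have [|d' d'0 Hd'] := cq (- q z); first by rewrite oppr_gt0.
pose t := Num.min e d' / 2.
have t0 : 0 < t by rewrite divr_gt0// lt_min e0.
have tw : normc (z + t%:C - z) = t by rewrite addrAC subrr add0r normc_real gtr0_norm.
have te : t < e by apply: (@lt_le_trans _ _ (Num.min e d')); [rewrite /t in t0 *; lra|rewrite ge_min lexx].
have td : t < d' by apply: (@lt_le_trans _ _ (Num.min e d')); [rewrite /t in t0 *; lra|rewrite ge_min lexx orbT].
have := He (z + t%:C); rewrite tw => /(_ te) He'.
have := Hd' (z + t%:C); rewrite tw => /(_ td); rewrite ltr_norml => /andP[_ qlt].
have : 0 <= q (z + t%:C).
  by apply: He'; rewrite -subr_eq0 -normc_eq0 tw gt_eqF.
by lra.
Qed.

(** This is [green_jensen] for u. On |z| = s the two sums cancel and u is ln a. At 0, u is ln (g 0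
    0) plus twice the sum of m(x) ln (s / |x|) over x != 0 plus twice m(0) ln s. *)
Lemma jensen_circle :
  2 * pi * ln (g 0 0) + 4 * pi * (\sum_(x <- Z | x != 0) (m x)%:R * ln (s / normc x) + (m 0)%:R * ln s) +
  4 * pi * lambda * characteristic (disc_integral a) s <= Int th0 th1 (fun t => ln (a (sp s t))).
Proof.
have [ux [uy [uxx [uxy [uyx [uyy [[Hx Hy Hxx Hxy [Hyx Hyy]] du dux duy HL]]]]]]] := pC_lap pC_u.
have D' z : normc z < s1 -> normc (z - 0) < s1 by rewrite subr0.
have Ha := coef_pC 3 s1r.
have a0 z : normc z < s1 -> 0 <= a z by move=> zs; apply: coef_ge0; exact/D/D'.
have LL z : normc z < s1 -> 4 * lambda * a z <= uxx z + uyy z.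
  move=> /D' zs; rewrite -subr_ge0.
  apply: (@punctured_ge0 (fun w => uxx w + uyy w - 4 * lambda * a w)).
    apply: contB_at; first exact: (contD_at (pC_cont Hxx zs) (pC_cont Hyy zs)).
    exact: (contM_at (@contC R _ (4 * lambda) z) (pC_cont Ha zs)).
  exists (small z) => [|w]; first exact: small_gt0.
  rewrite lt_min => /andP[wd /disc_sub ws] wz; rewrite subr_ge0.
  by apply: lap_u (HL w ws) => //; rewrite coef_gt0 ?(mult_isolated (D zs) wd wz)//; exact: D.
have := green_jensen (k := 1) Ha a0 (pC0 pC_u) Hx Hy Hxx Hxy Hyx Hyy du dux duy LL s0 ss1.
have z0 : normc (0 - 0 : R[i]) < s1 by rewrite subrr normc0 (lt_trans s0).
have d0 : normc (0 - 0 : R[i]) < d 0 by exact: self (D z0).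
rewrite (u_local z0 d0) /k.
have -> : \sum_(x <- Z) (m x)%:R * reflected x 0 =
    \sum_(x <- Z | x != 0) (m x)%:R * ln (s ^+ 2) + (m 0)%:R * ln (s ^+ 2).
  under eq_bigr do rewrite reflected0.
  have [Z0|Z0] := boolP (0 \in Z); first by rewrite (bigD1_seq 0)//= addrC.
  have -> : m 0 = 0%N.
    apply/eqP; rewrite -leqn0 leqNgt Zm// normc0; exact: lt_trans ss1.
  rewrite mul0r addr0 big_seq [RHS]big_seq_cond; apply: eq_bigl => x.
  by case: (boolP (x \in Z)) => //= xZ; apply/esym; apply: contraNneq Z0 => <-.
have -> : \sum_(x <- Z | x != 0) (m x)%:R * ln (s ^+ 2) =
    2 * \sum_(x <- Z | x != 0) (m x)%:R * ln (s / normc x) +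
    \sum_(x <- Z | x != 0) (m x)%:R * lnabs2 x 0.
  rewrite mulr_sumr -big_split/=; apply: eq_bigr => x x0.
  have x1 : 0 < normc x by rewrite normc_gt0.
  have -> : lnabs2 x 0 = ln (normc x) *+ 2 by rewrite /lnabs2 normcBC subr0 (lnXn 2 x1).
  have p1 : s \in Num.pos by rewrite posrE.
  have p2 : normc x \in Num.pos by rewrite posrE.
  rewrite (ln_div p1 p2) (lnXn 2 s0) -[ln s *+ 2]mulr_natl -[ln (normc x) *+ 2]mulr_natl.
  by set A := ln s; set B := ln (normc x); ring.
have -> : Int th0 th1 (fun t => u (sp s t)) = Int th0 th1 (fun t => ln (a (sp s t))).
  apply: eq_Int => t _; rewrite /u /k.
  have ns : normc (sp s t) = s by rewrite normc_sp gtr0_norm.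
  have /negbTE -> : sp s t \notin Z.
    by apply/negP => /Zs; rewrite ns ltxx.
  rewrite addr0 -[RHS]addr0 -addrA; congr (_ + _); apply/eqP; rewrite addrC subr_eq0; apply/eqP.
  by rewrite big_seq [RHS]big_seq; apply: eq_bigr => x xZ; rewrite reflected_circle.
rewrite (lnXn 2 s0) -mulr_natl => J; apply: le_trans J.
by rewrite le_eqVlt; apply/orP; left; apply/eqP; ring.
Qed.

End circle.
End divisor.

(** * The counting function of the zeros *)

Section counting.
Variables (R : realType) (m : R[i] -> nat).
Notation mu := (@lebesgue_measure R).
Implicit Types (x z : R[i]) (Z : seq R[i]).

Definition counting Z (r : R) : R :=
  \sum_(x <- Z | x != 0) (m x)%:R * ln (r / normc x) + (m 0)%:R * ln r.

(** The share of the zero x in (n(t) - n(0)) / t. Values in the extended reals let nonnegativity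
    alone justify exchanging sum and integral. *)
Let G (r : R) x : R -> \bar R :=
  (fun t => ((m x)%:R / t)%:E) \_ `]normc x, +oo[.

Let G_cont x (t : R) : 0 < t -> {for t, continuous (fun t : R => (m x)%:R / t)}.
Proof.
move=> t0; apply: (contM_at (@contC R _ (m x)%:R t)).
exact: (is_derive_cont (is_derive_inv (lt0r_neq0 t0))).
Qed.

Let G_measurable (r : R) x : measurable_fun `]0, r[ (G r x).
Proof.
apply/measurable_restrict => //; apply/measurable_EFinP.
have -> : `]0, r[ `&` `]normc x, +oo[ = `]normc x, r[%classic.
  apply/seteqP; split=> t /=; rewrite !in_itv/= ?andbT; first by move=> [/andP[_ ->] ->].
  by move=> /andP[h1 ->]; rewrite h1 (le_lt_trans (normc_ge0 x) h1).
apply: open_continuous_measurable_fun; first exact: interval_open.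
move=> t; rewrite inE/= in_itv/= => /andP[h1 _]; apply: G_cont.
exact: le_lt_trans (normc_ge0 x) h1.
Qed.

Let G_ge0 (r : R) x (t : R) : 0 < t -> (0 <= G r x t)%E.
Proof.
move=> t0; rewrite /G patchE; case: ifP => // _.
by rewrite lee_fin divr_ge0// ltW.
Qed.

Let G_integral (r : R) x : x != 0 -> normc x < r ->
  integral mu `]0, r[ (G r x) = ((m x)%:R * ln (r / normc x))%:E.
Proof.
move=> x0 xr; have x1 : 0 < normc x by rewrite normc_gt0.
rewrite -integral_mkcondr.
have -> : `]0, r[ `&` `]normc x, +oo[ = `]normc x, r[%classic.
  apply/seteqP; split=> t /=; rewrite !in_itv/= ?andbT; first by move=> [/andP[_ ->] ->].
  by move=> /andP[h1 ->]; rewrite h1 (lt_trans x1 h1).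
have mf : measurable_fun `]normc x, r[ (fun t : R => (m x)%:R / t).
  apply: open_continuous_measurable_fun; first exact: interval_open.
  move=> t; rewrite inE/= in_itv/= => /andP[h1 _]; apply: G_cont.
  exact: lt_trans x1 h1.
rewrite -(@integral_itv_bndoo R (normc x) r _ true false); last exact/measurable_EFinP.
pose F (t : R) := (m x)%:R * ln t.
have dF (t : R) : normc x <= t -> is_derive t 1 F ((m x)%:R / t).
  move=> xt; have t0 : 0 < t by exact: lt_le_trans xt.
  by have := dM (dC (m x)%:R t) (is_derive1_ln t0); rewrite mul0r add0r.
rewrite (@continuous_FTC2 R (fun t : R => (m x)%:R / t) F).
- have r0 := lt_trans x1 xr.
  have p1 : r \in Num.pos by rewrite posrE.
  have p2 : normc x \in Num.pos by rewrite posrE.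
  by rewrite -EFinB /F (ln_div p1 p2) mulrBr.
- exact: xr.
- apply: continuous_in_subspaceT => t; rewrite inE/= in_itv/= => /andP[h1 _]; apply: G_cont.
  exact: lt_le_trans x1 h1.
- split.
  + by move=> t; rewrite in_itv/= => /andP[/ltW/dF[]].
  + exact: (cvg_at_right_filter (is_derive_cont (dF _ (lexx (normc x))))).
  + exact: (cvg_at_left_filter (is_derive_cont (dF _ (ltW xr)))).
- by move=> t; rewrite in_itv/= => /andP[/ltW/dF[_ ht] _]; rewrite derive1E.
Qed.

(** Each zero x other than 0 contributes m(x) times the integral of 1 / t from |x| to r. *)
Lemma counting_integral Z (r : R) : 0 < r -> uniq Z ->
  (forall z, (z \in Z) = (normc z < r) && (0 < m z)%N) ->
  Rintegral mu `]0, r[ (fun t => (\sum_(z \in [set z | normc z < t]) ((m z)%:R : R) - (m 0)%:R) / t)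
  + (m 0)%:R * ln r = counting Z r.
Proof.
move=> r0 uZ ZE; rewrite /counting; congr (_ + _).
pose Z' := [seq x <- Z | x != 0].
have Z'r x : x \in Z' -> x != 0 /\ normc x < r.
  by rewrite mem_filter ZE => /andP[-> /andP[->]].
have SE (t : R) : 0 < t -> t < r ->
    (((\sum_(z \in [set z | normc z < t]) ((m z)%:R : R)) - (m 0)%:R) / t)%:E =
    (\sum_(x <- Z') G r x t)%E.
  move=> t0 tr; rewrite (@fsbigE _ _ _ _ _ [seq x <- Z | normc x < t]); first last.
  - move=> z /= zt; rewrite mem_filter zt/= ZE (lt_trans zt tr)/= -eqn0Ngt => /eqP -> //.
  - by move=> z /=; rewrite mem_filter => /andP[].
  - by rewrite filter_uniq.
  have -> : \sum_(i <- [seq x <- Z | normc x < t] | i \in [set z | normc z < t]) ((m i)%:R : R) =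
      \sum_(x <- Z | normc x < t) (m x)%:R.
    rewrite big_filter_cond; apply: eq_bigl => z.
    by rewrite andb_idr// => zt; rewrite inE.
  have -> : \sum_(x <- Z | normc x < t) ((m x)%:R : R) - (m 0)%:R =
      \sum_(x <- Z | (normc x < t) && (x != 0)) (m x)%:R.
    have [Z0|Z0] := boolP (0 \in Z).
      rewrite big_mkcond (bigD1_seq 0 Z0 uZ) normc0 t0 /= addrAC subrr add0r -big_mkcondr.
      by apply: eq_bigl => x; rewrite andbC.
    have -> : m 0 = 0%N.
      by apply/eqP; move: Z0; rewrite ZE normc0 r0/= -eqn0Ngt.
    rewrite subr0 big_seq_cond [RHS]big_seq_cond; apply: eq_bigl => x.
    by case: (boolP (x \in Z)) => //= xZ; rewrite andb_idr// => _; apply: contraNneq Z0 => <-.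
  rewrite mulr_suml -sumEFin big_filter; rewrite big_mkcondl/=.
  rewrite [RHS]big_mkcond/= [LHS]big_mkcond/=; apply: eq_bigr => x _.
  case: ifP => // _; rewrite /G patchE.
  by rewrite (_ : (t \in `]normc x, +oo[%classic) = (normc x < t))//; apply/idP/idP;
    rewrite inE/= in_itv/= andbT.
transitivity (fine (integral mu `]0, r[ (fun t => (\sum_(x <- Z') G r x t)%E))).
  by congr fine; apply: eq_integral => t; rewrite inE/= in_itv/= => /andP[t0 tr]; exact: SE.
rewrite ge0_integral_sum//; first last.
- by move=> x t /=; rewrite in_itv/= => /andP[t0 _]; exact: G_ge0.
- by move=> x; exact: G_measurable.
rewrite big_seq (eq_bigr (fun x => ((m x)%:R * ln (r / normc x))%:E)); last first.
  by move=> x /Z'r[x0 xr]; exact: G_integral.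
by rewrite -big_seq sumEFin/= big_filter.
Qed.

Lemma counting_cont Z (r : R) : 0 < r -> {for r, continuous (counting Z)}.
Proof.
move=> r0; have cln := continuous_ln r0.
apply: contD_at; last exact: (contM_at (@contC R _ (m 0)%:R r) cln).
elim: Z => [|x Z IH].
  have -> : (fun r : R => \sum_(x <- [::] | x != 0) (m x)%:R * ln (r / normc x)) = fun=> 0.
    by apply/funext => t; rewrite big_nil.
  exact: contC.
have [x0|x0] := boolP (x != 0); last first.
  have -> // : (fun r : R => \sum_(x <- x :: Z | x != 0) (m x)%:R * ln (r / normc x)) =
      fun r => \sum_(x <- Z | x != 0) (m x)%:R * ln (r / normc x).
  by apply/funext => t; rewrite big_cons (negbTE x0).
have -> : (fun r : R => \sum_(x <- x :: Z | x != 0) (m x)%:R * ln (r / normc x)) =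
    fun r => (m x)%:R * ln (r / normc x) + \sum_(x <- Z | x != 0) (m x)%:R * ln (r / normc x).
  by apply/funext => t; rewrite big_cons x0.
apply: contD_at IH; apply: (contM_at (@contC R _ (m x)%:R r)).
have x1 : 0 < normc x by rewrite normc_gt0.
have cid : {for r, continuous (fun y : R => y)} by exact: cvg_id.
have c1 := contM_at cid (@contC R _ (normc x)^-1 r).
exact: (continuous_comp c1 (continuous_ln (divr_gt0 r0 x1))).
Qed.

End counting.

(** * Jensen's inequality on an arbitrary circle *)

Section jensen.
Variables (R : realType) (rho : \bar R) (a : R[i] -> R) (m : R[i] -> nat) (lambda : R).
Variables (d : R[i] -> R) (g : R[i] -> R[i] -> R).
Hypothesis loc : forall z, disc rho z -> [/\ 0 < d z, forall k, pC k z (d z) (g z) &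
  forall w, normc (w - z) < d z ->
    [/\ disc rho w, 0 < g z w & a w = (normc (w - z) ^+ 2) ^+ m z * g z w]].
Hypothesis lap : forall z L, disc rho z -> 0 < a z -> is_lap (fun w => ln (a w)) z L -> 4 * lambda * a z <= L.
Implicit Types (x z w : R[i]) (r s : R).

(* The tangent line replaces concavity of ln, so the mean of a need not be known to be positive. *)
Lemma ln_le_tangent (x K : R) : 0 < x -> 0 < K -> ln x <= K^-1 * x + (ln K - 1).
Proof.
move=> x0 K0; have xK : 0 < K^-1 * x by rewrite mulr_gt0// invr_gt0.
have := @le_ln1Dx R (K^-1 * x - 1); rewrite [1 + _]addrC subrK => H.
have : ln (K^-1 * x) <= K^-1 * x - 1 by apply: H; lra.
have p1 : K^-1 \in Num.pos by rewrite posrE invr_gt0.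
have p2 : x \in Num.pos by rewrite posrE.
have p3 : K \in Num.pos by rewrite posrE.
by rewrite (lnM p1 p2) (lnV p3); lra.
Qed.

Lemma left_limit_ge0 (q : R -> R) (r e : R) : 0 < e -> {for r, continuous q} ->
  (forall s, r - e < s < r -> 0 <= q s) -> 0 <= q r.
Proof.
move=> e0 /cont_eps cq He; rewrite leNgt; apply/negP => qr.
have [|d' d'0 Hd'] := cq (- q r); first by rewrite oppr_gt0.
pose t := Num.min e d' / 2.
have t0 : 0 < t by rewrite divr_gt0// lt_min e0.
have te : t < e by apply: (@lt_le_trans _ _ (Num.min e d')); [rewrite /t in t0 *; lra|rewrite ge_min lexx].
have td : t < d' by apply: (@lt_le_trans _ _ (Num.min e d')); [rewrite /t in t0 *; lra|rewrite ge_min lexx orbT].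
have /Hd' : `|r - t - r| < d' by rewrite addrAC subrr add0r normrN gtr0_norm.
have : 0 <= q (r - t) by apply: He; lra.
by rewrite ltr_norml; lra.
Qed.

Lemma seq_bound (Z : seq R[i]) r : 0 < r -> (forall x, x \in Z -> normc x < r) ->
  exists2 M, 0 <= M < r & forall x, x \in Z -> normc x <= M.
Proof.
move=> r0; elim: Z => [|x Z IH] H; first by exists 0; rewrite ?lexx.
have [|M /andP[M0 Mr] HM] := IH; first by move=> y yZ; apply: H; rewrite inE yZ orbT.
exists (Num.max M (normc x)); first by rewrite le_max M0 gt_max Mr H// mem_head.
move=> y; rewrite inE => /orP[/eqP ->|/HM yM]; first by rewrite le_max lexx orbT.
by rewrite le_max yM.
Qed.

(** Zeros of a may lie on |z| = r. So [jensen_circle] is used for s slightly below r, beyond all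
    zeros of |z| < r and with r as the larger radius; the result compares functions continuous in s
    and passes to s = r. *)
Lemma jensen_bound r (Z : seq R[i]) (K : R) : 0 < r -> (r%:E < rho)%E -> uniq Z ->
  (forall z, (z \in Z) = (normc z < r) && (0 < m z)%N) ->
  0 < K -> Int th0 th1 (fun t => a (sp r t)) <= 2 * pi * K ->
  lambda * characteristic (disc_integral a) r + counting m Z r + ln (g 0 0) / 2 <= ln K / 2.
Proof.
move=> r0 rr uZ ZE K0 mK; have p0 := pi_gt0 R.
have [r1 rr1 r1r] : exists2 r1, r < r1 & (r1%:E <= rho)%E.
  move: rr; case: (rho) => [rho'||]//.
    by rewrite lte_fin => h; exists rho'.
  by move=> _; exists (r + 1); [rewrite ltrDl|rewrite leey].
have [|M /andP[M0 Mr] HM] := @seq_bound Z r r0.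
  by move=> x; rewrite ZE => /andP[].
pose T := characteristic (disc_integral a).
pose mean s := Int th0 th1 (fun t => a (sp s t)).
pose N := counting m Z.
pose q s := K^-1 * mean s + (ln K - 1) * (2 * pi) - 2 * pi * ln (g 0 0) - 4 * pi * N s - 4 * pi * lambda * T s.
have Ha := coef_pC loc 2 r1r.
have a0 z : normc z < r1 -> 0 <= a z by move=> zs; apply: (coef_ge0 loc); exact: disc_real r1r zs.
have q0 : 0 <= q r.
  (* For s > (r + M) / 2 one has s^2 >= ((r + M) / 2)^2 >= r M, which puts the reflected zeros
     outside |z| < r. *)
  have e0 : 0 < (r - M) / 2 by rewrite divr_gt0// subr_gt0.
  apply: (left_limit_ge0 e0) => [|s /andP[s1 sr]].
    have [ax [ay [Da Hax Hay]]] := pCS Ha.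
    have rn : `|r| < r1 by rewrite gtr0_norm.
    have cm := is_derive_cont (green_mean (pC0 Ha) (pC0 Hax) (pC0 Hay) Da rn).
    have cA (x : R) : 0 < x -> x < r1 -> {for x, continuous (disc_integral a)}.
      by move=> x0 xr; exact: (is_derive_cont (is_derive_disc_integral Ha a0 x0 xr)).
    have cT := is_derive_cont (is_derive_characteristic cA (disc_integral_bound Ha a0) r0 rr1).
    have cN := @counting_cont R m Z r r0.
    have k1 := contM_at (@contC R _ K^-1 r) cm.
    have k2 := contD_at k1 (@contC R _ ((ln K - 1) * (2 * pi)) r).
    have k3 := contB_at k2 (@contC R _ (2 * pi * ln (g 0 0)) r).
    have k4 := contB_at k3 (contM_at (@contC R _ (4 * pi) r) cN).
    exact: (contB_at k4 (contM_at (@contC R _ (4 * pi * lambda) r) cT)).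
  have s0 : 0 < s by lra.
  have Ms : M < s by lra.
  have sn : `|s| < r1 by rewrite gtr0_norm//; lra.
  have ns t : normc (sp s t) = s by rewrite normc_sp gtr0_norm.
  have rrho : (r%:E <= rho)%E by exact: ltW.
  have J := @jensen_circle R rho a m lambda d g loc lap s r Z s0 sr rrho uZ.
  have {}J : 2 * pi * ln (g 0 0) + 4 * pi * N s + 4 * pi * lambda * T s <=
      Int th0 th1 (fun t => ln (a (sp s t))).
    apply: J.
    - by move=> x /HM; lra.
    - by move=> x xr; rewrite ZE xr.
    - move=> x /HM xM; apply: le_trans (_ : r * M <= _); first by rewrite ler_wpM2l// ltW.
      have : ((r + M) / 2) ^+ 2 <= s ^+ 2 by rewrite lerXn2r ?nnegrE; lra.
      have := sqr_ge0 (r - M); nra.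
  have ca : continuous (fun t => a (sp s t)) by exact: (pC_circ (pC0 Ha) sn).
  have apos t : 0 < a (sp s t).
    have Ds : disc rho (sp s t) by apply: (disc_real r1r); rewrite ns; lra.
    rewrite (coef_gt0 loc Ds) eqn0Ngt; apply/negP => ms.
    have : sp s t \in Z by rewrite ZE ns sr.
    by move/HM; rewrite ns; lra.
  have cl : continuous (fun t => ln (a (sp s t))).
    by move=> t; exact: (continuous_comp (ca t) (continuous_ln (apos t))).
  have ck := contM (@contC R _ K^-1) ca.
  have cc := contD ck (@contC R _ (ln K - 1)).
  have := Int_le (a := th0) (b := th1) cl cc (fun t _ => ln_le_tangent (apos t) K0).
  rewrite (IntD _ _ ck (@contC R _ (ln K - 1))) (IntZ _ _ _ ca) Int_cst ?th1B0; last exact: (th01 R).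
  by rewrite /q /mean; lra.
have mK' : K^-1 * mean r <= 2 * pi by rewrite mulrC ler_pdivrMr.
have : 4 * pi * (lambda * T r + N r + ln (g 0 0) / 2 - ln K / 2) <= 0.
  by move: q0; rewrite /q; lra.
by rewrite pmulr_rle0 ?mulr_gt0//; rewrite /T /N; lra.
Qed.

End jensen.

(** * Growth lemma and main estimate *)

Section growth.
Variable R : realType.
Notation mu := (@lebesgue_measure R).
Implicit Types (rho : \bar R) (r : R).

Lemma open_radii rho : open (radii rho).
Proof.
rewrite (_ : radii rho = [set r | 0 < r] `&` [set r | (r%:E < rho)%E]).
  apply: openI; first exact: open_gt.
  case: rho => [rho||].
  - by under eq_set do rewrite lte_fin; exact: open_lt.
  - by rewrite (_ : [set r | _] = setT); [exact: openT|apply/seteqP; split=> // r _ /=; rewrite ltry].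
  - by rewrite (_ : [set r | _] = set0); [exact: open0|apply/seteqP; split=> // r /=; rewrite ltNge leNye].
by apply/seteqP; split=> r [].
Qed.

Lemma measurable_radii rho : measurable (radii rho).
Proof. exact: open_measurable (@open_radii rho). Qed.

Lemma measurable_on_radii rho (f : R -> R) (D : set R) : D `<=` radii rho -> measurable D ->
  (forall r, radii rho r -> {for r, continuous f}) -> measurable_fun D f.
Proof.
move=> Drho mD cf; apply: (measurable_funS (measurable_radii rho) Drho).
apply: open_continuous_measurable_fun; first exact: open_radii.
by move=> r; rewrite inE; exact: cf.
Qed.

Lemma radii_exhaustion rho r0 : (r0%:E < rho)%E -> exists u : nat -> R,
  [/\ {homo u : n m / (n <= m)%N >-> n <= m}, forall n, r0 <= u n, forall n, ((u n)%:E < rho)%E &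
      forall r, (r%:E < rho)%E -> exists n, r <= u n].
Proof.
case: rho => [rho||]//.
- rewrite lte_fin => rr; have d0 : 0 < rho - r0 by rewrite subr_gt0.
  exists (fun n => rho - (rho - r0) / n.+1%:R); split=> [n k nk|n|n|r].
  + by rewrite lerD2l lerN2 ler_pM2l// lef_pV2 ?posrE// ler_nat.
  + by rewrite lerBrDr addrC -lerBrDr ler_pdivrMr//; apply: ler_peMr; [exact: ltW|rewrite ler1n].
  + by rewrite lte_fin gtrBl divr_gt0.
  + rewrite lte_fin => rrho; have d1 : 0 < rho - r by rewrite subr_gt0.
    exists (Num.truncn ((rho - r0) / (rho - r))).
    have := truncnS_gt ((rho - r0) / (rho - r)); rewrite ltr_pdivrMr// => H.
    rewrite lerBrDr -lerBrDl ler_pdivrMr// mulrC; exact: ltW.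
- move=> _; exists (fun n => r0 + n%:R); split=> [n k nk|n|n|r _].
  + by rewrite lerD2l ler_nat.
  + by rewrite lerDl.
  + by rewrite ltry.
  + exists (Num.truncn (r - r0)).+1; rewrite -lerBlDl; exact/ltW/truncnS_gt.
Qed.

Lemma ge0_integral_setU_le (A B : set R) (f : R -> \bar R) : measurable A -> measurable B ->
  measurable_fun (A `|` B) f -> (forall x, (A `|` B) x -> (0 <= f x)%E) ->
  (integral mu (A `|` B) f <= integral mu A f + integral mu B f)%E.
Proof.
move=> mA mB mf f0; have mBA : measurable (B `\` A) by exact: measurableD.
have AB : A `|` B = A `|` (B `\` A) by rewrite setUDr setDv setD0.
rewrite AB ge0_integral_setU//; last 3 first.
- by rewrite -AB.
- by rewrite -AB.
- by apply/disj_setPS => x [Ax []].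
rewrite leeD2l//; apply: ge0_subset_integral => //.
- by apply: measurable_funS mf; [exact: measurableU|exact: subsetUr].
- by move=> x Bx; apply: f0; right.
Qed.

(* [h' / h^(1+delta)] has the bounded primitive [- h^(-delta) / delta]. *)
Lemma borel_growth rho r0 (h h' W : R -> R) (delta : R) : 0 < delta -> 0 < r0 -> (r0%:E < rho)%E ->
  (forall r, r0 <= r -> (r%:E < rho)%E ->
    [/\ is_derive r 1 h (h' r), {for r, continuous h'}, 0 < h r, 0 <= h' r &
        {for r, continuous W} /\ 0 <= W r]) ->
  let E := [set r | [/\ r0 < r, (r%:E < rho)%E & W r * (h r * expR (delta * ln (h r))) <= h' r]] in
  measurable E /\ (integral mu E (fun r => (W r)%:E) < +oo)%E.
Proof.
move=> delta0 r00 r0rho H E.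
(* [k] is h^(1 + delta) and [P] is the primitive - h^(-delta) / delta of [q]. As [P] is negative,
   its increase from r0 is at most - P r0, which is the bound [B] below. *)
pose k r := h r * expR (delta * ln (h r)).
pose q r := h' r / k r.
pose P r := - delta^-1 * expR (- (delta * ln (h r))).
have ck r : r0 <= r -> (r%:E < rho)%E -> {for r, continuous k} /\ 0 < k r.
  move=> r1 r2; have [dh _ h0 _ _] := H r r1 r2.
  have ch := is_derive_cont dh; split; last by rewrite mulr_gt0// expR_gt0.
  apply: (contM_at ch); have c1 := contM_at (@contC R _ delta r) (continuous_comp ch (continuous_ln h0)).
  exact: (continuous_comp c1 (@continuous_expR R _)).
have cq r : r0 <= r -> (r%:E < rho)%E -> {for r, continuous q} /\ 0 <= q r.
  move=> r1 r2; have [_ ch' _ h'0 _] := H r r1 r2; have [ck1 k0] := ck r r1 r2.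
  split; last by rewrite divr_ge0// ltW.
  by apply: (contM_at ch'); exact: (continuous_comp ck1 (is_derive_cont (is_derive_inv (lt0r_neq0 k0)))).
have dP r : r0 <= r -> (r%:E < rho)%E -> is_derive r 1 P (q r).
  move=> r1 r2; have [dh _ h0 _ _] := H r r1 r2.
  have d1 := dN (dM (dC delta r) (dcomp (is_derive1_ln h0) dh)).
  have d2 := @dcomp R expR (fun y => - (delta * ln (h y))) r _ _ (is_derive_expR _) d1.
  have := dM (dC (- delta^-1) r) d2.
  rewrite (_ : _ + _ = q r)// /q /k expRN; have e0 := lt0r_neq0 (expR_gt0 (delta * ln (h r))).
  by field; rewrite e0 (lt0r_neq0 h0) (lt0r_neq0 delta0).
have [u [um ur0 urho uex]] := radii_exhaustion r0rho.
pose F n : set R := `[r0, u n]%classic.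
have Fr n r : F n r -> r0 <= r /\ (r%:E < rho)%E.
  rewrite /F/= in_itv/= => /andP[r1 r2]; split=> //.
  by apply: le_lt_trans (urho n); rewrite lee_fin.
pose B := (delta^-1 * expR (- (delta * ln (h r0))))%:E.
have mF n : measurable (F n) by exact: measurable_itv.
have mqF n : measurable_fun (F n) (EFin \o q).
  apply/measurable_EFinP; apply: subspace_continuous_measurable_fun => //.
  by apply: continuous_in_subspaceT => r; rewrite inE => /Fr[r1 r2]; have [] := cq r r1 r2.
have IF n : (integral mu (F n) (EFin \o q) <= B)%E.
  have := ur0 n; rewrite le_eqVlt => /predU1P[e|lt].
    by rewrite /F -e set_itv1 integral_set1 lee_fin mulr_ge0 ?expR_ge0// invr_ge0 ltW.
  rewrite (@continuous_FTC2 R q P r0 (u n) lt).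
  - rewrite -EFinB lee_fin /P !mulNr opprK gerDr oppr_le0.
    by rewrite mulr_ge0 ?expR_ge0// invr_ge0 ltW.
  - by apply: continuous_in_subspaceT => r; rewrite inE => /Fr[r1 r2]; have [] := cq r r1 r2.
  - split.
    + move=> r; rewrite in_itv/= => /andP[/ltW r1 /ltW r2].
      by have [] := Fr n r ltac:(by rewrite /F/= in_itv/= r1); move=> a1 a2; have [] := dP r a1 a2.
    + by apply: cvg_at_right_filter; exact: (is_derive_cont (dP _ (lexx r0) r0rho)).
    + by apply: cvg_at_left_filter; exact: (is_derive_cont (dP _ (ur0 n) (urho n))).
  - move=> r; rewrite in_itv/= => /andP[/ltW r1 /ltW r2].
    have [a1 a2] := Fr n r ltac:(by rewrite /F/= in_itv/= r1).
    by have [_ e] := dP r a1 a2; rewrite derive1E.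
have nF : {homo F : n m / (n <= m)%N >-> (n <= m)%O}.
  move=> n m' nm; apply/subsetPset => r; rewrite /F/= !in_itv/= => /andP[-> /= h1].
  exact: le_trans h1 (um _ _ nm).
have q0F n x : F n x -> (0 <= (EFin \o q) x)%E.
  by move=> /Fr[r1 r2]; rewrite lee_fin; have [] := cq x r1 r2.
have cvgF : integral mu (F i) (EFin \o q) @[i --> \oo] --> integral mu (\bigcup_i F i) (EFin \o q).
  apply: ge0_nondecreasing_set_cvg_integral.
- exact: nF.
- exact: mF.
- exact: mqF.
- exact: q0F.
have mU : measurable (\bigcup_i F i) by exact: bigcupT_measurable.
have IU : (integral mu (\bigcup_i F i) (EFin \o q) <= B)%E.
  by rewrite -(cvg_lim _ cvgF)//; apply: lime_le; [apply/cvg_ex; eexists; exact: cvgF|exact: nearW].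
have UE r : (\bigcup_i F i) r <-> (r0 <= r /\ (r%:E < rho)%E).
  split=> [[n _ /Fr]//|[r1 /uex[n rn]]]; exists n => //.
  by rewrite /F/= in_itv/= r1.
have mW : measurable_fun (\bigcup_i F i) W.
  apply/measurable_fun_bigcup => // n; apply: subspace_continuous_measurable_fun => //.
  by apply: continuous_in_subspaceT => r; rewrite inE => /Fr[r1 r2]; have [_ _ _ _ []] := H r r1 r2.
have mk : measurable_fun (\bigcup_i F i) (fun r => W r * k r).
  apply: measurable_funM => //.
  apply/measurable_fun_bigcup => // n; apply: subspace_continuous_measurable_fun => //.
  by apply: continuous_in_subspaceT => r; rewrite inE => /Fr[r1 r2]; have [] := ck r r1 r2.
have mh' : measurable_fun (\bigcup_i F i) h'.
  apply/measurable_fun_bigcup => // n; apply: subspace_continuous_measurable_fun => //.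
  by apply: continuous_in_subspaceT => r; rewrite inE => /Fr[r1 r2]; have [] := H r r1 r2.
have mq : measurable_fun (\bigcup_i F i) (EFin \o q) by apply/measurable_fun_bigcup.
have EE : E = (\bigcup_i F i `&` [set r | W r * k r <= h' r]) `&` `]r0, +oo[%classic.
  apply/seteqP; split=> r; rewrite /E/= in_itv/= andbT.
    by move=> [r1 r2 r3]; split=> //; split=> //; apply/UE; split=> //; exact: ltW.
  by move=> [[/UE[r1 r2] r3] r4].
have mE : measurable E.
  by rewrite EE; apply: measurableI => //; exact: measurable_fun_le.
have EU : E `<=` \bigcup_i F i by rewrite EE => r [[]].
(* On E the weight is at most [q], whose integral from r0 on is at most [B]. *)
split=> //; apply: (@le_lt_trans _ _ B); last by rewrite ltry.
apply: le_trans IU; apply: (@le_trans _ _ (integral mu E (EFin \o q))).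
  apply: ge0_le_integral => //.
  - by move=> r /EU/UE[r1 r2]; rewrite lee_fin; have [_ _ _ _ []] := H r r1 r2.
  - by apply/measurable_EFinP; exact: measurable_funS mW.
  - exact: measurable_funS mq.
  - move=> r [r1 r2 r3]; have [_ k0] := ck r (ltW r1) r2.
    by rewrite lee_fin /q ler_pdivlMr.
apply: ge0_subset_integral => // r /UE[r1 r2]; rewrite lee_fin.
by have [] := cq r r1 r2.
Qed.

End growth.

Section main_estimate.
Variables (R : realType) (rho : \bar R) (a : R[i] -> R) (m : R[i] -> nat) (lambda : R).
Variables (d : R[i] -> R) (g : R[i] -> R[i] -> R).
Hypothesis loc : forall z, disc rho z -> [/\ 0 < d z, forall k, pC k z (d z) (g z) &
  forall w, normc (w - z) < d z ->
    [/\ disc rho w, 0 < g z w & a w = (normc (w - z) ^+ 2) ^+ m z * g z w]].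
Hypothesis lap : forall z L, disc rho z -> 0 < a z -> is_lap (fun w => ln (a w)) z L -> 4 * lambda * a z <= L.
Notation mu := (@lebesgue_measure R).
Implicit Types (x z w : R[i]) (r s t : R).

Let A := disc_integral a.
Let T := characteristic A.
Let mean r := Int th0 th1 (fun t => a (sp r t)).

Definition Nram r : R :=
  Rintegral mu `]0, r[ (fun t => (\sum_(z \in [set z | normc z < t]) ((m z)%:R : R) - (m 0)%:R) / t)
  + (m 0)%:R * ln r.

Lemma radii_larger r : radii rho r -> exists2 r1, r < r1 & (r1%:E <= rho)%E.
Proof.
move=> [_]; case: (rho) => [rho'||]//.
  by rewrite lte_fin => h; exists rho'.
by move=> _; exists (r + 1); [rewrite ltrDl|rewrite leey].
Qed.

Lemma radii_le r s : 0 < s -> s <= r -> radii rho r -> radii rho s.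
Proof. by move=> s0 sr [_ rr]; split=> //; apply: le_lt_trans rr; rewrite lee_fin. Qed.

Let a0 r1 : (r1%:E <= rho)%E -> forall z, normc z < r1 -> 0 <= a z.
Proof. by move=> r1r z zr; apply: (coef_ge0 loc); exact: disc_real r1r zr. Qed.

Lemma is_derive_area r : radii rho r -> is_derive r 1 A (r / pi * mean r).
Proof.
move=> Rr; have [r1 rr1 r1r] := radii_larger Rr; have [r0 _] := Rr.
exact: (is_derive_disc_integral (coef_pC loc 2 r1r) (a0 r1r) r0 rr1).
Qed.

Lemma mean_cont r : radii rho r -> {for r, continuous mean}.
Proof.
move=> Rr; have [r1 rr1 r1r] := radii_larger Rr; have [r0 _] := Rr.
have Ha := coef_pC loc 2 r1r; have [ax [ay [Da Hax Hay]]] := pCS Ha.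
have rn : `|r| < r1 by rewrite gtr0_norm.
exact: (is_derive_cont (green_mean (pC0 Ha) (pC0 Hax) (pC0 Hay) Da rn)).
Qed.

Lemma mean_ge0 r : radii rho r -> 0 <= mean r.
Proof.
move=> [r0 rr]; apply: Int_ge0 => t _; apply: (coef_ge0 loc).
by rewrite /disc /mkset normc_sp gtr0_norm.
Qed.

Lemma is_derive_T r : radii rho r -> is_derive r 1 T (A r / r).
Proof.
move=> Rr; have [r1 rr1 r1r] := radii_larger Rr; have [r0 _] := Rr.
apply: (@is_derive_characteristic R A r1) => //.
  move=> s s0 sr; apply: (is_derive_cont (is_derive_disc_integral (coef_pC loc 2 r1r) (a0 r1r) s0 sr)).
exact: (disc_integral_bound (coef_pC loc 2 r1r) (a0 r1r)).
Qed.

Lemma area_ge0 r : radii rho r -> 0 <= A r.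
Proof.
move=> Rr; have [r1 rr1 r1r] := radii_larger Rr; have [r0 _] := Rr.
have [M _ HM] := disc_integral_bound (coef_pC loc 2 r1r) (a0 r1r) (ltW r0) rr1.
by have /andP[] := HM r r0 (lexx r).
Qed.

Lemma area_le s r : 0 < s -> s <= r -> radii rho r -> A s <= A r.
Proof.
move=> s0 sr Rr; have Rx (x : R) : s <= x <= r -> radii rho x.
  by move=> /andP[sx xr]; apply: radii_le Rr => //; exact: lt_le_trans sx.
apply: (derive_nondecreasing sr (fun (y : R) yI => is_derive_area (Rx y yI))) => y yI.
have [y0 _] := Rx y yI; have p0 := pi_gt0 R.
by rewrite mulr_ge0 ?mean_ge0 ?divr_ge0 ?(ltW p0) ?(ltW y0)//; exact: Rx.
Qed.

(** On small circles around 0 the coefficient is positive, 0 being the only possible zero nearby; so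
    A has positive derivative there and increases strictly from s / 2 to s. *)
Lemma area_gt0 r : radii rho r -> 0 < A r.
Proof.
move=> Rr; have [r0 rr] := Rr; have D0 : disc rho 0 by rewrite /disc /mkset normc0 (lt_trans _ rr)// lte_fin.
have [d0 _ Ha] := loc D0; have p0 := pi_gt0 R.
pose s := Num.min r (d 0 / 2).
have s0 : 0 < s by rewrite lt_min r0 divr_gt0.
have sr : s <= r by rewrite ge_min lexx.
have sd : s < d 0 by apply: (@le_lt_trans _ _ (d 0 / 2)); [rewrite ge_min lexx orbT|lra].
have s20 : 0 < s / 2 by rewrite divr_gt0.
have Rs := radii_le s0 sr Rr; apply: lt_le_trans (area_le s0 sr Rr).
have Rx (x : R) : s / 2 <= x <= s -> radii rho x.
  by move=> /andP[sx xr]; apply: radii_le Rs => //; exact: lt_le_trans sx.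
have [x xI|x xI|c] := @MVT_segment R A (fun y : R => y / pi * mean y) (s / 2) s ltac:(lra).
- by apply: is_derive_area; apply: Rx; move: xI; rewrite in_itv/= => /andP[/ltW -> /ltW ->].
- apply: continuous_in_subspaceT x xI => x; rewrite inE/= in_itv/= => /Rx/is_derive_area.
  exact: is_derive_cont.
rewrite in_itv/= => cI AE; have Rc := Rx c cI; have [c0 _] := Rc.
have A2 : 0 <= A (s / 2) by apply: area_ge0; apply: Rx; rewrite lexx/=; lra.
suff : 0 < c / pi * mean c * (s - s / 2) by rewrite -AE; lra.
have cs : normc (sp c _) < d 0 by move=> t; rewrite normc_sp gtr0_norm//; case/andP: cI; lra.
have ac t : 0 < a (sp c t).
  have ct : normc (sp c t - 0) < d 0 by rewrite subr0; exact: cs.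
  have [Dc g0 ->] := Ha _ ct; rewrite mulr_gt0// !exprn_gt0// subr0 normc_sp gtr0_norm//.
have [r1 cr1 r1r] := radii_larger Rc.
have ca : continuous (fun t => a (sp c t)).
  by apply: (pC_circ (pC0 (coef_pC loc 2 r1r))); rewrite gtr0_norm.
have ci : continuous (fun t => (a (sp c t))^-1).
  by move=> t; exact: (continuous_comp (ca t) (is_derive_cont (is_derive_inv (lt0r_neq0 (ac t))))).
have [M M0 HM] := segment_bounded th0 th1 ci.
have M1 : 0 < M + 1 by rewrite ltr_wpDl.
have mc : (M + 1)^-1 * (2 * pi) <= mean c.
  rewrite -th1B0 -(Int_cst _ (th01 R)); apply: Int_le => //; first exact: contC.
  move=> t /HM; rewrite gtr0_norm ?invr_gt0// => h.
  by rewrite -[leRHS]invrK lef_pV2 ?posrE ?invr_gt0//; lra.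
have mc0 : 0 < mean c by apply: lt_le_trans mc; rewrite mulr_gt0 ?invr_gt0// mulr_gt0.
by rewrite !mulr_gt0 ?invr_gt0//; lra.
Qed.

Lemma T_ge0 r : radii rho r -> 0 <= T r.
Proof.
move=> Rr; have [r1 rr1 r1r] := radii_larger Rr; have [r0 _] := Rr.
have cA s : 0 < s -> s < r1 -> {for s, continuous A}.
  move=> s0 sr; exact: (is_derive_cont (is_derive_disc_integral (coef_pC loc 2 r1r) (a0 r1r) s0 sr)).
have [M _ HM] := characteristic_bound cA (disc_integral_bound (coef_pC loc 2 r1r) (a0 r1r)) (ltW r0) rr1.
by have /andP[] := HM r r0 (lexx r).
Qed.

Lemma T_le s r : 0 < s -> s <= r -> radii rho r -> T s <= T r.
Proof.
move=> s0 sr Rr; have Rx (x : R) : s <= x <= r -> radii rho x.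
  by move=> /andP[sx xr]; apply: radii_le Rr => //; exact: lt_le_trans sx.
apply: (derive_nondecreasing sr (fun (y : R) yI => is_derive_T (Rx y yI))) => y yI.
have [y0 _] := Rx y yI.
by rewrite divr_ge0 ?(ltW y0)// area_ge0//; exact: Rx.
Qed.

Lemma zeros_below r : (r%:E < rho)%E -> exists2 Z : seq R[i], uniq Z &
  forall z, (z \in Z) = (normc z < r) && (0 < m z)%N.
Proof.
move=> rr; have [Z uZ ZE] := zeros_finite loc rr.
exists [seq z <- Z | normc z < r]; first exact: filter_uniq.
by move=> z; rewrite mem_filter ZE; case: ltP => //= zr; rewrite (ltW zr).
Qed.

(** A zero off the origin contributes a nonnegative amount, so only the origin can make the counting
    function negative, and only for r < 1. *)
Lemma Nram_ge r : radii rho r -> (m 0)%:R * ln r <= Nram r.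
Proof.
move=> [r0 rr]; have [Z uZ ZE] := zeros_below rr.
rewrite /Nram (counting_integral r0 uZ ZE) /counting lerDr big_seq_cond; apply: sumr_ge0 => x.
rewrite ZE => /andP[/andP[xr _] x0]; rewrite mulr_ge0// ln_ge0//.
by rewrite ler_pdivlMr ?normc_gt0// mul1r ltW.
Qed.

Lemma Nram_jensen r K : radii rho r -> 0 < K -> mean r <= 2 * pi * K ->
  lambda * T r + Nram r + ln (g 0 0) / 2 <= ln K / 2.
Proof.
move=> [r0 rr] K0 mK; have [Z uZ ZE] := zeros_below rr.
rewrite /Nram (counting_integral r0 uZ ZE).
exact: (jensen_bound loc lap r0 rr uZ ZE K0 mK).
Qed.

Let W kappa r := expR (kappa * T r).

Let W_cont kappa r : radii rho r -> {for r, continuous (W kappa)}.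
Proof.
move=> Rr; have c1 := contM_at (@contC R _ kappa r) (is_derive_cont (is_derive_T Rr)).
exact: (continuous_comp c1 (@continuous_expR R _)).
Qed.

Let W_meas kappa (D : set R) : measurable D -> D `<=` radii rho -> measurable_fun D (fun r => (W kappa r)%:E).
Proof. by move=> mD Dr; apply/measurable_EFinP; apply: measurable_on_radii Dr mD (@W_cont kappa). Qed.

Definition exp_int kappa (D : set R) : \bar R := (\int[mu]_(r in D) (expR (kappa * T r))%:E)%E.

(* The two negated growth conditions combine to A' < r^(1+2 eps) exp((2+2 eps) kappa T) T^((1+2 eps)^2). *)
Let off_exceptional (eps kappa r : R) : 0 < eps -> radii rho r -> 2 <= T r ->
  A r / r < W kappa r * (T r * expR (2 * eps * ln (T r))) ->
  r / pi * mean r < W kappa r * (A r * expR (2 * eps * ln (A r))) ->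
  (lambda - (1 + eps) * kappa) * T r + Nram r <=
    ((1 + 2 * eps) ^+ 2 / 2 + `|ln (g 0 0)| / (2 * ln 2)) * ln (T r) + eps * ln r.
Proof.
move=> e0 Rr T2 H1 H2; have [r0 _] := Rr; have Ar := area_gt0 Rr; have p0 := pi_gt0 R.
have T0 : 0 < T r by apply: lt_le_trans T2.
have lnP (x : R) : 0 < x -> x \in Num.pos by rewrite posrE.
have lnA : ln (A r) <= ln r + kappa * T r + (1 + 2 * eps) * ln (T r).
  have h : A r <= r * (W kappa r * (T r * expR (2 * eps * ln (T r)))).
    by move: (ltW H1); rewrite ler_pdivrMr// mulrC.
  have e1 := expR_gt0 (kappa * T r); have e2 := expR_gt0 (2 * eps * ln (T r)).
  have q1 : 0 < T r * expR (2 * eps * ln (T r)) by rewrite mulr_gt0.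
  have q2 : 0 < W kappa r * (T r * expR (2 * eps * ln (T r))) by rewrite mulr_gt0.
  have := ler_ln (lnP _ Ar) (lnP _ (mulr_gt0 r0 q2)); rewrite h => /esym.
  rewrite (lnM (lnP _ r0) (lnP _ q2)) (lnM (lnP _ e1) (lnP _ q1)) (lnM (lnP _ T0) (lnP _ e2)) !expRK.
  by lra.
(* The second growth bound, solved for the circle integral [mean], reads mean < 2 pi K. *)
pose K := W kappa r * (A r * expR (2 * eps * ln (A r))) / (2 * r).
have e1 := expR_gt0 (kappa * T r); have e2 := expR_gt0 (2 * eps * ln (A r)).
have q1 : 0 < A r * expR (2 * eps * ln (A r)) by rewrite mulr_gt0.
have q2 : 0 < W kappa r * (A r * expR (2 * eps * ln (A r))) by rewrite mulr_gt0.
have r2 : 0 < 2 * r by rewrite mulr_gt0.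
have K0 : 0 < K by rewrite divr_gt0.
have mK : mean r <= 2 * pi * K.
  have -> : mean r = 2 * pi * ((r / pi * mean r) / (2 * r)).
    have F (p q y : R) : p != 0 -> q != 0 -> y = 2 * p * (q / p * y / (2 * q)).
      by move=> p1 q3; field; rewrite p1 q3.
    exact: (F _ _ _ (lt0r_neq0 p0) (lt0r_neq0 r0)).
  by rewrite ler_pM2l ?mulr_gt0// ler_pM2r ?invr_gt0//; exact: ltW.
have J := Nram_jensen Rr K0 mK.
have two0 : 0 < 2 :> R by [].
have lnK : ln K = kappa * T r + (ln (A r) + 2 * eps * ln (A r)) - (ln 2 + ln r).
  rewrite /K (ln_div (lnP _ q2) (lnP _ r2)) (lnM (lnP _ e1) (lnP _ q1)) (lnM (lnP _ Ar) (lnP _ e2)).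
  by rewrite (lnM (lnP _ two0) (lnP _ r0)) !expRK.
have l2 : 0 < ln 2 :> R by rewrite ln_gt0// ltr1n.
have lT : ln 2 <= ln (T r) by rewrite ler_ln ?posrE.
(* Since T >= 2, the inequality ln T >= ln 2 turns the constant from Jensen's inequality into a
   multiple of ln T. *)
have gT : - (ln (g 0 0) / 2) <= `|ln (g 0 0)| / (2 * ln 2) * ln (T r).
  apply: (@le_trans _ _ (`|ln (g 0 0)| / 2)).
    by have := ler_norm (- ln (g 0 0)); rewrite normrN; lra.
  rewrite invfM mulrA -mulrA ler_peMr ?divr_ge0//.
  by rewrite mulrC ler_pdivlMr// mul1r.
have : ln K / 2 <= kappa * (1 + eps) * T r + eps * ln r + (1 + 2 * eps) ^+ 2 / 2 * ln (T r).
  rewrite lnK.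
  have h : (1 + 2 * eps) * ln (A r) <= (1 + 2 * eps) * (ln r + kappa * T r + (1 + 2 * eps) * ln (T r)).
    by rewrite ler_wpM2l//; lra.
  have -> : kappa * (1 + eps) * T r + eps * ln r + (1 + 2 * eps) ^+ 2 / 2 * ln (T r) =
     (kappa * T r + (1 + 2 * eps) * (ln r + kappa * T r + (1 + 2 * eps) * ln (T r)) - ln r) / 2 by field.
  by lra.
rewrite mulrDl; lra.
Qed.

(** E consists of the initial interval up to r0, where T may be below 2 but the weight is at most
    its value at r0, and of the two exceptional sets of [borel_growth], for h = T and for h = A.
    Beyond r0 the bound T >= 2 keeps ln T away from 0, so that constants can be absorbed. *)
Lemma main_inequality (eps kappa r0 : R) : 0 < eps -> 0 <= kappa -> radii rho r0 -> 2 <= T r0 ->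
  exists E : set R, [/\ measurable E, E `<=` radii rho, (exp_int kappa E < +oo)%E &
    exists C : R, forall r, radii rho r -> ~ E r ->
      2 <= T r /\ (lambda - (1 + eps) * kappa) * T r + Nram r <= C * ln (T r) + eps * ln r].
Proof.
move=> e0 k0 R0 T2; have [r00 r0rho] := R0.
have e20 : 0 < 2 * eps by rewrite mulr_gt0.
have two0 : 0 < 2 :> R by [].
have Rr r : r0 <= r -> (r%:E < rho)%E -> radii rho r by move=> r1 r2; split=> //; exact: lt_le_trans r1.
have T2r r : r0 <= r -> (r%:E < rho)%E -> 2 <= T r.
  by move=> r1 r2; apply: le_trans T2 (T_le r00 r1 (Rr r r1 r2)).
have W0 r : 0 <= W kappa r by exact: expR_ge0.
have cinv r : 0 < r -> {for r, continuous (fun x : R => x^-1)}.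
  by move=> r1; exact: (is_derive_cont (is_derive_inv (lt0r_neq0 r1))).
have [mE1 iE1] := @borel_growth R rho r0 T (fun r => A r / r) (W kappa) (2 * eps) e20 r00 r0rho
  (fun r h1 h2 => And5 (is_derive_T (Rr r h1 h2))
    (contM_at (is_derive_cont (is_derive_area (Rr r h1 h2))) (cinv r (lt_le_trans r00 h1)))
    (lt_le_trans two0 (T2r r h1 h2))
    (divr_ge0 (area_ge0 (Rr r h1 h2)) (ltW (lt_le_trans r00 h1)))
    (conj (@W_cont kappa r (Rr r h1 h2)) (W0 r))).
have cm r : radii rho r -> {for r, continuous (fun r => r / pi * mean r)}.
  move=> Rx; apply: (contM_at _ (mean_cont Rx)).
  have cid : {for r, continuous (fun y : R => y)} by exact: cvg_id.
  exact: (contM_at cid (@contC R _ pi^-1 r)).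
have m0 r : radii rho r -> 0 <= r / pi * mean r.
  move=> Rx; have [x0 _] := Rx.
  by rewrite mulr_ge0 ?mean_ge0// divr_ge0 ?(ltW x0)// ltW// pi_gt0.
have [mE2 iE2] := @borel_growth R rho r0 A (fun r => r / pi * mean r) (W kappa) (2 * eps) e20 r00 r0rho
  (fun r h1 h2 => And5 (is_derive_area (Rr r h1 h2)) (cm r (Rr r h1 h2))
    (area_gt0 (Rr r h1 h2)) (m0 r (Rr r h1 h2))
    (conj (@W_cont kappa r (Rr r h1 h2)) (W0 r))).
set E1 := [set r | _] in mE1 iE1; set E2 := [set r | _] in mE2 iE2.
pose E0 : set R := `]0, r0]%classic.
have mE0 : measurable E0 by exact: measurable_itv.
have s0 : E0 `<=` radii rho.
  by move=> r; rewrite /E0/= in_itv/= => /andP[x0 x1]; exact: radii_le R0.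
have s1 : E1 `<=` radii rho by move=> r [x0 x1 _]; apply: Rr => //; exact: ltW.
have s2 : E2 `<=` radii rho by move=> r [x0 x1 _]; apply: Rr => //; exact: ltW.
have s12 : E1 `|` E2 `<=` radii rho by move=> r [/s1|/s2].
have s012 : E0 `|` (E1 `|` E2) `<=` radii rho by move=> r [/s0|/s12].
have m12 : measurable (E1 `|` E2) by exact: measurableU.
have m012 : measurable (E0 `|` (E1 `|` E2)) by exact: measurableU.
have WE0 r : (0 <= (W kappa r)%:E)%E by rewrite lee_fin.
have i0 : (integral mu E0 (fun r => (W kappa r)%:E) < +oo)%E.
  apply: (@le_lt_trans _ _ (integral mu E0 (cst (W kappa r0)%:E))).
    apply: ge0_le_integral => //.
    + exact: W_meas.
    + by move=> r; rewrite /E0/= in_itv/= => /andP[x0 x1]; rewrite lee_fin ler_expR ler_wpM2l// T_le.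
  have muE0 : mu E0 = r0%:E.
    by rewrite /E0 lebesgue_measure_itv/= lte_fin r00 -EFinD subr0.
  rewrite integral_cst//; set v := (X in (_ * X < _)%E).
  by have -> : v = r0%:E by []; rewrite -EFinM ltry.
exists (E0 `|` (E1 `|` E2)); split=> //.
  apply: le_lt_trans (ge0_integral_setU_le mE0 m12 _ _) _ => //; first exact: W_meas.
  apply: lte_add_pinfty => //.
  apply: le_lt_trans (ge0_integral_setU_le mE1 mE2 _ _) _ => //; first exact: W_meas.
  exact: lte_add_pinfty.
exists ((1 + 2 * eps) ^+ 2 / 2 + `|ln (g 0 0)| / (2 * ln 2)) => r Rx nE.
have [x0 x1] := Rx.
have r0r : r0 < r.
  by rewrite ltNge; apply/negP => rr0; apply: nE; left; rewrite /E0/= in_itv/= x0.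
have T2' := T2r r (ltW r0r) x1; split=> //.
apply: off_exceptional => //.
- by rewrite ltNge; apply/negP => h; apply: nE; right; left.
- by rewrite ltNge; apply/negP => h; apply: nE; right; right.
Qed.

End main_estimate.

(** * The critical exponent *)

Section critical_exponent.
Variables (R : realType) (rho : \bar R) (a : R[i] -> R) (m : R[i] -> nat) (lambda : R).
Variables (d : R[i] -> R) (g : R[i] -> R[i] -> R).
Hypothesis rho0 : (0 < rho)%E.
Hypothesis lambda0 : 0 < lambda.
Hypothesis loc : forall z, disc rho z -> [/\ 0 < d z, forall k, pC k z (d z) (g z) &
  forall w, normc (w - z) < d z ->
    [/\ disc rho w, 0 < g z w & a w = (normc (w - z) ^+ 2) ^+ m z * g z w]].
Hypothesis lap : forall z L, disc rho z -> 0 < a z -> is_lap (fun w => ln (a w)) z L -> 4 * lambda * a z <= L.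
Notation mu := (@lebesgue_measure R).
Notation T := (characteristic (disc_integral a)).

Definition critical_exponent : \bar R :=
  ereal_inf [set c%:E | c in [set c : R | 0 < c /\ exp_int a c (radii rho) = +oo%E]].

Hypothesis c_fin : (critical_exponent < +oo)%E.

Let W_meas (kappa : R) (D : set R) : measurable D -> D `<=` radii rho ->
  measurable_fun D (fun r => (expR (kappa * T r))%:E).
Proof.
move=> mD Dr; apply/measurable_EFinP; apply: (measurable_on_radii Dr mD) => r Rr.
have c1 := contM_at (@contC R _ kappa r) (is_derive_cont (is_derive_T loc Rr)).
exact: (continuous_comp c1 (@continuous_expR R _)).
Qed.

Lemma exp_int_le (c c' : R) : c <= c' -> (exp_int a c (radii rho) <= exp_int a c' (radii rho))%E.
Proof.
move=> cc; have mR := @measurable_radii R rho.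
apply: ge0_le_integral => //.
- exact: W_meas.
- exact: W_meas.
- by move=> r Rr; rewrite lee_fin ler_expR ler_wpM2r// (T_ge0 loc Rr).
Qed.

Lemma critical_exponent_ge0 : (0 <= critical_exponent)%E.
Proof. by apply/ereal_infP => _ [c [c0 _] <-]; rewrite lee_fin ltW. Qed.

Lemma critical_exponentE : critical_exponent = (fine critical_exponent)%:E.
Proof. by rewrite fineK// ge0_fin_numE// critical_exponent_ge0. Qed.

Lemma exp_int_above (kappa : R) : fine critical_exponent < kappa -> exp_int a kappa (radii rho) = +oo%E.
Proof.
move=> ck; have : (critical_exponent < kappa%:E)%E by rewrite critical_exponentE lte_fin.
move=> /ereal_inf_lt[_ [c [c0 cI] <-]]; rewrite lte_fin => ck'.
by apply/eqP; rewrite -leye_eq -cI exp_int_le// ltW.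
Qed.

Let bounded_exp (kappa B : R) (D : set R) : 0 <= kappa -> measurable D -> D `<=` radii rho ->
  (forall r, D r -> T r <= B) -> (rho < +oo)%E -> (exp_int a kappa D < +oo)%E.
Proof.
move=> k0 mD DR TB rfin.
have : exists rho' : R, rho = rho'%:E by case: rho rho0 rfin => [r'||]// _ _; exists r'.
move=> [rho' rhoE]; have rho'0 : 0 < rho' by move: rho0; rewrite rhoE lte_fin.
apply: (@le_lt_trans _ _ (integral mu D (cst (expR (kappa * B))%:E))).
  apply: ge0_le_integral => //.
  - exact: W_meas.
  - by move=> r Dr; rewrite lee_fin ler_expR ler_wpM2l// TB.
have muD : (mu D <= rho'%:E)%E.
  have DI : D `<=` `]0, rho'[%classic.
    by move=> r /DR[r0]; rewrite rhoE lte_fin /= in_itv/= r0.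
  apply: (@le_trans _ _ (mu `]0, rho'[%classic)).
    by apply: le_measure; rewrite ?inE//; exact: measurable_itv.
  by rewrite lebesgue_measure_itv/= lte_fin rho'0 -EFinD subr0.
rewrite integral_cst//; set v := (X in (_ * X < _)%E).
apply: (@le_lt_trans _ _ ((expR (kappa * B))%:E * rho'%:E)%E); last by rewrite -EFinM ltry.
by apply: lee_wpmul2l; [rewrite lee_fin expR_ge0|exact: muD].
Qed.

Lemma T_ge_ln : rho = +oo%E -> forall r, 1 <= r -> disc_integral a 1 * ln r <= T r.
Proof.
move=> rhoE r r1; have Rx (x : R) : 0 < x -> radii rho x by move=> x0; split=> //; rewrite rhoE ltry.
have d1 (x : R) : 1 <= x <= r -> is_derive x 1 (fun x => T x - disc_integral a 1 * ln x)
    (disc_integral a x / x - (0 * ln x + disc_integral a 1 * x^-1)).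
  move=> /andP[x1 _]; have x0 : 0 < x by apply: lt_le_trans x1.
  exact: (dB (is_derive_T loc (Rx x x0)) (dM (dC (disc_integral a 1) x) (is_derive1_ln x0))).
have := derive_nondecreasing r1 d1.
rewrite ln1 mulr0 subr0 => /(_ _)/(le_trans (T_ge0 loc (Rx 1 ltr01))); rewrite subr_ge0; apply.
move=> x /andP[x1 _]; have x0 : 0 < x by apply: lt_le_trans x1.
rewrite mul0r add0r -mulrBl mulr_ge0 ?invr_ge0 ?(ltW x0)// subr_ge0.
by apply: (area_le loc) => //; exact: Rx.
Qed.

(** For a finite radius, a bounded T would make the integral of exp (kappa T) finite for every kappa
    >= 0, against the finiteness of the critical exponent. On the whole plane T grows at least like
    a positive multiple of ln r. *)
Lemma T_unbounded (B : R) : exists2 r, radii rho r & B <= T r.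
Proof.
have [rfin|] := ltP rho +oo%E; last first.
  rewrite leye_eq => /eqP rhoE.
  have A1 : 0 < disc_integral a 1 by apply: (area_gt0 loc); split=> //; rewrite rhoE ltry.
  pose r := expR (`|B| / disc_integral a 1).
  have r1 : 1 <= r by rewrite -expR0 ler_expR divr_ge0// ltW.
  exists r; first by split; [exact: expR_gt0|rewrite rhoE ltry].
  apply: le_trans (T_ge_ln rhoE r1); rewrite expRK mulrC divfK ?lt0r_neq0//.
  exact: ler_norm.
apply: contrapT => no; have k0 : 0 <= fine critical_exponent + 1.
  by rewrite addr_ge0// fine_ge0// critical_exponent_ge0.
have mR := @measurable_radii R rho.
have TB r : radii rho r -> T r <= B.
  by move=> Rr; rewrite leNgt; apply/negP => BT; apply: no; exists r => //; exact: ltW.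
have := @bounded_exp (fine critical_exponent + 1) B _ k0 mR (@subset_refl _ _) TB rfin.
by rewrite exp_int_above ?ltrDl// ltxx.
Qed.

Let ln_linear_bound (beta C K : R) : 0 < beta -> exists B : R, forall t : R,
  2 <= t -> beta * t <= C * ln t + K -> t <= B.
Proof.
move=> b0; pose C1 := `|C| + 1; have C10 : 0 < C1 by rewrite ltr_wpDl.
(* The tangent of ln at k has slope 1 / k, so t gets the coefficient [C1] / k = beta / 2, half of
   the one on the left. *)
pose k := 2 * C1 / beta; have k0 : 0 < k by rewrite divr_gt0// mulr_gt0.
exists (2 / beta * (C1 * (ln k - 1) + K)) => t t2 H.
have t0 : 0 < t by apply: lt_le_trans t2.
have lt0 : 0 <= ln t by rewrite ln_ge0//; lra.
have h1 : C * ln t <= C1 * ln t by rewrite ler_wpM2r// /C1; have := ler_norm C; lra.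
have h2 : C1 * ln t <= C1 * (k^-1 * t + (ln k - 1)) by apply: ler_wpM2l; [exact: ltW|exact: ln_le_tangent].
have h3 : C1 * (k^-1 * t) = beta / 2 * t.
  by rewrite /k; have := lt0r_neq0 C10; have := lt0r_neq0 b0 => *; field; apply/andP.
have h4 : beta / 2 * t <= C1 * (ln k - 1) + K by rewrite mulrDr h3 in h2; lra.
by rewrite -ler_pdivrMl ?divr_gt0// invf_div.
Qed.

Lemma lambda_le_critical : (lambda%:E <= critical_exponent)%E.
Proof.
rewrite leNgt; apply/negP; rewrite critical_exponentE lte_fin; set c := fine critical_exponent => cl.
have c0 : 0 <= c by rewrite fine_ge0// critical_exponent_ge0.
have [r0 R0 T2] := T_unbounded 2; have [r00 r0rho] := R0.
have mR := @measurable_radii R rho.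
have [rfin|] := ltP rho +oo%E; last first.
  rewrite leye_eq => /eqP rhoE.
  have Rx (x : R) : 0 < x -> radii rho x by move=> x0; split=> //; rewrite rhoE ltry.
  have mu_ray (x : R) : mu `]x, +oo[%classic = +oo%E by rewrite lebesgue_measure_itv/= ltry.
  have exp_ray (kappa : R) (D : set R) (x : R) : 0 <= kappa -> 0 < x -> measurable D -> D `<=` radii rho ->
      `]x, +oo[ `<=` D -> exp_int a kappa D = +oo%E.
    move=> k0 x0 mD DR xD; apply/eqP; rewrite -leye_eq.
    apply: (@le_trans _ _ (integral mu `]x, +oo[ (fun r => (expR (kappa * T r))%:E))).
      rewrite -(mu_ray x) -[leLHS]mul1e -integral_cst//.
      apply: ge0_le_integral => //.
      - by apply: W_meas => // y /xD/DR.
      - by move=> y /xD/DR Ry; rewrite lee_fin -[leLHS]expR0 ler_expR mulr_ge0// (T_ge0 loc Ry).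
    by apply: ge0_subset_integral => //; exact: W_meas.
  (* Since T >= 0, the weight is at least 1; every positive exponent has infinite integral over a
     ray, and the infimum is 0. *)
  have cz : c = 0.
    apply/eqP; rewrite eq_le c0 andbT leNgt; apply/negP => cp.
    have : (critical_exponent <= (c / 2)%:E)%E.
      apply: ereal_inf_lbound; exists (c / 2) => //; split; first by rewrite divr_gt0.
      apply: (exp_ray _ _ 1) => //; first by rewrite ltW// divr_gt0.
      by move=> x; rewrite /= in_itv/= andbT => x1; apply: Rx; lra.
    by rewrite critical_exponentE lee_fin -/c; lra.
  have A1 : 0 < disc_integral a 1 by apply: (area_gt0 loc); exact: Rx.
  set alpha := disc_integral a 1 in A1.
  (* As eps <= 1, (1 + eps) eps + eps / alpha <= eps (2 + 1 / alpha) <= lambda / 2. *)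
  pose eps := Num.min 1 (lambda / (2 * (alpha^-1 + 2))).
  have ai : 0 < alpha^-1 by rewrite invr_gt0.
  have e0 : 0 < eps by rewrite lt_min ltr01 divr_gt0// mulr_gt0// addr_gt0.
  have e1 : eps <= 1 by rewrite ge_min lexx.
  have e2 : eps * (alpha^-1 + 2) <= lambda / 2.
    have : eps <= lambda / (2 * (alpha^-1 + 2)) by rewrite ge_min lexx orbT.
    rewrite ler_pdivlMr ?mulr_gt0 ?addr_gt0//; lra.
  have [E [mE ER Efin [C HC]]] := main_inequality loc lap e0 (ltW e0) R0 T2.
  have b0 : 0 < lambda - (1 + eps) * eps - eps / alpha.
    have : eps * eps <= eps by rewrite -[leRHS]mulr1 ler_wpM2l// ltW.
    by lra.
  have [B HB] := @ln_linear_bound _ C 0 b0.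
  (* Beyond x, T >= alpha ln r > |B|, so a point outside E would contradict T <= B. Hence E contains
     a ray, against the finiteness of its integral. *)
  pose x := expR (`|B| / alpha) + 1.
  have x1 : 1 < x by rewrite /x ltrDr expR_gt0.
  have : exp_int a eps E = +oo%E.
    apply: (exp_ray _ _ x (ltW e0)) => //; first lra.
    move=> r; rewrite /= in_itv/= andbT => xr; apply: contrapT => nE.
    have r1 : 1 <= r by lra.
    have Rr : radii rho r by apply: Rx; lra.
    have [T2r H] := HC r Rr nE.
    have lr : ln r <= T r / alpha by rewrite ler_pdivlMr// mulrC T_ge_ln.
    have N0 : 0 <= Nram m r.
      by apply: le_trans (Nram_ge loc Rr); rewrite mulr_ge0// ln_ge0.
    have TB : T r <= B.
      apply: HB => //; have : eps * ln r <= eps * (T r / alpha) by rewrite ler_wpM2l// ltW.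
      have -> : eps * (T r / alpha) = eps / alpha * T r by ring.
      set q := eps / alpha; rewrite !mulrBl; lra.
    have : ln (expR (`|B| / alpha)) < ln r by rewrite ltr_ln ?posrE ?expR_gt0//; rewrite /x in xr; lra.
    rewrite expRK => lB; have : `|B| / alpha < T r / alpha by exact: lt_le_trans lr.
    by rewrite ltr_pM2r//; have := ler_norm B; lra.
  by move=> Eoo; rewrite Eoo ltxx in Efin.
(* As eps <= 1, (1 + eps)(c + eps) <= c + eps (c + 2) <= (c + lambda) / 2. *)
pose eps := Num.min 1 ((lambda - c) / (2 * (c + 2))).
have lc : 0 < lambda - c by rewrite subr_gt0.
have c2 : 0 < 2 * (c + 2) by rewrite mulr_gt0// ltr_wpDl.
have e0 : 0 < eps by rewrite lt_min ltr01 divr_gt0.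
have e1 : eps <= 1 by rewrite ge_min lexx.
have e2 : eps * (2 * (c + 2)) <= lambda - c.
  by rewrite -ler_pdivlMr// ge_min lexx orbT.
have k0 : 0 <= c + eps by rewrite addr_ge0// ltW.
have [E [mE ER Efin [C HC]]] := main_inequality loc lap e0 k0 R0 T2.
have b0 : 0 < lambda - (1 + eps) * (c + eps).
  have : eps * eps <= eps by rewrite -[leRHS]mulr1 ler_wpM2l// ltW.
  by lra.
have [rho' rhoE] : exists rho' : R, rho = rho'%:E by case: rho rho0 rfin => [r'||]// _ _; exists r'.
have rho'0 : 0 < rho' by move: rho0; rewrite rhoE lte_fin.
(* For r0 <= r < rho', [K] bounds eps ln r minus the lower bound m(0) ln r of the counting function.
   Smaller radii are covered by T r0, as T is nondecreasing. *)
pose K := eps * `|ln rho'| + (m 0)%:R * `|ln r0|.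
have [B HB] := @ln_linear_bound _ C K b0.
have TB r : radii rho r -> ~ E r -> T r <= Num.max B (T r0).
  move=> Rr nE; rewrite le_max; have [r0r|rr0] := leP r0 r; last first.
    by rewrite (T_le loc _ (ltW rr0) R0) ?orbT//; have [] := Rr.
  have [r_gt0 rr] := Rr; have rr' : r < rho' by move: rr; rewrite rhoE lte_fin.
  have [T2r H] := HC r Rr nE; rewrite HB//.
  have l1 : ln r <= `|ln rho'|.
    by apply: le_trans (ler_norm _); rewrite ler_ln ?posrE// ltW.
  have l2 : - `|ln r0| <= ln r.
    by apply: le_trans (_ : ln r0 <= _); [have := ler_norm (- ln r0); rewrite normrN; lra|rewrite ler_ln ?posrE].
  have h1 : eps * ln r <= eps * `|ln rho'| by rewrite ler_wpM2l// ltW.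
  have h2 : - ((m 0)%:R * `|ln r0|) <= (m 0)%:R * ln r by rewrite -mulrN ler_wpM2l.
  by have := Nram_ge loc Rr; rewrite /K; lra.
have mD : measurable (radii rho `\` E) by exact: measurableD.
have DE : radii rho = E `|` (radii rho `\` E).
  by rewrite setUDr setDv setD0 setUC; apply/esym/setUidPl.
have := exp_int_above (_ : c < c + eps); rewrite ltrDl => /(_ e0).
rewrite /exp_int [X in integral _ X _]DE => oo.
have : (integral mu (E `|` (radii rho `\` E)) (fun r => (expR ((c + eps) * T r))%:E) < +oo)%E.
  apply: le_lt_trans (ge0_integral_setU_le mE mD _ _) _.
  - by apply: W_meas; [exact: measurableU|rewrite -DE].
  - by move=> r _; rewrite lee_fin expR_ge0.
  apply: lte_add_pinfty => //.
  apply: (@bounded_exp _ (Num.max B (T r0))) => //.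
  by move=> r [Rr nE]; exact: TB.
by rewrite oo ltxx.
Qed.

End critical_exponent.

(* Application to the pullback of the form *)
Local Close Scope complex_scope.
Unset Implicit Arguments.

Theorem theorem1p6 (R : realType) (V : topologicalType) (n : nat)
    (M : complex_atlas R V n)
    (compactV : compact [set: V]) (hausdorffV : hausdorff_space V)
    (omega : positive_form M) (lambda : R) (lambda_gt0 : 0 < lambda)
    (curvature : curvature_le_opp omega lambda)
    (rho : \bar R) (rho_gt0 : (0 < rho)%E)
    (f : R[i] -> V) (holf : holomorphic_on M (disc rho) f)
    (nonconstant : exists z w, [/\ disc rho z, disc rho w & f z <> f w])
    (c_finite : (c_growth omega f rho < +oo)%E) :
  let c := fine (c_growth omega f rho) in
  let T := T_char omega f in
  (forall eps : R, 0 < eps ->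
    exists E : set R,
      [/\ measurable E, E `<=` radii rho,
          (exp_T_integral omega f (c + eps) E < +oo)%E &
          exists C : R, forall r, radii rho r -> ~ E r ->
            (lambda - (1 + eps) * (c + eps)) * T r + N_ram M f r
              <= C * ln (T r) + eps * ln r]) /\
  (lambda%:E <= c_growth omega f rho)%E.
Proof.
move=> c T.
pose a := pullback omega f; pose m := ram_mult M f.
(* Radii and positive factors are chosen for all z at once; a point outside the disc gets a dummy
   pair. *)
have /choice[dg Hdg] : forall z, exists p : R * (R[i] -> R), disc rho z ->
    [/\ 0 < p.1, forall k, pC k z p.1 p.2 & forall w, normc (w - z) < p.1 ->
      [/\ disc rho w, 0 < p.2 w & a w = (normc (w - z) ^+ 2) ^+ m z * p.2 w]].
  move=> z; have [Dz|nD] := pselect (disc rho z); last by exists (0, fun=> 0) => /nD.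
  have [r r0 [g [Hg Ha]]] := pullback_local holf nonconstant omega Dz.
  by exists (r, g) => _; split.
(* The real part of [Ric] is L / 4, which turns the curvature hypothesis into the Laplacian
   inequality. *)
have lap z L : disc rho z -> 0 < a z -> is_lap (fun w => ln (a w)) z L -> 4 * lambda * a z <= L.
  move=> Dz az HL; have := curvature (disc rho) f (@disc_open R rho) holf z Dz az.
  by rewrite lecE => /andP[_]; rewrite /Ric (is_lap_ddc HL)/= -/a; lra.
have cE : c_growth omega f rho = critical_exponent rho a by [].
have c_fin : (critical_exponent rho a < +oo)%E by rewrite -cE.
have c0 : 0 <= c by rewrite /c cE fine_ge0// critical_exponent_ge0.
split; last by rewrite cE; exact: (lambda_le_critical rho_gt0 lambda_gt0 Hdg lap c_fin).
move=> eps e0.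
have [r0 R0 T2] := T_unbounded rho_gt0 Hdg c_fin 2.
have k0 : 0 <= c + eps by rewrite addr_ge0// ltW.
have [E [mE ER Efin [C HC]]] := main_inequality Hdg lap e0 k0 R0 T2.
by exists E; split=> //; exists C => r Rr nE; have [] := HC r Rr nE.
Qed.
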